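(* Let $w\not\equiv0$ be a meromorphic function on $\mathbb{C}$ and assume that for some $\varepsilon>0$ $$\limsup_{r\to\infty}\frac{(\log r)^{1+\varepsilon}\log T(r,w)}{r}=0 .$$ Let $0<\delta<1/2$. Then for any complex number $c=c(r)$ (allowed to depend on $r$) with $$0\le|c|\le o\left(\frac{r}{(\log r)^{1+\varepsilon}\log T(r,w)}\right)^{\delta}\qquad(r\to\infty),$$ there is a set $E\subset[1,+\infty)$ of finite logarithmic measure such that $$m\left(r,\frac{w_c}{w}\right)=o(T(r,w)),\qquad r\to\infty,\ r\notin E .$$
   Context: $w_c(z)=w(z+c)$. $m(r,f)=\frac1{2\pi}\int_0^{2\pi}\log^+|f(re^{i\theta})|\,d\theta$ is the Nevanlinna proximity function and $T(r,f)=m(r,f)+N(r,f)$ the Nevanlinna characteristic, with $N(r,f)$ the integrated counting function of poles. $o(X(r))^\delta$ denotes $(g(r))^\delta$ for some nonnegative function $g$ with $g(r)/X(r)\to0$ as $r\to\infty$. A set $E$ has finite logarithmic measure if $\int_E\frac{dt}{t}<\infty$. *)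

(* Defs.v *)
From HB Require Import structures.
From mathcomp Require Import all_boot all_order all_algebra.
From mathcomp Require Import complex.
From mathcomp Require Import all_classical all_reals all_analysis.

Set Implicit Arguments.
Unset Strict Implicit.
Unset Printing Implicit Defensive.
Import Order.TTheory GRing.Theory Num.Theory.
Import numFieldNormedType.Exports.
Import ComplexField.
Local Open Scope classical_set_scope.
Local Open Scope ring_scope.
Local Open Scope complex_scope.

(* `normc z` is the modulus as an element of R, whereas `|z| lives in R[i]. *)
Notation cmod := Normc.normc.

(* [derivable f z 1] over the field R[i] is complex differentiability at z. *)
Definition holomorphic_at (R : realType) (f : R[i] -> R[i]) (p : R[i]) : Prop :=
  \forall z \near (p : R[i]^o), derivable (f : R[i]^o -> R[i]^o) z 1.

Definition is_pole (R : realType) (f : R[i] -> R[i]) (p : R[i]) : Prop :=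
  (\forall z \near (p : R[i]^o)^', derivable (f : R[i]^o -> R[i]^o) z 1) /\
  cmod (f z) @[z --> (p : R[i]^o)^'] --> +oo.

(* A meromorphic function is encoded as a total function whose values at its
   poles are irrelevant. Removable singularities are not allowed, so that the
   function is identically zero iff all its values are 0. *)
Definition meromorphic (R : realType) (f : R[i] -> R[i]) : Prop :=
  forall p, holomorphic_at f p \/ is_pole f p.

Definition pole_order (R : realType) (f : R[i] -> R[i]) (p : R[i]) : nat :=
  xget 0%N [set k | (0 < k)%N /\ exists2 l : R[i]^o, l != 0 &
    ((z - p) ^+ k * f z : R[i]^o) @[z --> (p : R[i]^o)^'] --> l].

Definition log_plus (R : realType) (x : R) : R := Num.max 0 (ln x).

(* Poles and zeros of f on the circle of radius r form a Lebesgue-null set of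
   arguments when f is meromorphic and not identically 0. *)
Definition proximity (R : realType) (r : R) (f : R[i] -> R[i]) : \bar R :=
  (((2 * pi)^-1)%:E * \int[lebesgue_measure]_(t in `[0%R, (2 * pi)%R])
     (log_plus (cmod (f (r%:C * (cos t +i* sin t)))))%:E)%E.

Definition pole_count (R : realType) (t : R) (f : R[i] -> R[i]) : \bar R :=
  (\esum_(p in [set p | is_pole f p /\ (cmod p <= t)%R])
     ((pole_order f p)%:R)%:E)%E.

Definition int_pole_count (R : realType) (r : R) (f : R[i] -> R[i]) : \bar R :=
  (\int[lebesgue_measure]_(t in `]0%R, r])
     ((pole_count t f - pole_count 0 f) * (t^-1)%:E)
   + pole_count 0 f * (ln r)%:E)%E.

Definition characteristic (R : realType) (r : R) (f : R[i] -> R[i]) : \bar R :=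
  (proximity r f + int_pole_count r f)%E.

Definition finite_log_measure (R : realType) (E : set R) : Prop :=
  measurable E /\ (\int[lebesgue_measure]_(t in E) (t^-1)%:E < +oo)%E.

(* Main.v *)
Require Import Defs.
From HB Require Import structures.
From mathcomp Require Import all_boot all_order all_algebra.
From mathcomp Require Import complex.
From mathcomp Require Import all_classical all_reals all_analysis.
From mathcomp Require Import measurable_realfun.
From mathcomp Require Import ring lra.

(** Fix radii r < rho < rho' with gaps of size H = X/2, where
    X = r / ((log r)^(1+eps) log T(r)). The Poisson-Jensen formula on |z| = rho
    writes log |w(z+c)/w(z)| as the increment of a Poisson integral, which is at
    most 4 (|c|/H) times the Poisson integral of |log |w||, minus the increments
    of the Green functions of the zeros and poles a. Each Green increment is
    bounded by log (1 + A^2/|z+c-a|^2) + log (1 + A^2/|z-a|^2) with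
    A^2 = 4 |c| (rho - |a|); its mean over |z| = r is of order
    A/r <= 2 sqrt(|c|/H) (rho' - |a|)/r, and Jensen's formula on |z| = rho' bounds
    the sum of the weights (rho' - |a|)/r by T(rho'). Altogether
    m(r, w_c/w) = O(sqrt(|c|/H) (T(rho') + 1)).
    The hypothesis gives |c| <= X^(1/2) with X -> oo, so |c|/H -> 0, and a
    Borel-type lemma gives T(r + 2X) <= e T(r) outside a set of finite
    logarithmic measure. If T is bounded, w is constant by Liouville's theorem.
    All of this takes place on circles free of zeros and poles; the other radii
    are countable and belong to the exceptional set. *)

Set Implicit Arguments.
Unset Strict Implicit.
Unset Printing Implicit Defensive.
Import Order.TTheory GRing.Theory Num.Theory.
Import numFieldNormedType.Exports.
Import ComplexField.
Local Open Scope classical_set_scope.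
Local Open Scope ring_scope.
Local Open Scope complex_scope.
Local Notation Re := complex.Re.
Local Notation Im := complex.Im.

(** * Complex modulus and continuity *)

Section Modulus.
Variable R : realType.
Implicit Types (z w : R[i]) (x y : R).

(** The delicate terms are the zeros and poles near the circle: the number of them in the disc of
    radius [rho] is controlled only by about [T(rho') * r / H], so counting them would lose a factor
    [r / H]. What saves it is that the Green function of a point [a] near the boundary is small,
    which the factor [rho - |a|] inside [A^2] records. As [rho - |a|] and [H] are both at most
    [rho' - |a|], one gets [A <= 2 * sqrt (|c| / H) * (rho' - |a|)], linear in the quantity that
    Jensen's formula sums; this is the purpose of the second radius [rho']. The square in
    [log (1 + A^2 / |z - b|^2)] makes its circle mean accessible: [|z - b|^2 + A^2] is at most the
    square of a rescaled distance, whose logarithm has a known mean, and the bound is uniform in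
    [b]. In the Poisson part the increment of the kernel is bounded relative to the kernel itself,
    which is symmetric in the two angles, so that averaging over [|z| = r] costs nothing. No branch
    of a complex logarithm is ever chosen: the Poisson formula for [ln |F|] comes from
    differentiation in a dilation parameter. *)

Lemma cmodE z : cmod z = Num.sqrt (Re z ^+ 2 + Im z ^+ 2).
Proof. by case: z. Qed.

Lemma normcE z : `|z| = (cmod z)%:C :> R[i].
Proof. by rewrite normc_def cmodE. Qed.

Lemma cmod_ge0 z : 0 <= cmod z.
Proof. by rewrite cmodE sqrtr_ge0. Qed.

Lemma cmodM z w : cmod (z * w) = cmod z * cmod w.
Proof. exact: Normc.normcM. Qed.

Lemma cmodV z : cmod z^-1 = (cmod z)^-1.
Proof. exact: Normc.normcV. Qed.

Lemma cmodD z w : cmod (z + w) <= cmod z + cmod w.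
Proof. exact: le_normcD. Qed.

Lemma cmodN z : cmod (- z) = cmod z.
Proof. exact: normcN. Qed.

Lemma cmod0 : cmod (0 : R[i]) = 0.
Proof. exact: Normc.normc0. Qed.

Lemma cmod1 : cmod (1 : R[i]) = 1.
Proof. exact: Normc.normc1. Qed.

Lemma cmodB_sym z w : cmod (z - w) = cmod (w - z).
Proof. by rewrite -cmodN opprB. Qed.

Lemma cmod_eq0 z : (cmod z == 0) = (z == 0).
Proof.
by apply/eqP/eqP => [/Normc.eq0_normc//|->]; rewrite cmod0.
Qed.

Lemma cmod_gt0 z : (0 < cmod z) = (z != 0).
Proof. by rewrite lt_neqAle cmod_ge0 eq_sym cmod_eq0 andbT. Qed.

Lemma cmodX z n : cmod (z ^+ n) = cmod z ^+ n.
Proof. by elim: n => [|n IH]; rewrite ?expr0 ?cmod1// !exprS cmodM IH. Qed.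

Lemma cmod_real x : cmod x%:C = `|x|.
Proof. by rewrite cmodE /= expr0n addr0 sqrtr_sqr. Qed.

Lemma cmod_sqr z : cmod z ^+ 2 = Re z ^+ 2 + Im z ^+ 2.
Proof. by rewrite cmodE sqr_sqrtr// addr_ge0// sqr_ge0. Qed.

Lemma cmodJ z : cmod (conjc z) = cmod z.
Proof. by rewrite !cmodE; case: z => a b /=; rewrite sqrrN. Qed.

Lemma Re_le_cmod z : `|Re z| <= cmod z.
Proof. by rewrite cmodE -sqrtr_sqr ler_wsqrtr// lerDl sqr_ge0. Qed.

Lemma Im_le_cmod z : `|Im z| <= cmod z.
Proof. by rewrite cmodE -sqrtr_sqr ler_wsqrtr// lerDr sqr_ge0. Qed.

Lemma cmod_le_ReIm z : cmod z <= `|Re z| + `|Im z|.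
Proof.
rewrite -(@ler_pXn2r _ 2)// ?nnegrE ?cmod_ge0 ?addr_ge0//.
rewrite cmod_sqr sqrrD !real_normK ?num_real//.
by rewrite lerD2r lerDl mulrn_wge0// mulr_ge0.
Qed.

Lemma lerB_cmod z w : cmod z - cmod w <= cmod (z - w).
Proof. by rewrite lerBlDr; apply: le_trans (cmodD _ _); rewrite subrK. Qed.

Lemma complex_eta z : z = Re z +i* Im z.
Proof. by case: z. Qed.

Lemma cReM z w : Re (z * w) = Re z * Re w - Im z * Im w.
Proof. by case: z; case: w. Qed.

Lemma cImM z w : Im (z * w) = Re z * Im w + Im z * Re w.
Proof. by case: z; case: w. Qed.

Lemma cReD z w : Re (z + w) = Re z + Re w.
Proof. by case: z; case: w. Qed.

Lemma cImD z w : Im (z + w) = Im z + Im w.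
Proof. by case: z; case: w. Qed.

Lemma cReN z : Re (- z) = - Re z.
Proof. by case: z. Qed.

Lemma cImN z : Im (- z) = - Im z.
Proof. by case: z. Qed.

Lemma complex_ext z w : Re z = Re w -> Im z = Im w -> z = w.
Proof. by case: z => a b; case: w => c d /= -> ->. Qed.

End Modulus.

Section ComplexTopology.
Variable R : realType.
Implicit Types (z p : R[i]) (f g : R[i] -> R[i]).

(** A positive element of [R[i]] has zero imaginary part, so the balls of [R[i]^o], whose radii lie
    in [R[i]], amount to balls with real radii. *)
Lemma nbhsCP p (A : set R[i]) :
  nbhs (p : R[i]^o) A <->
  exists2 d : R, 0 < d & forall z, cmod (z - p) < d -> A z.
Proof.
split.
- move=> /(@nbhs_normP _ R[i]^o)[e /= e0 H].
  have [e1 e2] : e = (Re e)%:C /\ 0 < Re e.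
    move: e0; rewrite ltcE => /andP[/eqP /= e1 e2]; split => //.
    by rewrite [LHS]complex_eta e1.
  exists (Re e) => // z zp; apply: H => /=.
  by rewrite normcE e1 ltcR cmodB_sym.
- move=> [d d0 H]; apply/(@nbhs_normP _ R[i]^o); exists d%:C; first by rewrite /= ltcR.
  by move=> z /=; rewrite normcE ltcR cmodB_sym => /H.
Qed.

Lemma continuousCP (T : Type) (F : set_system T) (FF : Filter F)
    (f : T -> R[i]^o) (l : R[i]^o) :
  f x @[x --> F] --> l <->
  forall e : R, 0 < e -> \forall x \near F, cmod (f x - l) < e.
Proof.
split.
- move=> H e e0; have /H : nbhs (l : R[i]^o) [set z : R[i]^o | cmod (z - l) < e].
    by apply/nbhsCP; exists e.
  by [].
- move=> H A /nbhsCP[d d0 dA]; have := H _ d0.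
  by apply: filterS => x /dA.
Qed.

Lemma continuous_Re p : {for p, continuous (fun z : R[i]^o => Re z)}.
Proof.
apply/(@cvgrPdist_lt _ _ _ (nbhs (p : R[i]^o)) _) => e e0.
apply/nbhsCP; exists e => // z zp.
by rewrite -cReN -cReD; apply: le_lt_trans (Re_le_cmod _) _; rewrite cmodB_sym.
Qed.

Lemma continuous_Im p : {for p, continuous (fun z : R[i]^o => Im z)}.
Proof.
apply/(@cvgrPdist_lt _ _ _ (nbhs (p : R[i]^o)) _) => e e0.
apply/nbhsCP; exists e => // z zp.
by rewrite -cImN -cImD; apply: le_lt_trans (Im_le_cmod _) _; rewrite cmodB_sym.
Qed.

Lemma continuous_cmod p : {for p, continuous (fun z : R[i]^o => cmod z)}.
Proof.
apply/(@cvgrPdist_lt _ _ _ (nbhs (p : R[i]^o)) _) => e e0.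
apply/nbhsCP; exists e => // z zp.
rewrite ltr_norml; apply/andP; split.
  by rewrite ltrNl opprB (le_lt_trans (lerB_cmod _ _)).
by rewrite (le_lt_trans (lerB_cmod _ _))// cmodB_sym.
Qed.

Lemma continuous_Complex (T : topologicalType) (a b : T -> R) t :
  {for t, continuous a} -> {for t, continuous b} ->
  {for t, continuous ((fun t => a t +i* b t) : T -> R[i]^o)}.
Proof.
move=> ca cb; apply/continuousCP => e e0.
have e20 : 0 < e / 2 by rewrite divr_gt0.
move/cvgrPdist_lt : ca => /(_ _ e20) ca.
move/cvgrPdist_lt : cb => /(_ _ e20) cb.
near=> s; apply: le_lt_trans (cmod_le_ReIm _) _ => /=.
rewrite [ltRHS](splitr e) ltrD//.
  by rewrite distrC; near: s.
by rewrite distrC; near: s.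
Unshelve. all: by end_near. Qed.

(** The first-order form has no division, includes the point [p] itself, and composes directly with
    curves. *)
Lemma derivableCP f p :
  derivable (f : R[i]^o -> R[i]^o) p 1 <->
  exists d, forall e : R, 0 < e -> exists2 r : R, 0 < r &
    forall z, cmod (z - p) < r ->
      cmod (f z - f p - d * (z - p)) <= e * cmod (z - p).
Proof.
split.
- move=> /cvg_ex[/= l H0]; have H := (continuousCP _ _ _).1 H0.
  exists l => e e0.
  have [r r0 Hr] := (nbhsCP 0 (fun h : R[i] => h != 0 ->
    cmod (h^-1 *: (f (h%:A + p) - f p) - l) < e)).1 (H _ e e0); exists r => // z zp.
  have [->|zNp] := eqVneq z p; first by rewrite !subrr mulr0 subr0 cmod0 mulr0.
  have := Hr (z - p); rewrite subr0 => /(_ zp); rewrite subr_eq0 => /(_ zNp).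
  have -> : (z - p)%:A + p = z by rewrite /GRing.scale/= mulr1 subrK.
  move=> /ltW K; apply: le_trans (ler_wpM2r (cmod_ge0 _) K).
  rewrite -cmodM le_eqVlt; apply/orP; left; apply/eqP; congr (cmod _).
  rewrite mulrBl; congr (_ - _).
  by rewrite /GRing.scale/= mulrC mulVKf// subr_eq0.
- move=> [d H]; apply/cvg_ex; exists d; apply/continuousCP => e e0.
  have e20 : 0 < e / 2 by rewrite divr_gt0.
  have [r r0 Hr] := H _ e20; 
  apply: (nbhsCP 0 (fun h : R[i] => h != 0 ->
    cmod (h^-1 *: (f (h%:A + p) - f p) - d) < e)).2.
  exists r => // h; rewrite subr0 => hr h0.
  have {Hr} := Hr (h + p); rewrite addrK => /(_ hr) K.
  have -> : h%:A + p = h + p by rewrite /GRing.scale/= mulr1.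
  have -> : h^-1 *: (f (h + p) - f p) - d =
    h^-1 * (f (h + p) - f p - d * h).
    rewrite mulrBr; congr (_ - _).
    by rewrite mulrC mulfK.
  rewrite cmodM cmodV mulrC.
  apply: le_lt_trans (_ : _ <= e / 2) _; last by lra.
  by rewrite ler_pdivrMr// cmod_gt0.
Qed.

Lemma derivable_cvgC f p : derivable (f : R[i]^o -> R[i]^o) p 1 ->
  {for p, continuous (f : R[i]^o -> R[i]^o)}.
Proof. by move=> /derivable1_diffP/differentiable_continuous. Qed.

End ComplexTopology.

(** * Integrals over real intervals *)

Section RealIntegral.
Variable R : realType.
Implicit Types (a b c K : R) (u v : R -> R).

Definition rint a b u : R := \int[lebesgue_measure]_(x in `[a, b]) u x.

(** Continuity is two-sided even at the end points: the integrands are defined on the whole line,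
    and the condition restricts to subintervals without subspace topologies. *)
Definition cont_on (V : topologicalType) a b (u : R -> V) :=
  forall t, a <= t <= b -> {for t, continuous u}.

Lemma cont_on_within a b u : cont_on a b u -> {within `[a, b], continuous u}.
Proof.
move=> H; apply: continuous_in_subspaceT => t /set_mem /=.
by rewrite in_itv/= => /H.
Qed.

Lemma integrable_cont a b u : cont_on a b u ->
  lebesgue_measure.-integrable `[a, b] (EFin \o u).
Proof.
move=> H; apply: continuous_compact_integrable; first exact: segment_compact.
exact: cont_on_within.
Qed.

Lemma eq_Rint a b u v : (forall t, a <= t <= b -> u t = v t) ->
  rint a b u = rint a b v.
Proof.
by move=> H; apply: eq_Rintegral => t /set_mem/=; rewrite in_itv/= => /H.
Qed.

Lemma RintD a b u v : cont_on a b u -> cont_on a b v ->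
  rint a b (fun t => u t + v t) = rint a b u + rint a b v.
Proof. by move=> cu cv; rewrite /rint RintegralD//; exact: integrable_cont. Qed.

Lemma RintB a b u v : cont_on a b u -> cont_on a b v ->
  rint a b (fun t => u t - v t) = rint a b u - rint a b v.
Proof. by move=> cu cv; rewrite /rint RintegralB//; exact: integrable_cont. Qed.

Lemma RintZ a b K u : cont_on a b u ->
  rint a b (fun t => K * u t) = K * rint a b u.
Proof. by move=> cu; rewrite /rint RintegralZl//; exact: integrable_cont. Qed.

Lemma Rint_cst a b K : a <= b -> rint a b (fun=> K) = K * (b - a).
Proof.
move=> ab; rewrite /rint Rintegral_cst//; congr (_ * _).
rewrite /= (lebesgue_measure_itv `[a, b]) /= lte_fin; move: ab.
by rewrite le_eqVlt => /predU1P[->|ab]; rewrite ?ltxx ?subrr// ab.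
Qed.

Lemma Rint_split a b c u : a <= c -> c <= b -> cont_on a b u ->
  rint a b u = rint a c u + rint c b u.
Proof.
move=> ac cb cu.
have := @Rintegral_itvB R u (BLeft a) (BRight b) c (integrable_cont cu).
rewrite !bnd_simp => /(_ ac cb); rewrite /rint => /eqP.
rewrite subr_eq addrC => /eqP ->; congr (_ + _).
apply: Rintegral_itv_obnd_cbnd; apply: integrableS (integrable_cont cu) => //.
by apply: subset_itvr; rewrite bnd_simp.
Qed.

Lemma le_Rint a b u v : cont_on a b u -> cont_on a b v ->
  (forall t, a <= t <= b -> u t <= v t) -> rint a b u <= rint a b v.
Proof.
move=> cu cv H; apply: le_Rintegral; [by []|exact: integrable_cont|exact: integrable_cont|].
by move=> t /=; rewrite in_itv/= => /H.
Qed.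

Lemma Rint_ge0 a b u : (forall t, a <= t <= b -> 0 <= u t) -> 0 <= rint a b u.
Proof. by move=> H; apply: Rintegral_ge0 => t /=; rewrite in_itv/= => /H. Qed.

Lemma Rint_bound a b u K : a <= b -> cont_on a b u ->
  (forall t, a <= t <= b -> `|u t| <= K) -> `|rint a b u| <= K * (b - a).
Proof.
move=> ab cu H; rewrite -Rint_cst//.
have cc : cont_on a b (fun=> K) by move=> t _; exact: cvg_cst.
have cN : cont_on a b (fun=> - K) by move=> t _; exact: cvg_cst.
rewrite ler_norml; apply/andP; split; last first.
  by apply: le_Rint => // t /H; exact: le_trans (ler_norm _).
have -> : - rint a b (fun=> K) = rint a b (fun=> - K).
  by rewrite !Rint_cst// mulNr.
by apply: le_Rint => // t /H; rewrite ler_norml => /andP[].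
Qed.

Lemma Rint_FTC a b (U u : R -> R) : a <= b ->
  (forall t, a <= t <= b -> is_derive t 1 U (u t)) -> cont_on a b u ->
  rint a b u = U b - U a.
Proof.
rewrite le_eqVlt => /predU1P[<-|ab] dU cu.
  by rewrite /rint set_itv1 Rintegral_set1 subrr.
have cU : cont_on a b U.
  by move=> t /dU [+ _] => /derivable1_diffP/differentiable_continuous.
have aab : a <= a <= b by rewrite lexx ltW.
have bab : a <= b <= b by rewrite lexx ltW.
rewrite /rint /Rintegral (@continuous_FTC2 _ u U a b ab)//.
- exact: cont_on_within.
- split => [t /[!in_itv]/= /andP[at_ tb]||].
  + by have [|] := dU t; rewrite ?(ltW at_) ?(ltW tb).
  + exact: cvg_at_right_filter (cU _ aab).
  + exact: cvg_at_left_filter (cU _ bab).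
- move=> t /[!in_itv]/= /andP[at_ tb]; rewrite derive1E.
  by have [|] := dU t; rewrite ?(ltW at_) ?(ltW tb).
Qed.

End RealIntegral.

(** * Integrals and derivatives of complex-valued functions of a real variable *)

Section ComplexIntegral.
Variable R : realType.
Implicit Types (a b c K : R) (f g : R -> R[i]).

Definition ccont_on a b f := cont_on a b (f : R -> R[i]^o).

Lemma ccont_Re a b f : ccont_on a b f -> cont_on a b (fun t => Re (f t)).
Proof.
move=> cf t tab.
exact: (@continuous_comp _ _ _ (f : R -> R[i]^o) (fun z : R[i]^o => Re z) t (cf _ tab) (@continuous_Re _ _)).
Qed.

Lemma ccont_Im a b f : ccont_on a b f -> cont_on a b (fun t => Im (f t)).
Proof.
move=> cf t tab.
exact: (@continuous_comp _ _ _ (f : R -> R[i]^o) (fun z : R[i]^o => Im z) t (cf _ tab) (@continuous_Im _ _)).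
Qed.

Lemma ccontD a b f g : ccont_on a b f -> ccont_on a b g ->
  ccont_on a b (fun t => f t + g t).
Proof. by move=> cf cg t tab; apply: cvgD; [exact: cf|exact: cg]. Qed.

Lemma ccontB a b f g : ccont_on a b f -> ccont_on a b g ->
  ccont_on a b (fun t => f t - g t).
Proof. by move=> cf cg t tab; apply: cvgB; [exact: cf|exact: cg]. Qed.

Lemma ccontM a b f g : ccont_on a b f -> ccont_on a b g ->
  ccont_on a b (fun t => f t * g t).
Proof. by move=> cf cg t tab; apply: cvgM; [exact: cf|exact: cg]. Qed.

Lemma ccont_cst a b (k : R[i]) : ccont_on a b (fun=> k).
Proof. by move=> t _; exact: cvg_cst. Qed.

Definition cint a b f : R[i] :=
  rint a b (fun t => Re (f t)) +i* rint a b (fun t => Im (f t)).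

Lemma eq_cint a b f g : (forall t, a <= t <= b -> f t = g t) ->
  cint a b f = cint a b g.
Proof. by move=> H; congr Complex; apply: eq_Rint => t /H ->. Qed.

Lemma cintD a b f g : ccont_on a b f -> ccont_on a b g ->
  cint a b (fun t => f t + g t) = cint a b f + cint a b g.
Proof.
move=> cf cg; apply: complex_ext => /=; rewrite ?cReD ?cImD /=.
  by rewrite -RintD; [|exact: ccont_Re..]; apply: eq_Rint => t _; rewrite cReD.
by rewrite -RintD; [|exact: ccont_Im..]; apply: eq_Rint => t _; rewrite cImD.
Qed.

Lemma cintB a b f g : ccont_on a b f -> ccont_on a b g ->
  cint a b (fun t => f t - g t) = cint a b f - cint a b g.
Proof.
move=> cf cg; apply: complex_ext => /=; rewrite ?cReD ?cImD ?cReN ?cImN /=.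
  rewrite -RintB; [|exact: ccont_Re..].
  by apply: eq_Rint => t _; rewrite cReD cReN.
rewrite -RintB; [|exact: ccont_Im..].
by apply: eq_Rint => t _; rewrite cImD cImN.
Qed.

Lemma cintZ a b (k : R[i]) f : ccont_on a b f ->
  cint a b (fun t => k * f t) = k * cint a b f.
Proof.
move=> cf; have cr := ccont_Re cf; have ci := ccont_Im cf.
have Z x (u : R -> R) : cont_on a b u -> cont_on a b (fun t => x * u t).
  by move=> cu t tab; apply: cvgMr; exact: cu.
apply: complex_ext; rewrite ?cReM ?cImM /=.

  rewrite -!RintZ// -RintB; [|exact: Z..].
  by apply: eq_Rint => t _; rewrite cReM.
rewrite -!RintZ// -RintD; [|exact: Z..].
by apply: eq_Rint => t _; rewrite cImM.
Qed.

Lemma cint_cst a b (k : R[i]) : a <= b -> cint a b (fun=> k) = k * (b - a)%:C.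
Proof.
move=> ab; apply: complex_ext; rewrite ?cReM ?cImM /= Rint_cst//.
  by rewrite mulr0 subr0.
by rewrite mulr0 add0r.
Qed.

Lemma cint_split a b c f : a <= c -> c <= b -> ccont_on a b f ->
  cint a b f = cint a c f + cint c b f.
Proof.
move=> ac cb cf; apply: complex_ext; rewrite ?cReD ?cImD /=; apply: Rint_split => //.
  exact: ccont_Re.
exact: ccont_Im.
Qed.

(** Real and imaginary parts are bounded separately, hence the factor 2; it is harmless, since the
    bound serves for limits and for unspecified constants. *)
Lemma cint_bound a b f K : a <= b -> ccont_on a b f ->
  (forall t, a <= t <= b -> cmod (f t) <= K) ->
  cmod (cint a b f) <= 2 * K * (b - a).
Proof.
move=> ab cf H; apply: le_trans (cmod_le_ReIm _) _ => /=.
rewrite -mulrA mulr_natl mulr2n; apply: lerD; apply: Rint_bound => //.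
- exact: ccont_Re.
- by move=> t /H; exact: le_trans (Re_le_cmod _).
- exact: ccont_Im.
- by move=> t /H; exact: le_trans (Im_le_cmod _).
Qed.

(** Componentwise, so that the real fundamental theorem of calculus applies to each part. *)
Definition cder (g : R -> R[i]) (t : R) (d : R[i]) :=
  is_derive t 1 (fun t => Re (g t)) (Re d) /\
  is_derive t 1 (fun t => Im (g t)) (Im d).

Lemma cder_cont g t d : cder g t d -> {for t, continuous (g : R -> R[i]^o)}.
Proof.
move=> [[dr _] [di _]].
have -> : (g : R -> R[i]^o) = (fun t => Re (g t) +i* Im (g t)).
  by apply/funext => s; exact: complex_eta.
apply: continuous_Complex.
  exact/differentiable_continuous/derivable1_diffP.
exact/differentiable_continuous/derivable1_diffP.
Qed.

Lemma cint_FTC a b (G g : R -> R[i]) : a <= b ->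
  (forall t, a <= t <= b -> cder G t (g t)) -> ccont_on a b g ->
  cint a b g = G b - G a.
Proof.
move=> ab dG cg; apply: complex_ext; rewrite ?cReD ?cImD ?cReN ?cImN /=.
  apply: (@Rint_FTC _ _ _ (fun t => Re (G t))) => //.
    by move=> t /dG[].
  exact: ccont_Re.
apply: (@Rint_FTC _ _ _ (fun t => Im (G t))) => //.
  by move=> t /dG[].
exact: ccont_Im.
Qed.

Lemma is_deriveRP (u : R -> R) (t d : R) : is_derive t 1 u d <->
  forall e, 0 < e -> exists2 r : R, 0 < r &
    forall s, `|s - t| < r -> `|u s - u t - d * (s - t)| <= e * `|s - t|.
Proof.
split.
- move=> [/cvg_ex[/= l Hl] <-] e e0.
  have -> : 'D_1 u t = l by apply: cvg_lim.
  move/cvgrPdist_lt : Hl => /(_ _ e0) /nbhs_normP[r /= r0 Hr].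
  exists r => // s st.
  have [->|sNt] := eqVneq s t; first by rewrite !subrr mulr0 subr0 normr0 mulr0.
  have := Hr (s - t); rewrite /= sub0r normrN => /(_ st).
  rewrite subr_eq0 => /(_ sNt); rewrite /GRing.scale/= mulr1 subrK => /ltW K.
  apply: le_trans (ler_wpM2r (normr_ge0 _) K); rewrite -normrM distrC mulrBl.
  by rewrite mulrAC mulVf ?subr_eq0// mul1r.
- move=> H.
  have Hl : h^-1 *: (u (h *: 1 + t) - u t) @[h --> 0^'] --> d.
    apply/cvgrPdist_lt => e e0; have e20 : 0 < e / 2 by rewrite divr_gt0.
    have [r r0 Hr] := H _ e20; apply/nbhs_normP; exists r => //= h.
    rewrite /= sub0r normrN => hr h0.
    rewrite /GRing.scale/= mulr1.
    have := Hr (h + t); rewrite addrK => /(_ hr) K.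
    rewrite distrC -(ltr_pM2r (_ : 0 < `|h|)) ?normr_gt0// -normrM mulrBl.
    rewrite mulrAC mulVf// mul1r; apply: le_lt_trans K _.
    by rewrite ltr_pM2r ?normr_gt0//; lra.
  by apply: DeriveDef; [apply/cvg_ex; exists d|exact: cvg_lim Hl].
Qed.

Definition hasder (f : R[i] -> R[i]) (p d : R[i]) :=
  forall e : R, 0 < e -> exists2 r : R, 0 < r &
    forall z, cmod (z - p) < r ->
      cmod (f z - f p - d * (z - p)) <= e * cmod (z - p).

(** Curves get the same first-order form as [hasder], so that the chain rule becomes a comparison of
    remainders. *)
Lemma cderP g (t : R) d : cder g t d <->
  forall e, 0 < e -> exists2 r : R, 0 < r &
    forall s, `|s - t| < r -> cmod (g s - g t - d * (s - t)%:C) <= e * `|s - t|.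
Proof.
have rr s : Re (g s - g t - d * (s - t)%:C) =
    Re (g s) - Re (g t) - Re d * (s - t).
  by rewrite !cReD !cReN cReM /= mulr0 subr0.
have ii s : Im (g s - g t - d * (s - t)%:C) =
    Im (g s) - Im (g t) - Im d * (s - t).
  by rewrite !cImD !cImN cImM /= mulr0 add0r.
split.
- move=> [/is_deriveRP dr /is_deriveRP di] e e0.
  have e20 : 0 < e / 2 by rewrite divr_gt0.
  have [r1 r10 H1] := dr _ e20; have [r2 r20 H2] := di _ e20.
  exists (Num.min r1 r2); first by rewrite lt_min r10.
  move=> s; rewrite lt_min => /andP[s1 s2].
  apply: le_trans (cmod_le_ReIm _) _; rewrite rr ii.
  by rewrite [in leRHS](splitr e) mulrDl lerD ?H1 ?H2.
- move=> H; split; apply/is_deriveRP => e e0; have [r r0 Hr] := H _ e0;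
    exists r => // s sr.
    by rewrite -rr; exact: le_trans (Re_le_cmod _) (Hr _ sr).
  by rewrite -ii; exact: le_trans (Im_le_cmod _) (Hr _ sr).
Qed.

Lemma cder_comp (f : R[i] -> R[i]) g t d d' :
  hasder f (g t) d -> cder g t d' -> cder (fun s => f (g s)) t (d * d').
Proof.
move=> Hf /[dup] Hg /cderP Hg'; apply/cderP => e e0.
have M0 : 0 < cmod d + 1 by rewrite ltr_wpDl// cmod_ge0.
have N0 : 0 < cmod d' + 1 by rewrite ltr_wpDl// cmod_ge0.
have [r r0 Hr] := Hf (e / 2 / (cmod d' + 1)) ltac:(by rewrite !divr_gt0).
have e1 : 0 < Num.min 1 (e / 2 / (cmod d + 1)) by rewrite lt_min ltr01 !divr_gt0.
have [r1 r10 Hr1] := Hg' _ e1.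
exists (Num.min r1 (r / (cmod d' + 1))); first by rewrite lt_min r10 divr_gt0.
move=> s; rewrite lt_min ltr_pdivlMr// => /andP[s1 s2].
have K := Hr1 _ s1.
have K1 : cmod (g s - g t) <= (cmod d' + 1) * `|s - t|.
  rewrite -[_ - g t](subrK (d' * (s - t)%:C)).
  apply: le_trans (cmodD _ _) _; rewrite cmodM cmod_real mulrDl mul1r addrC lerD2l.
  apply: le_trans K _; rewrite ler_piMl// ?normr_ge0//.
  by rewrite ge_min lexx.
have K2 : cmod (g s - g t) < r by apply: le_lt_trans K1 _; rewrite mulrC.
have -> : f (g s) - f (g t) - d * d' * (s - t)%:C =
  (f (g s) - f (g t) - d * (g s - g t)) + d * (g s - g t - d' * (s - t)%:C).
  by ring.
apply: le_trans (cmodD _ _) _; rewrite cmodM.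
rewrite [in leRHS](splitr e) mulrDl; apply: lerD.
  apply: le_trans (Hr _ K2) _.
  rewrite mulrAC ler_pdivrMr// -!mulrA ler_pM2l// ler_pM2l ?invr_gt0//.
  by rewrite mulrC.
apply: le_trans (ler_wpM2l (cmod_ge0 _) K) _.
apply: le_trans (_ : _ <= (cmod d + 1) * (e / 2 / (cmod d + 1) * `|s - t|)) _; last first.
  by rewrite mulrA [(cmod d + 1) * _]mulrC divfK// gt_eqF.
apply: ler_pM; rewrite ?cmod_ge0 ?mulr_ge0 ?(ltW e1)//; first by rewrite lerDl.
by rewrite ler_wpM2r// ge_min lexx orbT.
Qed.

Lemma cderD f g t d d' : cder f t d -> cder g t d' ->
  cder (fun s => f s + g s) t (d + d').
Proof.
move=> [fr fi] [gr gi]; split; rewrite ?cReD ?cImD.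
  under eq_fun do rewrite cReD; exact: is_deriveD.
under eq_fun do rewrite cImD; exact: is_deriveD.
Qed.

Lemma cderM f g t d d' : cder f t d -> cder g t d' ->
  cder (fun s => f s * g s) t (f t * d' + g t * d).
Proof.
move=> [fr fi] [gr gi]; split; rewrite ?cReD ?cImD ?cReM ?cImM.
  under eq_fun do rewrite cReM.
  refine (is_derive_eq (is_deriveB (is_deriveM fr gr) (is_deriveM fi gi)) _).
  by rewrite /GRing.scale/=; ring.
under eq_fun do rewrite cImM.
refine (is_derive_eq (is_deriveD (is_deriveM fr gi) (is_deriveM fi gr)) _).
by rewrite /GRing.scale/=; ring.
Qed.

Lemma cder_cst (k : R[i]) t : cder (fun=> k) t 0.
Proof. by split; exact: is_derive_cst. Qed.

End ComplexIntegral.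

(** * Goursat's bisection argument *)

Section Rectangles.
Variable R : realType.

(* Goursat bisection: an additive rectangle function that is o(size^2) at every
   point vanishes. *)
Lemma rectangle_null (J : R -> R -> R -> R -> R[i]) (a b c d : R) :
  a <= b -> c <= d ->
  (forall a' m b' c' d', a <= a' -> a' <= m -> m <= b' -> b' <= b ->
    c <= c' -> c' <= d' -> d' <= d ->
    J a' b' c' d' = J a' m c' d' + J m b' c' d') ->
  (forall a' b' c' m d', a <= a' -> a' <= b' -> b' <= b ->
    c <= c' -> c' <= m -> m <= d' -> d' <= d ->
    J a' b' c' d' = J a' b' c' m + J a' b' m d') ->
  (forall x y, a <= x <= b -> c <= y <= d -> forall e, 0 < e ->
    exists2 r, 0 < r & forall a' b' c' d', a <= a' <= x -> x <= b' <= b ->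
      c <= c' <= y -> y <= d' <= d -> b' - a' < r -> d' - c' < r ->
      cmod (J a' b' c' d') <= e * ((b' - a') + (d' - c')) ^+ 2) ->
  J a b c d = 0.
Proof.
move=> ab cd add1 add2 loc; apply/eqP; rewrite -cmod_eq0; apply/contraT => K0.
have {}K0 : 0 < cmod (J a b c d) by rewrite lt_neqAle eq_sym K0 cmod_ge0.
set K := cmod _ in K0.
pose w n : R := (b - a) / 2 ^+ n; pose h n : R := (d - c) / 2 ^+ n.
have w0 n : 0 <= w n by rewrite /w mulr_ge0 ?subr_ge0// invr_ge0 exprn_ge0.
have h0 n : 0 <= h n by rewrite /h mulr_ge0 ?subr_ge0// invr_ge0 exprn_ge0.
have wS n : w n = w n.+1 + w n.+1.
  by rewrite /w exprS; field; rewrite expf_neq0.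
have hS n : h n = h n.+1 + h n.+1.
  by rewrite /h exprS; field; rewrite expf_neq0.
pose inv n (p : R * R) := [/\ a <= p.1, p.1 + w n <= b, c <= p.2, p.2 + h n <= d &
  K / 4 ^+ n <= cmod (J p.1 (p.1 + w n) p.2 (p.2 + h n))].
pose nest n (p q : R * R) := [/\ inv n.+1 q, p.1 <= q.1,
  q.1 + w n.+1 <= p.1 + w n, p.2 <= q.2 & q.2 + h n.+1 <= p.2 + h n].
have step n p : inv n p -> exists q, nest n p q.
  case: p => x y [/= ax xb cy yd KJ]; apply: contrapT => /forallNP N.
  have w1 := w0 n.+1; have h1 := h0 n.+1; have w2 := wS n; have h2 := hS n.
  (* If none of the four quarters kept a quarter of the bound [K / 4 ^+ n], additivity would make
     the whole value smaller than [K / 4 ^+ n]. *)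
  have small x' y' : (x' = x \/ x' = x + w n.+1) -> (y' = y \/ y' = y + h n.+1) ->
      cmod (J x' (x' + w n.+1) y' (y' + h n.+1)) < K / 4 ^+ n.+1.
    move=> Hx Hy; rewrite ltNge; apply/negP => H; apply: (N (x', y')).
    by split => /=; [split => //=|..]; case: Hx Hy => ex [] ey; rewrite ?ex ?ey; clear -ax xb cy yd w1 h1 w2 h2; lra.
  have : cmod (J x (x + w n) y (y + h n)) < K / 4 ^+ n.
    rewrite (add1 x (x + w n.+1)); [|lra..].
    rewrite (add2 x _ y (y + h n.+1)); [|lra..].
    rewrite (add2 (x + w n.+1) _ y (y + h n.+1)); [|lra..].
    have -> : x + w n = x + w n.+1 + w n.+1 by rewrite w2 addrA.
    have -> : y + h n = y + h n.+1 + h n.+1 by rewrite h2 addrA.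
    have s1 := small x y (or_introl erefl) (or_introl erefl).
    have s2 := small _ y (or_intror erefl) (or_introl erefl).
    have s3 := small x _ (or_introl erefl) (or_intror erefl).
    have s4 := small _ _ (or_intror erefl) (or_intror erefl).
    have -> : K / 4 ^+ n = K / 4 ^+ n.+1 * 4.
      by rewrite exprS; field; rewrite expf_neq0.
    move: s1 s2 s3 s4.
    set A := J _ _ _ _; set B := J _ _ _ _; set C := J _ _ _ _; set D := J _ _ _ _.
    have := cmodD (A + C) (B + D); have := cmodD A C; have := cmodD B D.
    by lra.
  by rewrite ltNge KJ.
pose s := fix s n := if n is n'.+1 then xget (s n') (nest n' (s n')) else (a, c).
have sinv n : inv n (s n).
  elim: n => [|n IH].
    rewrite /inv /= /w /h expr0 !divr1 ![_ + (_ - _)]addrC !subrK.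
    by rewrite !lexx.
  by have [] := xgetPex (s n) (step _ _ IH).
have snest n : nest n (s n) (s n.+1) := xgetPex (s n) (step _ _ (sinv n)).
have s1le n m : (n <= m)%N -> (s n).1 <= (s m).1 /\ (s m).1 + w m <= (s n).1 + w n.
  move/subnK <-; elim: (m - n)%N => [|k [IH1 IH2]]; first by rewrite add0n !lexx.
  by have [_ + + _ _] := snest (k + n)%N; rewrite addSn; split; lra.
have s2le n m : (n <= m)%N -> (s n).2 <= (s m).2 /\ (s m).2 + h m <= (s n).2 + h n.
  move/subnK <-; elim: (m - n)%N => [|k [IH1 IH2]]; first by rewrite add0n !lexx.
  by have [_ _ _ + +] := snest (k + n)%N; rewrite addSn; split; lra.
have limit (u v : nat -> R) : (forall n, 0 <= v n) ->
    (forall n m, (n <= m)%N -> u n <= u m /\ u m + v m <= u n + v n) ->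
    exists x, forall n, u n <= x <= u n + v n.
  move=> v0 H; exists (sup (range u)) => n.
  have ubn k : ubound (range u) (u k + v k).
    move=> _ [m _ <-]; case: (leP k m) => [/H[_]|/ltW/H[+ _]].
      by have := v0 m; lra.
    by have := v0 k; lra.
  apply/andP; split; first by apply: ub_le_sup; [exists (u n + v n)|exists n].
  by apply: ge_sup => //; exists (u n), n.
have [x Hx] := limit _ _ w0 s1le; have [y Hy] := limit _ _ h0 s2le.
have xab : a <= x <= b.
  by have := Hx 0; have [/= ] := sinv 0; lra.
have ycd : c <= y <= d.
  by have := Hy 0; have [/= ] := sinv 0; lra.
pose L := (b - a) + (d - c).
have L0 : 0 <= L by rewrite /L; lra.
(* At level [n] the sides add up to [L / 2 ^+ n], so this constant bounds the value of [J] by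
   [K / 4 ^+ n] times [L ^+ 2 / (2 * (L + 1) ^+ 2) < 1], against the invariant. *)
have [r r0 Hr] := loc x y xab ycd (K / (2 * (L + 1) ^+ 2))
  ltac:(by rewrite divr_gt0// mulr_gt0// exprn_gt0// ltr_wpDl).
pose n := Num.Def.archi_bound ((L + 1) / r).
have nr : (L + 1) / r < 2 ^+ n by apply: upper_nthrootP.
have p2 : 0 < 2 ^+ n :> R by rewrite exprn_gt0.
have wnr : w n < r.
  rewrite /w ltr_pdivrMr// mulrC; move: nr; rewrite ltr_pdivrMr//.
  by rewrite /L; lra.
have hnr : h n < r.
  rewrite /h ltr_pdivrMr// mulrC; move: nr; rewrite ltr_pdivrMr//.
  by rewrite /L; lra.
have [sa sb sc sd sK] := sinv n.
have := Hr (s n).1 ((s n).1 + w n) (s n).2 ((s n).2 + h n).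
rewrite sa sb sc sd !(addrC _ (w n)) !(addrC _ (h n)) !addrK !andbT.
rewrite !(addrC (w n)) !(addrC (h n)).
have /andP[-> ->] := Hx n; have /andP[-> ->] := Hy n.
move=> /(_ isT isT isT isT wnr hnr) H.
have := le_trans sK H.
have -> : w n + h n = L / 2 ^+ n by rewrite /w /h /L -mulrDl.
have -> : 4 ^+ n = (2 ^+ n) ^+ 2 :> R.
  by rewrite exprAC; congr (_ ^+ _); rewrite expr2 -natrM.
rewrite expr_div_n mulrA ler_pM2r ?invr_gt0 ?exprn_gt0//.
rewrite mulrAC ler_pdivlMr; last by rewrite mulr_gt0// exprn_gt0// ltr_wpDl.
rewrite ler_pM2l// => HH; have L2 := sqr_ge0 L.
clear -HH L0 L2; exfalso; lra.
Qed.

End Rectangles.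

(** * Cauchy's formula on circles *)

HB.lock Definition circ (R : realType) (r t : R) : R[i] :=
  r%:C * (cos t +i* sin t).

Section Circle.
Variable R : realType.
Implicit Types (r s t : R).

Lemma ReC_circ r t : Re (circ r t) = r * cos t.
Proof. by rewrite circ.unlock cReM /= mul0r subr0. Qed.

Lemma ImC_circ r t : Im (circ r t) = r * sin t.
Proof. by rewrite circ.unlock cImM /= mul0r addr0. Qed.

Lemma cmod_circ r t : cmod (circ r t) = `|r|.
Proof.
by rewrite cmodE ReC_circ ImC_circ !exprMn -mulrDr cos2Dsin2 mulr1 sqrtr_sqr.
Qed.

Lemma circ_2pi r : circ r (2 * pi) = circ r 0.
Proof. by rewrite circ.unlock (mulr_natl pi 2) cos2pi sin2pi cos0 sin0. Qed.

Lemma cder_circ r t : cder (circ r) t ((0 +i* 1) * circ r t).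
Proof.
split.
  under eq_fun do rewrite ReC_circ.
  rewrite cReM ImC_circ ReC_circ /= mul0r mul1r sub0r.
  refine (is_derive_eq (is_deriveZ r (is_derive_cos t)) _).
  by rewrite /GRing.scale/= mulrN.
under eq_fun do rewrite ImC_circ.
rewrite cImM ImC_circ ReC_circ /= mul0r mul1r add0r.
exact: (is_derive_eq (is_deriveZ r (is_derive_sin t)) _).
Qed.

Lemma circ_cont r t : {for t, continuous (circ r : R -> R[i]^o)}.
Proof. exact: cder_cont (cder_circ r t). Qed.

Lemma circ_ccont r a b : ccont_on a b (circ r).
Proof. by move=> t _; exact: circ_cont. Qed.

Lemma circ_lip r t s : 0 <= r -> cmod (circ r t - circ r s) <= 2 * r * `|t - s|.
Proof.
move=> r0; wlog st : s t / s <= t.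
  move=> H; case: (leP s t) => [/H//|/ltW/H]; by rewrite cmodB_sym distrC.
have cc : ccont_on s t (fun x => (0 +i* 1) * circ r x).
  exact (ccontM (@ccont_cst _ _ _ _) (@circ_ccont _ _ _)).
rewrite -(cint_FTC st (fun x _ => cder_circ r x) cc).
rewrite ger0_norm ?subr_ge0//; apply: (cint_bound st cc).
move=> x _; rewrite cmodM cmod_circ ger0_norm//.
by rewrite cmodE /= expr0n add0r expr1n sqrtr1 mul1r.
Qed.

End Circle.

Section Cauchy.
Variable R : realType.
Implicit Types (f : R[i] -> R[i]).

(** An affine function [al + be * w] has the primitive [al * w + be / 2 * w ^+ 2], so only the error
    of the affine approximation of [f] contributes to the integral along the curve. *)
Lemma edge_estimate f (g g' : R -> R[i]) (a b M N : R) (al be : R[i]) :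
  a <= b -> (forall t, a <= t <= b -> cder g t (g' t)) -> ccont_on a b g' ->
  (forall t, a <= t <= b -> {for g t, continuous (f : R[i]^o -> R[i]^o)}) ->
  (forall t, a <= t <= b -> cmod (f (g t) - (al + be * g t)) <= M) ->
  (forall t, a <= t <= b -> cmod (g' t) <= N) ->
  cmod (cint a b (fun t => f (g t) * g' t) -
    ((al * g b + be / 2 * g b ^+ 2) - (al * g a + be / 2 * g a ^+ 2)))
  <= 2 * (M * N) * (b - a).
Proof.
move=> ab dg cg' cf HM HN.
have cg : ccont_on a b g by move=> t /dg/cder_cont.
have cfg : ccont_on a b (fun t => f (g t)).
  move=> t tab.
  exact: (@continuous_comp _ _ _ (g : R -> R[i]^o) (f : R[i]^o -> R[i]^o) t (cg _ tab) (cf _ tab)).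
have cl : ccont_on a b (fun t => al + be * g t).
  exact (ccontD (@ccont_cst _ _ _ _) (ccontM (@ccont_cst _ _ _ _) cg)).
have <- : cint a b (fun t => (al + be * g t) * g' t) =
    (al * g b + be / 2 * g b ^+ 2) - (al * g a + be / 2 * g a ^+ 2).
  apply: (@cint_FTC _ _ _ (fun t => al * g t + be / 2 * g t ^+ 2)).
  - exact: ab.
  - move=> t /dg dt.
    have dq := cderM (cder_cst (be / 2) t) (cderM dt dt).
    have dl := cderM (cder_cst al t) dt.
    have := cderD dl dq.
    rewrite !mulr0 !addr0.
    have -> : al * g' t + be / 2 * (g t * g' t + g t * g' t) =
       (al + be * g t) * g' t by field.
    by under eq_fun do rewrite -expr2.
  - exact (ccontM cl cg').
rewrite -cintB; [|exact (ccontM cfg cg')|exact (ccontM cl cg')].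
apply: cint_bound; first exact: ab.
  exact (ccontB (ccontM cfg cg') (ccontM cl cg')).
move=> t tab; rewrite -mulrBl cmodM.
by apply: ler_pM; rewrite ?cmod_ge0 ?HM ?HN.
Qed.

Section Polar.
Variables (r : R) (z : R[i]).
Hypothesis (r0 : 0 < r) (zr : cmod z < r).

(** For fixed [s] these points run through a circle of radius [s * r]; as [s] decreases from 1 to 0
    the original circle contracts to [z] inside the disc. *)
Definition ray (s t : R) : R[i] := z + s%:C * (circ r t - z).

Lemma ray1 t : ray 1 t = circ r t.
Proof. by rewrite /ray mul1r addrC subrK. Qed.

Lemma cmod_ray s t : 0 <= s <= 1 -> cmod (ray s t) <= r.
Proof.
move=> /andP[s0 s1].
have -> : ray s t = (1 - s)%:C * z + s%:C * circ r t.
  by rewrite /ray rmorphB/=; ring.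
apply: le_trans (cmodD _ _) _; rewrite !cmodM cmod_circ !cmod_real.
rewrite !ger0_norm ?subr_ge0//; last exact: ltW.
rewrite -[leRHS](subrK (s * r)) lerD2r.
have -> : r - s * r = (1 - s) * r by ring.
by rewrite ler_wpM2l ?subr_ge0// ltW.
Qed.

Lemma cmod_circB t : r - cmod z <= cmod (circ r t - z) <= 2 * r.
Proof.
have c1 : cmod (circ r t) = r by rewrite cmod_circ gtr0_norm.
have := lerB_cmod (circ r t) z; have := cmodD (circ r t) (- z).
by rewrite cmodN c1; have := zr; lra.
Qed.

Lemma circB_neq0 t : circ r t - z != 0.
Proof.
rewrite -cmod_gt0; have /andP[+ _] := cmod_circB t.
by apply: lt_le_trans; rewrite subr_gt0.
Qed.

Lemma cder_ray_s s t : cder (ray^~ t) s (circ r t - z).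
Proof.
have dl : cder (fun s : R => s%:C) s 1.
  by split => /=; [exact: is_derive_id|exact: is_derive_cst].
have := cderD (cder_cst z s) (cderM dl (cder_cst (circ r t - z) s)).
by rewrite mulr0 !add0r mulr1.
Qed.

Lemma cder_ray_t s t : cder (ray s) t (s%:C * ((0 +i* 1) * circ r t)).
Proof.
have := cderD (cder_cst z t) (cderM (cder_cst s%:C t)
  (cderD (cder_circ r t) (cder_cst (- z) t))).
by rewrite mulr0 !addr0 add0r.
Qed.

Lemma ray_lip s t x y : 0 <= x <= 1 ->
  cmod (ray s t - ray x y) <= 2 * r * (`|s - x| + `|t - y|).
Proof.
move=> /andP[x0 x1].
have -> : ray s t - ray x y = (s - x)%:C * (circ r t - z) +
    x%:C * (circ r t - circ r y) by rewrite /ray rmorphB/=; ring.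
apply: le_trans (cmodD _ _) _; rewrite !cmodM !cmod_real mulrDr; apply: lerD.
  by rewrite mulrC ler_wpM2r//; case/andP: (cmod_circB t).
rewrite ger0_norm//; apply: le_trans (circ_lip _ _ (ltW r0)).
by rewrite ler_piMl// cmod_ge0.
Qed.

(* The bisection argument is applied to the parameter rectangle of (s, t), so that
   no Cauchy theorem for general contours is needed. *)
Lemma polar_homotopy f (d : R) : 0 < d -> d <= 1 ->
  (forall s t, d <= s <= 1 -> derivable (f : R[i]^o -> R[i]^o) (ray s t) 1) ->
  cint 0 (2 * pi) (fun t => f (ray 1 t) * (1%:C * ((0 +i* 1) * circ r t))) =
  cint 0 (2 * pi) (fun t => f (ray d t) * (d%:C * ((0 +i* 1) * circ r t))).
Proof.
move=> d0 d1 df.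
pose hor s (c' d' : R) :=
  cint c' d' (fun t => f (ray s t) * (s%:C * ((0 +i* 1) * circ r t))).
pose ver t (a' b' : R) := cint a' b' (fun s => f (ray s t) * (circ r t - z)).
(* The integral of [f] along the image under [ray] of the boundary of a parameter rectangle. *)
pose J a' b' c' d' := hor b' c' d' - hor a' c' d' - (ver d' a' b' - ver c' a' b').
have p0 : 0 <= 2 * pi :> R by rewrite mulr_ge0// pi_ge0.
have cfc s t : d <= s <= 1 -> {for ray s t, continuous (f : R[i]^o -> R[i]^o)}.
  by move=> /df/derivable_cvgC.
have choriz s c' d' : d <= s <= 1 ->
    ccont_on c' d' (fun t => f (ray s t) * (s%:C * ((0 +i* 1) * circ r t))).
  move=> sd; apply: ccontM.
    move=> t _.
    exact: (@continuous_comp _ _ _ (ray s : R -> R[i]^o) (f : R[i]^o -> R[i]^o) t (cder_cont (cder_ray_t s t)) (cfc _ _ sd)).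
  by do 2 (apply: ccontM; first exact: ccont_cst); exact: circ_ccont.
have cvert t a' b' : d <= a' -> b' <= 1 ->
    ccont_on a' b' (fun s => f (ray s t) * (circ r t - z)).
  move=> da' b'1; apply: ccontM; last exact: ccont_cst.
  move=> s /andP[as_ sb].
  have sd : d <= s <= 1 by rewrite (le_trans da')//= (le_trans sb).
  exact: (@continuous_comp _ _ _ (ray^~ t : R -> R[i]^o) (f : R[i]^o -> R[i]^o) s (cder_cont (cder_ray_s s t)) (cfc _ _ sd)).
have : J d 1 0 (2 * pi) = 0.
  apply: (@rectangle_null R J) => //.
  - move=> a' m b' c' d' h1 h2 h3 h4 h5 h6 h7; rewrite /J.
    rewrite /ver (@cint_split _ a' b' m _ h2 h3); last exact: cvert.
    rewrite (@cint_split _ a' b' m _ h2 h3); last exact: cvert.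
    by ring.
  - move=> a' b' c' m d' h1 h2 h3 h4 h5 h6 h7; rewrite /J.
    rewrite /hor (@cint_split _ c' d' m _ h5 h6); last first.
      by apply: choriz; rewrite (le_trans h1)//=.
    rewrite (@cint_split _ c' d' m _ h5 h6); last first.
      by apply: choriz; rewrite h1/= (le_trans h2).
    by ring.
  move=> x y xd yp e e0.
  have [be Hbe] := (derivableCP f (ray x y)).1 (df x y xd).
  (* Each edge integral then differs from the increment of the primitive [Psi] by at most
     [e / 4 * L] times the length of the edge; the [Psi] increments cancel around the rectangle and
     the four lengths add up to [2 * L]. *)
  pose e' := e / (32 * r ^+ 2).
  have e'0 : 0 < e' by rewrite divr_gt0// mulr_gt0// exprn_gt0.
  have [q q0 Hq] := Hbe e' e'0.
  exists (q / (8 * r)); first by rewrite divr_gt0// mulr_gt0.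
  move=> a' b' c' d' /andP[h1 h2] /andP[h3 h4] /andP[h5 h6] /andP[h7 h8] w h.
  have ab : a' <= b' by rewrite (le_trans h2).
  have cd : c' <= d' by rewrite (le_trans h6).
  have x01 : 0 <= x <= 1 by rewrite (le_trans (ltW d0))/= ?(le_trans h1)// (le_trans h3).
  pose L := (b' - a') + (d' - c').
  have L0 : 0 <= L by rewrite /L; lra.
  pose al := f (ray x y) - be * ray x y.
  have close s t : a' <= s <= b' -> c' <= t <= d' ->
      cmod (f (ray s t) - (al + be * ray s t)) <= e' * (2 * r * L).
    move=> sab tcd.
    have K : cmod (ray s t - ray x y) <= 2 * r * L.
      apply: le_trans (ray_lip s t y x01) _.
      rewrite ler_pM2l ?mulr_gt0// /L; apply: lerD.
        rewrite ler_norml; apply/andP; split; lra.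
      rewrite ler_norml; apply/andP; split; lra.
    have K2 : cmod (ray s t - ray x y) < q.
      apply: le_lt_trans K _.
      move: w h; rewrite !ltr_pdivlMr ?mulr_gt0// => w h.
      by rewrite /L; move: w h; lra.
    apply: le_trans (_ : _ <= e' * cmod (ray s t - ray x y)) _; last first.
      by rewrite ler_pM2l.
    rewrite (_ : _ - _ = f (ray s t) - f (ray x y) - be * (ray s t - ray x y)).
      exact: Hq.
    by rewrite /al; ring.
  pose Psi w := al * w + be / 2 * w ^+ 2.
  have Hhor s : a' <= s <= b' ->
      cmod (hor s c' d' - (Psi (ray s d') - Psi (ray s c'))) <=
      2 * (e' * (2 * r * L) * (2 * r)) * (d' - c').
    move=> sab; have sd : d <= s <= 1 by move: sab; lra.
    apply: edge_estimate => //.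
    - by move=> t _; exact: cder_ray_t.
    - by do 2 (apply: ccontM; first exact: ccont_cst); exact: circ_ccont.
    - by move=> t _; exact: cfc.
    - by move=> t tcd; exact: close.
    - move=> t _; rewrite !cmodM cmod_real cmod_circ (gtr0_norm r0).
      rewrite [cmod (0 +i* 1)]cmodE /= expr0n add0r expr1n sqrtr1 mul1r.
      rewrite ger0_norm; last by move: sd; lra.
      by rewrite ler_pM2r//; move: sd; lra.
  have Hver t : c' <= t <= d' ->
      cmod (ver t a' b' - (Psi (ray b' t) - Psi (ray a' t))) <=
      2 * (e' * (2 * r * L) * (2 * r)) * (b' - a').
    move=> tcd.
    apply: (@edge_estimate f (ray^~ t) (fun=> circ r t - z)) => //.
    - by move=> s _; exact: cder_ray_s.
    - exact: ccont_cst.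
    - by move=> s sab; apply: cfc; move: sab; lra.
    - by move=> s sab; exact: close.
    - by move=> s _; case/andP: (cmod_circB t).
  have -> : J a' b' c' d' =
      (hor b' c' d' - (Psi (ray b' d') - Psi (ray b' c')))
      - (hor a' c' d' - (Psi (ray a' d') - Psi (ray a' c')))
      - ((ver d' a' b' - (Psi (ray b' d') - Psi (ray a' d')))
         - (ver c' a' b' - (Psi (ray b' c') - Psi (ray a' c')))).
    by rewrite /J; ring.
  set A := hor b' c' d' - _; set B := hor a' c' d' - _.
  set C := ver d' a' b' - _; set D := ver c' a' b' - _.
  have HA : cmod A <= _ := Hhor b' ltac:(by rewrite ab lexx).
  have HB : cmod B <= _ := Hhor a' ltac:(by rewrite ab lexx).
  have HC : cmod C <= _ := Hver d' ltac:(by rewrite cd lexx).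
  have HD : cmod D <= _ := Hver c' ltac:(by rewrite cd lexx).
  have E : e' * r ^+ 2 = e / 32.
    by rewrite /e'; field; rewrite gt_eqF.
  have T1 : cmod (A - B - (C - D)) <= cmod A + cmod B + cmod C + cmod D.
    have := cmodD (A - B) (- (C - D)); have := cmodD A (- B).
    by have := cmodD C (- D); rewrite !cmodN; lra.
  apply: le_trans T1 _; rewrite -/L.
  have T2 : 2 * (e' * (2 * r * L) * (2 * r)) = e / 4 * L.
    transitivity (8 * (e' * r ^+ 2) * L); first by ring.
    by rewrite E; field.
  rewrite T2 in HA HB HC HD.
  have -> : e * L ^+ 2 = e / 4 * L * (4 * (b' - a') + 4 * (d' - c')).
    by rewrite /L; field.
  have eL : 0 <= e / 4 * L by rewrite mulr_ge0// divr_ge0// ltW.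
  have b0 : 0 <= e / 4 * L * (b' - a') by rewrite mulr_ge0// subr_ge0.
  have c0 : 0 <= e / 4 * L * (d' - c') by rewrite mulr_ge0// subr_ge0.
  by rewrite mulrDr !(mulrCA _ 4) -/L; clear -HA HB HC HD b0 c0; lra.
rewrite /J.
(* By periodicity the two edges [t = 0] and [t = 2 * pi] carry the same integral and cancel. *)
have -> : ver (2 * pi) d 1 = ver 0 d 1.
  by rewrite /ver; apply: eq_cint => s _; rewrite /ray circ_2pi.
by rewrite subrr subr0 => /eqP; rewrite subr_eq0 => /eqP.
Qed.

End Polar.
End Cauchy.

Record holo (R : realType) (f : R[i] -> R[i]) (p : R[i]) : Prop := Holo {
  holo_derivable : derivable (f : R[i]^o -> R[i]^o) p 1 }.

Section Holomorphic.
Variable R : realType.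
Implicit Types (f g : R[i] -> R[i]) (p z : R[i]) (r : R).

Lemma holoD f g p : holo f p -> holo g p -> holo (fun z => f z + g z) p.
Proof. by move=> [hf] [hg]; split; exact: derivableD. Qed.

Lemma holoB f g p : holo f p -> holo g p -> holo (fun z => f z - g z) p.
Proof. by move=> [hf] [hg]; split; exact: derivableB. Qed.

Lemma holoM f g p : holo f p -> holo g p -> holo (fun z => f z * g z) p.
Proof. by move=> [hf] [hg]; split; exact (@derivableM _ R[i]^o f g p 1 hf hg). Qed.

Lemma holoV f p : f p != 0 -> holo f p -> holo (fun z => (f z)^-1) p.
Proof. by move=> f0 [hf]; split; exact (@derivableV _ R[i]^o f p 1 f0 hf). Qed.

Lemma holo_id p : holo (fun z => z) p.
Proof. by split; exact: derivable_id. Qed.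

Lemma holo_cst (k : R[i]) p : holo (fun=> k) p.
Proof. by split; exact: derivable_cst. Qed.

Lemma holoX f p n : holo f p -> holo (fun z => f z ^+ n) p.
Proof.
move=> hf; elim: n => [|n IH].
  have -> : (fun z => f z ^+ 0) = (fun=> 1) by apply/funext => z; rewrite expr0.
  exact (holo_cst 1 p).
have -> : (fun z => f z ^+ n.+1) = (fun z => f z * f z ^+ n).
  by apply/funext => z; rewrite exprS.
exact (holoM hf IH).
Qed.

Lemma holo_comp f g p : holo f (g p) -> holo g p -> holo (fun z => f (g z)) p.
Proof.
move=> [/derivable1_diffP df] [/derivable1_diffP dg]; split; apply/derivable1_diffP.
exact: (differentiable_comp dg df).
Qed.

Lemma holo_near f g p r : 0 < r -> (forall z, cmod (z - p) < r -> f z = g z) ->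
  holo f p -> holo g p.
Proof.
move=> r0 fg; have H : {near (p : R[i]^o), f =1 g}.
  apply: (nbhsCP p (fun z => f z = g z)).2.
  by exists r.
by move=> [hf]; split; exact (@near_eq_derivable _ R[i]^o R[i]^o f g p 1 H hf).
Qed.

Definition cmean (f : R -> R[i]) : R[i] :=
  ((2 * pi)^-1)%:C * cint 0 (2 * pi) f.

Lemma pi2_gt0 : 0 < 2 * pi :> R.
Proof. by rewrite mulr_gt0// pi_gt0. Qed.

Lemma cmeanD (f g : R -> R[i]) : ccont_on 0 (2 * pi) f -> ccont_on 0 (2 * pi) g ->
  cmean (fun t => f t + g t) = cmean f + cmean g.
Proof. by move=> cf cg; rewrite /cmean cintD// mulrDr. Qed.

Lemma cmeanB (f g : R -> R[i]) : ccont_on 0 (2 * pi) f -> ccont_on 0 (2 * pi) g ->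
  cmean (fun t => f t - g t) = cmean f - cmean g.
Proof. by move=> cf cg; rewrite /cmean cintB// mulrBr. Qed.

Lemma cmeanZ k (f : R -> R[i]) : ccont_on 0 (2 * pi) f ->
  cmean (fun t => k * f t) = k * cmean f.
Proof. by move=> cf; rewrite /cmean cintZ// mulrCA. Qed.

Lemma cmean_cst k : cmean (fun=> k) = k.
Proof.
rewrite /cmean cint_cst; last exact: ltW pi2_gt0.
rewrite subr0 mulrCA -rmorphM/= mulVf ?mulr1//.
by rewrite gt_eqF// pi2_gt0.
Qed.

Lemma eq_cmean (f g : R -> R[i]) : f =1 g -> cmean f = cmean g.
Proof. by move=> fg; rewrite /cmean (@eq_cint _ _ _ f g). Qed.

Lemma cmean_bound (f : R -> R[i]) K : ccont_on 0 (2 * pi) f ->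
  (forall t, 0 <= t <= 2 * pi -> cmod (f t) <= K) -> cmod (cmean f) <= 2 * K.
Proof.
move=> cf H; have p0 := pi2_gt0.
rewrite /cmean cmodM cmod_real gtr0_norm ?invr_gt0// ler_pdivrMl//.
apply: le_trans (cint_bound (ltW p0) cf H) _.
by rewrite subr0 mulrC.
Qed.

Lemma ccontV a b (f : R -> R[i]) : (forall t, a <= t <= b -> f t != 0) ->
  ccont_on a b f -> ccont_on a b (fun t => (f t)^-1).
Proof. by move=> f0 cf t tab; apply: cvgV; [exact: f0|exact: cf]. Qed.

Lemma holo_ccont a b f (g : R -> R[i]) : ccont_on a b g ->
  (forall t, a <= t <= b -> holo f (g t)) -> ccont_on a b (fun t => f (g t)).
Proof.
move=> cg hf t tab.
exact: (@continuous_comp _ _ _ (g : R -> R[i]^o) (f : R[i]^o -> R[i]^o) t (cg _ tab) (derivable_cvgC (holo_derivable (hf _ tab)))).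
Qed.

Lemma eq0_cmod z : (forall e : R, 0 < e -> cmod z <= e) -> z = 0.
Proof.
move=> H; apply/eqP; rewrite -cmod_eq0 eq_le cmod_ge0 andbT.
by apply/ler_addgt0Pr => e /H; rewrite add0r.
Qed.

Section CauchyFormula.
Variables (r : R) (z : R[i]).
Hypothesis (r0 : 0 < r) (zr : cmod z < r).

Lemma circB_ccont a b : ccont_on a b (fun t => (circ r t - z)^-1).
Proof.
apply: ccontV; first by move=> t _; exact: circB_neq0.
exact (ccontB (@circ_ccont _ _ _ _) (@ccont_cst _ _ _ _)).
Qed.

Lemma cauchy_kernel_ccont a b : ccont_on a b (fun t => circ r t / (circ r t - z)).
Proof. exact (ccontM (@circ_ccont _ _ _ _) (@circB_ccont _ _)). Qed.

(** The circle is contracted to [z]: the weight [circ r t / (circ r t - z)] stays the same at every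
    scale, while the values of [f] tend to [f z]. The mean of the weight is left as a factor and is
    evaluated separately. *)
Lemma cauchy_weighted f : (forall w, cmod w <= r -> holo f w) ->
  cmean (fun t => f (circ r t) * (circ r t / (circ r t - z))) =
  f z * cmean (fun t => circ r t / (circ r t - z)).
Proof.
move=> hf.
pose k t := circ r t / (circ r t - z).
have ck : ccont_on 0 (2 * pi) k := @cauchy_kernel_ccont _ _.
have cray s : 0 <= s <= 1 -> ccont_on 0 (2 * pi) (fun t => f (ray r z s t)).
  move=> s01; apply: holo_ccont; first by move=> t _; exact: cder_cont (cder_ray_t _ _ _ _).
  by move=> t _; apply: hf; exact: cmod_ray.
have shift d : 0 < d -> d <= 1 ->
    cmean (fun t => f (circ r t) * k t) = cmean (fun t => f (ray r z d t) * k t).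
  move=> d0 d1; rewrite /cmean; congr (_ * _).
  have ii0 : (0 +i* 1 : R[i]) != 0 by rewrite eq_complex /= oner_eq0 andbF.
  apply: (mulfI ii0).
  have c1 := ccontM (cray 1 ltac:(by rewrite ler01 lexx)) ck.
  have c2 := ccontM (cray d ltac:(by rewrite (ltW d0) d1)) ck.
  have -> : cint 0 (2 * pi) (fun t => f (circ r t) * k t) =
      cint 0 (2 * pi) (fun t => f (ray r z 1 t) * k t).
    by apply: eq_cint => t _; rewrite ray1.
  rewrite -(cintZ _ c1) -(cintZ _ c2).
  have hol : forall s t, d <= s <= 1 ->
      holo (fun w => f w / (w - z)) (ray r z s t).
    move=> s t /andP[ds s1]; have s0 : 0 < s := lt_le_trans d0 ds.
    apply: holoM; first by apply: hf; apply: cmod_ray => //; rewrite ltW.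
    apply: holoV; last by apply: holoB; [exact: holo_id|exact: holo_cst].
    rewrite /ray addrC addKr mulf_neq0 ?circB_neq0//.
    by rewrite eq_complex /= eqxx andbT gt_eqF.
  have := polar_homotopy r0 zr d0 d1 (fun s t H => holo_derivable (hol s t H)).
  (* The scale [s] in the velocity of the contracted circle cancels against the [s] in
     [ray r z s t - z]. *)
  have E s : 0 < s -> cint 0 (2 * pi) (fun t => f (ray r z s t) / (ray r z s t - z) *
        (s%:C * ((0 +i* 1) * circ r t))) =
      cint 0 (2 * pi) (fun t => (0 +i* 1) * (f (ray r z s t) * k t)).
    move=> s0; apply: eq_cint => t _; rewrite /k.
    have -> : ray r z s t - z = s%:C * (circ r t - z) by rewrite /ray addrC addKr.
    have n1 := circB_neq0 r0 zr t.
    have n2 : s%:C != 0 by rewrite eq_complex /= eqxx andbT gt_eqF.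
    by rewrite invfM; field; rewrite n1 n2.
  by rewrite !E.
pose M := r / (r - cmod z).
have rz0 : 0 < r - cmod z by rewrite subr_gt0.
have M0 : 0 < M by rewrite divr_gt0.
have kM t : cmod (k t) <= M.
  rewrite /k cmodM cmodV cmod_circ gtr0_norm// ler_pM2l// lef_pV2 ?posrE//.
    by case/andP: (cmod_circB r0 zr t).
  by rewrite cmod_gt0 circB_neq0.
apply/eqP; rewrite -subr_eq0; apply/eqP/eq0_cmod => e e0.
have zle : cmod z <= r by exact: ltW.
have := derivable_cvgC (holo_derivable (hf _ zle)) => /continuousCP.
have e1 : 0 < e / (2 * M) by rewrite divr_gt0// mulr_gt0.
move=> /(_ _ e1) /(nbhsCP z _).1 [q q0 Hq].
(* Points at scale [d] are within [d * (2 * r) <= q / 2] of [z]. *)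
pose d := Num.min 1 (q / (4 * r)).
have d0 : 0 < d by rewrite lt_min ltr01 divr_gt0// mulr_gt0.
have d1 : d <= 1 by rewrite ge_min lexx.
have dq : d <= q / (4 * r) by rewrite ge_min lexx orbT.
have cd := cray d ltac:(by rewrite (ltW d0) d1).
rewrite (shift d)// -(cmeanZ _ ck).
rewrite -cmeanB; [|exact (ccontM cd ck)|exact (ccontM (@ccont_cst _ _ _ _) ck)].
have -> : e = 2 * (e / (2 * M) * M) by field; rewrite gt_eqF.
apply: cmean_bound.
  exact (ccontB (ccontM cd ck) (ccontM (@ccont_cst _ _ _ _) ck)).
move=> t _; rewrite -mulrBl cmodM; apply: ler_pM; rewrite ?cmod_ge0 ?kM// ltW//.
apply: Hq; rewrite /ray addrC addKr cmodM cmod_real (gtr0_norm d0).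
have /andP[_ c2] := cmod_circB r0 zr t.
apply: le_lt_trans (ler_pM (ltW d0) (cmod_ge0 _) dq c2) _.
have -> : q / (4 * r) * (2 * r) = q / 2 by field; rewrite gt_eqF.
by rewrite ltr_pdivrMr// ltr_pMr// ltr1n.
Qed.

End CauchyFormula.

Lemma cint_conj a b (f : R -> R[i]) : ccont_on a b f ->
  cint a b (fun t => conjc (f t)) = conjc (cint a b f).
Proof.
move=> cf; apply: complex_ext => /=.
  by apply: eq_Rint => t _; case: (f t).
rewrite -[RHS]mulN1r -RintZ; last exact: ccont_Im.
by apply: eq_Rint => t _; case: (f t) => x y /=; rewrite mulN1r.
Qed.

Lemma conjCM (x y : R[i]) : conjc (x * y) = conjc x * conjc y.
Proof. exact: rmorphM. Qed.

Lemma conjCB (x y : R[i]) : conjc (x - y) = conjc x - conjc y.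
Proof. exact: rmorphB. Qed.

Lemma mulC_conj z : z * conjc z = (cmod z ^+ 2)%:C.
Proof.
by rewrite cmod_sqr; case: z => x y; apply: complex_ext; rewrite ?cReM ?cImM /=; ring.
Qed.

(** On the circle the conjugate of the kernel is the boundary value of [H], which is holomorphic on
    the closed disc with [H 0 = 1]. At the centre 0 the weight of [cauchy_weighted] is identically
    1, so the mean of [H] is 1. *)
Lemma cauchy_kernel_mean r z : 0 < r -> cmod z < r ->
  cmean (fun t => circ r t / (circ r t - z)) = 1.
Proof.
move=> r0 zr.
pose H (w : R[i]) := (r ^+ 2)%:C / ((r ^+ 2)%:C - conjc z * w).
have n0 w : cmod w <= r -> (r ^+ 2)%:C - conjc z * w != 0.
  move=> wr; rewrite -cmod_gt0; apply: lt_le_trans (lerB_cmod _ _).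
  rewrite cmod_real cmodM cmodJ ger0_norm ?exprn_ge0 1?ltW// subr_gt0 expr2.
  apply: le_lt_trans (_ : _ <= cmod z * r) _; first by rewrite ler_wpM2l// cmod_ge0.
  by rewrite ltr_pM2r.
have hH w : cmod w <= r -> holo H w.
  move=> wr; apply: holoM; first exact: holo_cst.
  apply: holoV; first exact: n0.
  by apply: holoB; [exact: holo_cst|apply: holoM; [exact: holo_cst|exact: holo_id]].
have c0 : cmod (0 : R[i]) < r by rewrite cmod0.
have := cauchy_weighted r0 c0 hH.
have -> : cmean (fun t => circ r t / (circ r t - 0)) = 1.
  rewrite (@eq_cmean _ (fun=> 1)) ?cmean_cst// => t.
  rewrite subr0 divff//; have := circB_neq0 r0 c0 t; by rewrite subr0.
have -> : H 0 = 1.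
  rewrite /H mulr0 subr0 divff// eq_complex /= eqxx andbT expf_neq0//.
  by rewrite gt_eqF.
rewrite mulr1 => E.
have /(congr1 conjc) : cmean (fun t => conjc (circ r t / (circ r t - z))) = 1.
  rewrite -E; apply: eq_cmean => t; rewrite subr0.
  have n1 := circB_neq0 r0 c0 t; rewrite subr0 in n1.
  have n2 := circB_neq0 r0 zr t.
  have n3 : conjc (circ r t) - conjc z != 0 by rewrite -conjCB conjc_eq0.
  rewrite divff// mulr1 /H conjCM conjc_inv conjCB.
  have -> : (r ^+ 2)%:C = circ r t * conjc (circ r t).
    by rewrite mulC_conj cmod_circ real_normK ?num_real.
  rewrite (mulrC (conjc z)) -mulrBr invfM.
  by field; rewrite n1 n3.
rewrite /cmean cint_conj; last exact: cauchy_kernel_ccont.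
rewrite conjCM conjcK conjc1.
have -> // : conjc ((2 * pi)^-1)%:C = ((2 * pi)^-1)%:C :> R[i].
by apply: complex_ext => //=; rewrite oppr0.
Qed.

Theorem cauchy_formula r z f : 0 < r -> cmod z < r ->
  (forall w, cmod w <= r -> holo f w) ->
  cmean (fun t => f (circ r t) * (circ r t / (circ r t - z))) = f z.
Proof.
by move=> r0 zr hf; rewrite cauchy_weighted// cauchy_kernel_mean// mulr1.
Qed.

End Holomorphic.

(** * Cauchy-type integrals and orders of zeros *)

Section CauchyType.
Variable R : realType.
Implicit Types (f g : R[i] -> R[i]) (p z : R[i]) (r : R).

Lemma ccont_bounded a b (q : R -> R[i]) : a <= b -> ccont_on a b q ->
  exists2 Q, 0 <= Q & forall t, a <= t <= b -> cmod (q t) <= Q.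
Proof.
move=> ab cq.
have cc : cont_on a b (fun t => cmod (q t)).
  move=> t tab.
  exact: (@continuous_comp _ _ _ (q : R -> R[i]^o) (fun z : R[i]^o => cmod z) t (cq _ tab) (@continuous_cmod _ _)).
have [c _ Hc] := @EVT_max _ (fun t => cmod (q t)) a b ab (cont_on_within cc).
exists (cmod (q c)); first exact: cmod_ge0.
by move=> t tab; apply: Hc; rewrite in_itv.
Qed.

Definition cderive f z : R[i] := 'D_1 (f : R[i]^o -> R[i]^o) z.

Lemma hasder_holo f z d : hasder f z d -> holo f z.
Proof. by move=> H; split; apply: (derivableCP f z).2; exists d. Qed.

Lemma hasder_uniq f z d d' : hasder f z d -> hasder f z d' -> d = d'.
Proof.
move=> H H'; apply/eqP; rewrite -subr_eq0; apply/eqP/eq0_cmod => e e0.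
have e20 : 0 < e / 2 by rewrite divr_gt0.
have [r1 r10 H1] := H _ e20; have [r2 r20 H2] := H' _ e20.
pose q := Num.min r1 r2 / 2.
have q0 : 0 < q by rewrite divr_gt0// lt_min r10.
have zq : z + q%:C - z = q%:C by rewrite addrC addKr.
have cq : cmod q%:C = q by rewrite cmod_real gtr0_norm.
have qm : q < Num.min r1 r2 by rewrite ltr_pdivrMr// ltr_pMr ?ltr1n// lt_min r10.
move: qm; rewrite lt_min => /andP[q1 q2].
have := H1 (z + q%:C); have := H2 (z + q%:C).
rewrite !zq !cq => /(_ q2) K2 /(_ q1) K1.
rewrite -(ler_pM2r q0) -[X in _ * X <= _]cq -cmodM.
set F := f _ - f _ in K1 K2.
have -> : (d - d') * q%:C = (F - d' * q%:C) - (F - d * q%:C) by ring.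
by have := cmodD (F - d' * q%:C) (- (F - d * q%:C)); rewrite cmodN; lra.
Qed.

Lemma holo_hasder f z : holo f z -> hasder f z (cderive f z).
Proof.
move=> [hf]; have [d Hd] := (derivableCP f z).1 hf.
suff -> : cderive f z = d by [].
move/cvg_ex : (hf) => [/= l Hl].
have -> : cderive f z = l by apply: cvg_lim Hl; exact: norm_hausdorff.
have : hasder f z l.
  move=> e e0; have H := (continuousCP _ _ _).1 Hl.
  have [r r0 Hr] := (nbhsCP 0 (fun h : R[i] => h != 0 ->
    cmod (h^-1 *: (f (h%:A + z) - f z) - l) < e)).1 (H _ e e0).
  exists r => // y yz.
  have [->|yNz] := eqVneq y z; first by rewrite !subrr mulr0 subr0 cmod0 mulr0.
  have := Hr (y - z); rewrite subr0 => /(_ yz); rewrite subr_eq0 => /(_ yNz).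
  have -> : (y - z)%:A + z = y by rewrite /GRing.scale/= mulr1 subrK.
  move=> /ltW K; apply: le_trans (ler_wpM2r (cmod_ge0 _) K).
  rewrite -cmodM le_eqVlt; apply/orP; left; apply/eqP; congr (cmod _).
  rewrite mulrBl; congr (_ - _).
  by rewrite /GRing.scale/= mulrC mulVKf// subr_eq0.
by move=> /hasder_uniq; apply.
Qed.

Lemma cderiveE f z d : hasder f z d -> cderive f z = d.
Proof. by move=> H; exact: hasder_uniq (holo_hasder (hasder_holo H)) H. Qed.

Lemma hasder_near f g z d r : 0 < r -> (forall y, cmod (y - z) < r -> f y = g y) ->
  hasder f z d -> hasder g z d.
Proof.
move=> r0 fg H e e0; have [q q0 Hq] := H e e0.
exists (Num.min q r); first by rewrite lt_min q0.
move=> y; rewrite lt_min => /andP[yq yr].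
by rewrite -!fg ?subrr ?cmod0//; exact: Hq.
Qed.

(** A remainder quadratic in [h], uniformly in [t], survives averaging; this is differentiation
    under the integral sign for explicit kernels. *)
Lemma hasder_under (K : R -> R[i] -> R[i]) (K' : R -> R[i]) z C d :
  0 < d -> 0 <= C ->
  (forall h, cmod h < d -> ccont_on 0 (2 * pi) (K^~ (z + h))) ->
  ccont_on 0 (2 * pi) K' ->
  (forall t h, 0 <= t <= 2 * pi -> cmod h < d ->
    cmod (K t (z + h) - K t z - K' t * h) <= C * cmod h ^+ 2) ->
  hasder (fun z => cmean (K^~ z)) z (cmean K').
Proof.
move=> d0 C0 cK cK' HK e e0.
exists (Num.min d (e / (2 * C + 1))).
  by rewrite lt_min d0 divr_gt0// ltr_wpDl// mulr_ge0.
move=> y; rewrite lt_min => /andP[yd ye].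
have yE : y = z + (y - z) by rewrite addrC subrK.
have c0 : ccont_on 0 (2 * pi) (K^~ z).
  by have := cK 0; rewrite addr0 cmod0; apply.
have cy := cK _ yd; rewrite -yE in cy.
rewrite mulrC -(cmeanZ _ cK') -(cmeanB cy c0).
have cz := ccontM (@ccont_cst _ 0 (2 * pi) (y - z)) cK'.
rewrite -(cmeanB (ccontB cy c0) cz).
apply: le_trans (_ : _ <= 2 * (C * cmod (y - z) ^+ 2)) _.
  apply: (cmean_bound (ccontB (ccontB cy c0) cz)) => t t2.
  by have := HK _ _ t2 yd; rewrite -yE (mulrC (K' t)).
rewrite expr2 !mulrA ler_wpM2r ?cmod_ge0//.
move: ye; rewrite ltr_pdivlMr; last by rewrite ltr_wpDl// mulr_ge0.
by have := cmod_ge0 (y - z); lra.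
Qed.

Lemma kernel_bound (q h k : R[i]) (Q M : R) : cmod q <= Q -> cmod k <= M ->
  cmod (q * (h ^+ 2 * k)) <= Q * M * cmod h ^+ 2.
Proof.
move=> qQ kM; rewrite cmodM cmodM cmodX [cmod h ^+ 2 * _]mulrC mulrA.
by rewrite ler_wpM2r ?exprn_ge0 ?cmod_ge0// ler_pM ?cmod_ge0.
Qed.

Section Kernels.
Variables (r : R) (q : R -> R[i]).
Hypothesis (r0 : 0 < r) (cq : ccont_on 0 (2 * pi) q).

Definition ctype z := cmean (fun t => q t / (circ r t - z)).

Let cinv : forall z a b, cmod z < r -> ccont_on a b (fun t => (circ r t - z)^-1).
Proof. by move=> z a b zr; exact: circB_ccont. Qed.

Let bound z : cmod z < r -> exists d, [/\ 0 < d,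
  (forall h, cmod h < d -> cmod (z + h) < r) &
  exists2 M, 0 <= M & forall t h, cmod h < d -> cmod (circ r t - (z + h))^-1 <= M].
Proof.
move=> zr; pose d := (r - cmod z) / 2.
have d0 : 0 < d by rewrite divr_gt0// subr_gt0.
have dzr h : cmod h < d -> cmod (z + h) < r - d.
  by move=> hd; have := cmodD z h; rewrite /d in hd *; lra.
exists d; split => //; first by move=> h /dzr; lra.
exists d^-1; first by rewrite invr_ge0 ltW.
move=> t h /dzr hd; have zh : cmod (z + h) < r by lra.
rewrite cmodV lef_pV2 ?posrE//; last by rewrite cmod_gt0 circB_neq0.
by have /andP[+ _] := cmod_circB r0 zh t; lra.
Qed.

Lemma hasder_ctype z : cmod z < r ->
  hasder ctype z (cmean (fun t => q t * (circ r t - z)^-1 ^+ 2)).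
Proof.
move=> zr; have [d [d0 zh [M M0 HM]]] := bound zr.
have [Q Q0 HQ] := ccont_bounded (ltW (pi2_gt0 R)) cq.
apply: (@hasder_under (fun t z => q t / (circ r t - z))
  (fun t => q t * (circ r t - z)^-1 ^+ 2) z (Q * M ^+ 3) d d0).
- by rewrite mulr_ge0// exprn_ge0.
- move=> h hd; exact (ccontM cq (@cinv _ 0 (2 * pi) (zh _ hd))).
- under eq_fun do rewrite expr2.
  exact (ccontM cq (ccontM (@cinv _ 0 (2 * pi) zr) (@cinv _ 0 (2 * pi) zr))).
move=> t h t2 hd.
have n1 := circB_neq0 r0 zr t; have n2 := circB_neq0 r0 (zh _ hd) t.
set u := (circ r t - (z + h))^-1; set v := (circ r t - z)^-1.
(* The resolvent identity, applied twice, extracts the factor [h ^+ 2] from the remainder. *)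
have uv : u - v = h * u * v by rewrite /u /v; field; rewrite n1 n2.
have -> : q t / (circ r t - (z + h)) - q t / (circ r t - z) - q t * v ^+ 2 * h =
    q t * (h ^+ 2 * (u * (v * v))).
  transitivity (q t * (u - v - h * v * v)); first by rewrite /u /v; ring.
  by rewrite uv -[X in h * u * v - X]mulrA; transitivity (q t * (h * v * (u - v)));
    [ring|rewrite uv; ring].
have uM : cmod u <= M by exact: HM.
have vM : cmod v <= M by have := HM t 0; rewrite addr0 cmod0; apply.
have H3 : cmod (u * (v * v)) <= M ^+ 3.
  rewrite !cmodM exprS expr2.
  by do 2 (apply: ler_pM; rewrite ?mulr_ge0 ?cmod_ge0//).
exact: (kernel_bound h (HQ _ t2) H3).
Qed.

Lemma holo_ctype2 z : cmod z < r ->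
  holo (fun z => cmean (fun t => q t * (circ r t - z)^-1 ^+ 2)) z.
Proof.
move=> zr; have [d [d0 zh [M M0 HM]]] := bound zr.
have [Q Q0 HQ] := ccont_bounded (ltW (pi2_gt0 R)) cq.
apply: (@hasder_holo _ _ (cmean (fun t => q t * (2 * (circ r t - z)^-1 ^+ 3)))).
have cinv2 y : cmod y < r -> ccont_on 0 (2 * pi) (fun t => (circ r t - y)^-1 ^+ 2).
  by move=> yr; under eq_fun do rewrite expr2; exact (ccontM (@cinv _ 0 (2 * pi) yr) (@cinv _ 0 (2 * pi) yr)).
apply: (@hasder_under (fun t z => q t * (circ r t - z)^-1 ^+ 2)
  (fun t => q t * (2 * (circ r t - z)^-1 ^+ 3)) z (Q * (3 * M ^+ 4)) d d0).
- by rewrite !mulr_ge0// exprn_ge0.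
- move=> h hd; exact (ccontM cq (cinv2 _ (zh _ hd))).
- under eq_fun do rewrite exprS.
  exact (ccontM cq (ccontM (@ccont_cst _ _ _ _) (ccontM (@cinv _ 0 (2 * pi) zr) (cinv2 _ zr)))).
move=> t h t2 hd.
have n1 := circB_neq0 r0 zr t; have n2 := circB_neq0 r0 (zh _ hd) t.
set u := (circ r t - (z + h))^-1; set v := (circ r t - z)^-1.
have uv : u - v = h * u * v by rewrite /u /v; field; rewrite n1 n2.
have -> : q t * u ^+ 2 - q t * v ^+ 2 - q t * (2 * v ^+ 3) * h =
    q t * (h ^+ 2 * (u * (v * (v * (u + 2 * v))))).
  transitivity (q t * ((u - v) * (u + v) - 2 * h * v ^+ 3)); first by ring.
  rewrite uv; transitivity (q t * (h * v * ((u - v) * (u + 2 * v)))); first by ring.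
  by rewrite uv; ring.
have uM : cmod u <= M by exact: HM.
have vM : cmod v <= M by have := HM t 0; rewrite addr0 cmod0; apply.
have uvM : cmod (u + 2 * v) <= 3 * M.
  have := cmodD u (2 * v); rewrite cmodM.
  have -> : cmod (2 : R[i]) = 2 by rewrite -[2 : R[i]](rmorph_nat (real_complex R) 2) cmod_real ger0_norm.
  by lra.
have H4 : cmod (u * (v * (v * (u + 2 * v)))) <= 3 * M ^+ 4.
  have -> : 3 * M ^+ 4 = M * (M * (M * (3 * M))) by ring.
  rewrite 3!cmodM.
  by do 3 (apply: ler_pM; rewrite ?mulr_ge0 ?cmod_ge0//).
exact: (kernel_bound h (HQ _ t2) H4).
Qed.

Lemma holo_ctype z : cmod z < r -> holo ctype z.
Proof. by move=> zr; apply: hasder_holo (hasder_ctype zr). Qed.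

End Kernels.

Lemma circ_cont_holo f r a b : 0 < r -> (forall w, cmod w <= r -> holo f w) ->
  ccont_on a b (fun t => f (circ r t)).
Proof.
move=> r0 hf; apply: holo_ccont; first exact: circ_ccont.
by move=> t _; apply: hf; rewrite cmod_circ gtr0_norm.
Qed.

Lemma near_disc z r : cmod z < r -> exists2 d, 0 < d &
  forall y, cmod (y - z) < d -> cmod y < r.
Proof.
move=> zr; exists (r - cmod z); first by rewrite subr_gt0.
move=> y yz; rewrite -[y](subrK z); apply: le_lt_trans (cmodD _ _) _.
by move: yz; lra.
Qed.

(** Cauchy's formula identifies [f] with a Cauchy-type integral, whose derivative has the squared
    kernel and is differentiable again. This makes the logarithmic derivative holomorphic. *)
Lemma holo_cderive f r z : 0 < r -> (forall w, cmod w <= r -> holo f w) ->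
  cmod z < r -> holo (cderive f) z.
Proof.
move=> r0 hf zr; pose q t := f (circ r t) * circ r t.
have cq : ccont_on 0 (2 * pi) q.
  exact (ccontM (circ_cont_holo r0 hf) (@circ_ccont _ _ _ _)).
have fE y : cmod y < r -> ctype r q y = f y.
  move=> yr; rewrite -(cauchy_formula r0 yr hf); apply: eq_cmean => t.
  by rewrite /q mulrA.
have [d d0 Hd] := near_disc zr.
apply: holo_near d0 _ (holo_ctype2 r0 cq zr) => y /Hd yr.
have [d' d'0 Hd'] := near_disc yr.
apply/esym/cderiveE; apply: hasder_near d'0 _ (hasder_ctype r0 cq yr).
by move=> x /Hd' /fE.
Qed.

(** With density [f(zeta) * zeta^(1-k)] the Cauchy-type integral [g k] takes at 0 the value of the
    [k]-th Taylor coefficient, and [f = z^k * g k] as long as the earlier coefficients vanish. The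
    first nonzero coefficient gives the order; if there is none, the bound [(|z| / r)^k * C] forces
    [f = 0]. *)
Lemma holo_zero_order f r : 0 < r -> (forall w, cmod w <= r -> holo f w) ->
  (exists n g, [/\ forall z, cmod z < r -> holo g z, g 0 != 0 &
     forall z, cmod z < r -> f z = z ^+ n * g z]) \/
  (forall z, cmod z < r -> f z = 0).
Proof.
move=> r0 hf; pose q k t := f (circ r t) * circ r t * (circ r t)^-1 ^+ k.
have c0 : cmod (0 : R[i]) < r by rewrite cmod0.
have circ0 t : circ r t != 0 by have := circB_neq0 r0 c0 t; rewrite subr0.
have cinv : ccont_on 0 (2 * pi) (fun t => (circ r t)^-1).
  by apply: ccontV; [move=> t _; exact: circ0|exact: circ_ccont].
have cf a b : ccont_on a b (fun t => f (circ r t)) := circ_cont_holo r0 hf.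
have cq k : ccont_on 0 (2 * pi) (q k).
  apply: (ccontM (ccontM (cf _ _) (@circ_ccont _ _ _ _))).
  elim: k => [|k IH]; first by under eq_fun do rewrite expr0; exact: ccont_cst.
  under eq_fun do rewrite exprS; exact (ccontM cinv IH).
pose g k := ctype r (q k).
have g0 z : cmod z < r -> f z = g 0 z.
  move=> zr; rewrite -(cauchy_formula r0 zr hf); apply: eq_cmean => t.
  by rewrite /q expr0 mulr1 mulrA.
have gS k z : cmod z < r -> g k 0 = 0 -> g k z = z * g k.+1 z.
  move=> zr gk0; rewrite -[LHS]subr0 -gk0 /g /ctype.
  rewrite -cmeanB; [|exact (ccontM (cq k) (@circB_ccont _ _ _ r0 zr _ _))|exact (ccontM (cq k) (@circB_ccont _ _ _ r0 c0 _ _))].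
  rewrite -cmeanZ; last exact (ccontM (cq _) (@circB_ccont _ _ _ r0 zr _ _)).
  apply: eq_cmean => t; rewrite /q exprSr subr0.
  set Q := (circ r t)^-1 ^+ k.
  have n1 := circB_neq0 r0 zr t; have n2 := circ0 t.
  by field; rewrite n1 n2.
have [H|H] := pselect (exists k, g k 0 != 0).
  left; case: (ex_minnP H) => n gn0 nmin; exists n, (g n); split; [|exact: gn0|].
    by move=> z zr; exact (holo_ctype r0 (cq n) zr).
  move=> z zr; rewrite (g0 _ zr).
  suff E k : (k <= n)%N -> g 0 z = z ^+ k * g k z by exact: E.
  elim: k => [|k IH] kn; first by rewrite expr0 mul1r.
  rewrite (IH (ltnW kn)) exprSr -mulrA -(gS _ _ zr)//.
  apply/eqP; apply: contraT => gk; have := nmin _ gk.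
  by rewrite leqNgt kn.
right => z zr.
have gk k : g k 0 = 0.
  by apply/eqP; apply: contraT => gk; exfalso; apply: H; exists k.
have E k : f z = z ^+ k * g k z.
  elim: k => [|k IH]; first by rewrite expr0 mul1r (g0 _ zr).
  by rewrite IH exprSr -mulrA -(gS _ _ zr (gk _)).
have [M M0 HM] := ccont_bounded (ltW (pi2_gt0 R)) (cf 0 (2 * pi)).
have rz0 : 0 < r - cmod z by rewrite subr_gt0.
have bd k : cmod (f z) <= (cmod z / r) ^+ k * (2 * (M * r / (r - cmod z))).
  have rk0 : r ^+ k != 0 by rewrite expf_neq0// gt_eqF.
  have -> : (cmod z / r) ^+ k * (2 * (M * r / (r - cmod z))) =
      cmod z ^+ k * (2 * (M * r / r ^+ k / (r - cmod z))).
    by rewrite expr_div_n; field; rewrite rk0 gt_eqF.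
  rewrite (E k) (cmodM (z ^+ k)) cmodX ler_wpM2l ?exprn_ge0 ?cmod_ge0//.
  apply: cmean_bound; first exact (ccontM (cq _) (@circB_ccont _ _ _ r0 zr _ _)).
  move=> t t2; rewrite /q 3!cmodM cmodX !cmodV cmod_circ (gtr0_norm r0) exprVn.
  apply: ler_pM.
  - by rewrite !mulr_ge0 ?cmod_ge0 ?(ltW r0)// invr_ge0 exprn_ge0// ltW.
  - by rewrite invr_ge0 cmod_ge0.
  - by rewrite ler_wpM2r ?invr_ge0 ?exprn_ge0 ?(ltW r0)// ler_wpM2r ?HM// ltW.
  - rewrite lef_pV2 ?posrE ?cmod_gt0 ?circB_neq0//.
    by case/andP: (cmod_circB r0 zr t).
apply: eq0_cmod => e e0; set C := 2 * _ in bd.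
have C0 : 0 <= C by rewrite !mulr_ge0 ?invr_ge0 ?(ltW r0) ?(ltW rz0).
have : (cmod z / r) ^+ n @[n --> \oo] --> (0 : R).
  apply: cvg_expr; rewrite ger0_norm; first by rewrite ltr_pdivrMr// mul1r.
  by rewrite divr_ge0 ?cmod_ge0 ?(ltW r0).
have e1 : 0 < e / (C + 1) by rewrite divr_gt0// ltr_wpDl.
move=> /cvgrPdist_lt /(_ _ e1) [n _ Hn].
apply: le_trans (bd n) _.
have := Hn n (leqnn n); rewrite /= sub0r normrN ltr_pdivlMr ?ltr_wpDl// => H1.
have := ler_norm ((cmod z / r) ^+ n); have := normr_ge0 ((cmod z / r) ^+ n).
set X := (_ / _) ^+ n in H1 *; set Y := `|X| in H1 *.
by move=> Y0 XY; nra.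
Qed.

End CauchyType.

(** * The Poisson formula *)

Section Poisson.
Variable R : realType.
Implicit Types (f : R[i] -> R[i]) (p z : R[i]) (r : R) (u v : R -> R).

Definition rmean u : R := (2 * pi)^-1 * rint 0 (2 * pi) u.

Lemma eq_rmean u v : u =1 v -> rmean u = rmean v.
Proof. by move=> uv; rewrite /rmean (@eq_Rint _ _ _ u v). Qed.

Lemma Re_cmean (f : R -> R[i]) : Re (cmean f) = rmean (fun t => Re (f t)).
Proof. by rewrite /cmean cReM /= mul0r subr0. Qed.

Lemma rmeanD u v : cont_on 0 (2 * pi) u -> cont_on 0 (2 * pi) v ->
  rmean (fun t => u t + v t) = rmean u + rmean v.
Proof. by move=> cu cv; rewrite /rmean RintD// mulrDr. Qed.

Lemma rmeanB u v : cont_on 0 (2 * pi) u -> cont_on 0 (2 * pi) v ->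
  rmean (fun t => u t - v t) = rmean u - rmean v.
Proof. by move=> cu cv; rewrite /rmean RintB// mulrBr. Qed.

Lemma rmeanZ k u : cont_on 0 (2 * pi) u ->
  rmean (fun t => k * u t) = k * rmean u.
Proof. by move=> cu; rewrite /rmean RintZ// mulrCA. Qed.

Lemma rmean_cst k : rmean (fun=> k) = k.
Proof.
rewrite /rmean Rint_cst; last exact: ltW (pi2_gt0 R).
by rewrite subr0 mulrCA mulVf ?mulr1// gt_eqF// pi2_gt0.
Qed.

Lemma le_rmean u v : cont_on 0 (2 * pi) u -> cont_on 0 (2 * pi) v ->
  (forall t, 0 <= t <= 2 * pi -> u t <= v t) -> rmean u <= rmean v.
Proof.
move=> cu cv uv; rewrite /rmean ler_pM2l ?invr_gt0 ?pi2_gt0//.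
exact: le_Rint.
Qed.

Lemma rmean_ge0 u : (forall t, 0 <= t <= 2 * pi -> 0 <= u t) -> 0 <= rmean u.
Proof.
by move=> H; rewrite mulr_ge0 ?invr_ge0 ?(ltW (pi2_gt0 _))//; exact: Rint_ge0.
Qed.

Definition pker r z t : R := (r ^+ 2 - cmod z ^+ 2) / cmod (circ r t - z) ^+ 2.

Section Kernel.
Variables (r : R) (z : R[i]).
Hypotheses (r0 : 0 < r) (zr : cmod z < r).

Lemma reflect_neq0 w : cmod w <= r -> (r ^+ 2)%:C - conjc z * w != 0.
Proof.
move=> wr; rewrite -cmod_gt0; apply: lt_le_trans (lerB_cmod _ _).
rewrite cmod_real cmodM cmodJ ger0_norm ?exprn_ge0 1?ltW// subr_gt0 expr2.
apply: le_lt_trans (_ : _ <= cmod z * r) _; first by rewrite ler_wpM2l// cmod_ge0.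
by rewrite ltr_pM2r.
Qed.

Lemma pker_ge0 t : 0 <= pker r z t.
Proof.
rewrite /pker divr_ge0 ?exprn_ge0 ?cmod_ge0// subr_ge0.
by rewrite ler_pXn2r ?nnegrE ?cmod_ge0 ?(ltW r0)// ltW.
Qed.

Lemma pker_le t : pker r z t <= (r + cmod z) / (r - cmod z).
Proof.
have /andP[c1 _] := cmod_circB r0 zr t.
have d0 : 0 < r - cmod z by rewrite subr_gt0.
have c0 := cmod_ge0 z; have cz : 0 <= r + cmod z by rewrite addr_ge0// ltW.
rewrite /pker ler_pdivrMr; last first.
  by rewrite exprn_gt0// (lt_le_trans d0).
have -> : r ^+ 2 - cmod z ^+ 2 = (r + cmod z) / (r - cmod z) * (r - cmod z) ^+ 2.
  by field; rewrite gt_eqF.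
rewrite ler_wpM2l ?divr_ge0 ?(ltW d0)//.
by rewrite ler_pXn2r ?nnegrE ?cmod_ge0 ?(ltW d0).
Qed.

Lemma cont_pker a b : cont_on a b (pker r z).
Proof.
have cB : ccont_on a b (fun t => circ r t - z).
  exact (ccontB (@circ_ccont _ _ _ _) (@ccont_cst _ _ _ _)).
have cc t : a <= t <= b -> {for t, continuous (fun t => cmod (circ r t - z))}.
  move=> tab.
  exact: (@continuous_comp _ _ _ ((fun t => circ r t - z) : R -> R[i]^o) (fun z : R[i]^o => cmod z) t (cB _ tab) (@continuous_cmod _ _)).
move=> t tab; apply: cvgMr; apply: cvgV.
  by rewrite expf_neq0// cmod_eq0 circB_neq0.
under eq_fun do rewrite expr2; rewrite expr2; apply: cvgM; exact: cc.
Qed.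

(** Cauchy's formula at [z] is added to Cauchy's formula at 0 for [g], which vanishes there; on the
    circle the two kernels add up to the real Poisson kernel. *)
Lemma cauchy_poisson f : (forall w, cmod w <= r -> holo f w) ->
  cmean (fun t => f (circ r t) * (pker r z t)%:C) = f z.
Proof.
move=> hf; have c0 : cmod (0 : R[i]) < r by rewrite cmod0.
pose q w := (r ^+ 2)%:C - conjc z * w.
have hq w : holo q w.
  exact (holoB (holo_cst _ _) (holoM (holo_cst _ _) (holo_id w))).
pose g w := f w * (conjc z * w / q w).
have hg w : cmod w <= r -> holo g w.
  move=> wr; have qn : q w != 0 := reflect_neq0 wr.
  exact (holoM (hf _ wr) (holoM (holoM (holo_cst _ _) (holo_id w)) (holoV qn (hq w)))).
have Eg := cauchy_formula r0 c0 hg.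
have E0 : g 0 = 0 by rewrite /g mulr0 mul0r mulr0.
rewrite -(cauchy_formula r0 zr hf) -[RHS]addr0 -E0 -Eg.
have cf : ccont_on 0 (2 * pi) (fun t => f (circ r t)) := circ_cont_holo r0 hf.
have cg : ccont_on 0 (2 * pi) (fun t => g (circ r t)) := circ_cont_holo r0 hg.
rewrite -cmeanD; [|exact (ccontM cf (@cauchy_kernel_ccont _ _ _ r0 zr _ _))
                  |exact (ccontM cg (@cauchy_kernel_ccont _ _ _ r0 c0 _ _))].
apply: eq_cmean => t; rewrite subr0 /g -mulrA -mulrDr; congr (_ * _).
have n1 := circB_neq0 r0 c0 t; rewrite subr0 in n1.
have n2 := circB_neq0 r0 zr t.
have n3 : conjc (circ r t) - conjc z != 0 by rewrite -conjCB conjc_eq0.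
have rE : (r ^+ 2)%:C = circ r t * conjc (circ r t).
  by rewrite mulC_conj cmod_circ real_normK ?num_real.
have qE : q (circ r t) = circ r t * (conjc (circ r t) - conjc z).
  by rewrite /q rE; ring.
rewrite /pker rmorphM fmorphV rmorphB/= -!mulC_conj conjCB rE qE.
by field; rewrite n1 n2 n3.
Qed.

Lemma pker_mean : rmean (pker r z) = 1.
Proof.
have := @cauchy_poisson (fun=> 1) (fun w _ => holo_cst 1 w).
move=> /(congr1 (fun w : R[i] => Re w)); rewrite Re_cmean => E.
by rewrite -[RHS]E; apply: eq_rmean => t; rewrite cReM /= mul1r mul0r subr0.
Qed.

Lemma poisson_Re f : (forall w, cmod w <= r -> holo f w) ->
  rmean (fun t => Re (f (circ r t)) * pker r z t) = Re (f z).
Proof.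
move=> hf; rewrite -(cauchy_poisson hf) Re_cmean; apply: eq_rmean => t.
by rewrite cReM /= mulr0 subr0.
Qed.

End Kernel.

Lemma is_derive_ln_cmod (g : R -> R[i]) t d : cder g t d -> g t != 0 ->
  is_derive t 1 (fun s => ln (cmod (g s))) (Re (d / g t)).
Proof.
move=> [dr di] g0.
have Q0 : 0 < Re (g t) ^+ 2 + Im (g t) ^+ 2.
  by rewrite -cmod_sqr exprn_gt0// cmod_gt0.
have -> : (fun s => ln (cmod (g s))) =
    (fun s => 2^-1 * ln (Re (g s) ^+ 2 + Im (g s) ^+ 2)).
  apply/funext => s; rewrite -cmod_sqr.
  have [->|n0] := eqVneq (g s) 0; first by rewrite cmod0 expr0n /= ln0// mulr0.
  by rewrite lnXn ?cmod_gt0// -(mulr_natl (ln _) 2) mulKf// pnatr_eq0.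
have dQ : is_derive t 1 (fun s => Re (g s) ^+ 2 + Im (g s) ^+ 2)
    (2 * (Re (g t) * Re d + Im (g t) * Im d)).
  under eq_fun do rewrite !expr2.
  refine (is_derive_eq (is_deriveD (is_deriveM dr dr) (is_deriveM di di)) _).
  by rewrite /GRing.scale/=; ring.
refine (is_derive_eq (is_deriveZ 2^-1 (@is_derive1_comp R (@ln R)
  (fun s => Re (g s) ^+ 2 + Im (g s) ^+ 2) t _ _ (is_derive1_ln Q0) dQ)) _).
rewrite /GRing.scale/=.
have n0 : Re (g t) ^+ 2 + Im (g t) ^+ 2 != 0 by rewrite gt_eqF.
have n0' := n0; case: (g t) n0 => x y /= n0; case: d {dr di dQ} => a b /=.
by field.
Qed.

End Poisson.

(** * The Poisson formula for logarithms of moduli *)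

Section PoissonLog.
Variable R : realType.
Implicit Types (F : R[i] -> R[i]) (p z : R[i]) (r : R).

Lemma cont_ln_cmod a b (g : R -> R[i]) : ccont_on a b g ->
  (forall t, a <= t <= b -> g t != 0) -> cont_on a b (fun t => ln (cmod (g t))).
Proof.
move=> cg g0 t tab.
have cc : {for t, continuous (fun t => cmod (g t))}.
  exact: (@continuous_comp _ _ _ (g : R -> R[i]^o) (fun z : R[i]^o => cmod z) t (cg _ tab) (@continuous_cmod _ _)).
apply: (@continuous_comp _ _ _ (fun t => cmod (g t)) (@ln R) t cc).
by apply: continuous_ln; rewrite cmod_gt0 g0.
Qed.

Lemma cont_onM a b (u v : R -> R) : cont_on a b u -> cont_on a b v ->
  cont_on a b (fun t => u t * v t).
Proof. by move=> cu cv t tab; apply: cvgM; [exact: cu|exact: cv]. Qed.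

Lemma holo_bounded k r r' : 0 < r -> r < r' -> (forall w, cmod w <= r' -> holo k w) ->
  exists2 K, 0 <= K & forall w, cmod w <= r -> cmod (k w) <= K.
Proof.
move=> r0 rr' hk; have r'0 : 0 < r' by exact: lt_trans rr'.
have ck : ccont_on 0 (2 * pi) (fun t => k (circ r' t)) := circ_cont_holo r'0 hk.
have [M M0 HM] := ccont_bounded (ltW (pi2_gt0 R)) ck.
have d0 : 0 < r' - r by rewrite subr_gt0.
exists (2 * (M * (r' / (r' - r)))).
  by rewrite !mulr_ge0 ?invr_ge0 ?(ltW r'0) ?(ltW d0).
move=> w wr; have wr' : cmod w < r' by exact: le_lt_trans rr'.
rewrite -(cauchy_formula r'0 wr' hk).
apply: cmean_bound; first exact (ccontM ck (@cauchy_kernel_ccont _ _ _ r'0 wr' _ _)).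
move=> t t2; rewrite cmodM; apply: ler_pM; rewrite ?cmod_ge0 ?HM//.
rewrite cmodM cmodV cmod_circ (gtr0_norm r'0) ler_pM2l//.
rewrite lef_pV2 ?posrE ?cmod_gt0 ?circB_neq0//.
have /andP[c1 _] := cmod_circB r'0 wr' t; apply: le_trans c1.
by rewrite lerD2l lerN2.
Qed.

(** Let [L s] be the defect of the formula for [F(s w)]. Its derivative is the defect of the Poisson
    formula for the real part of the holomorphic function [w * k (s w)], with [k] the logarithmic
    derivative of [F], hence 0. Since [L 0 = 0] because the kernel has mean 1, also [L 1 = 0]. *)
Lemma poisson_ln F r r1 z : 0 < r -> r < r1 -> cmod z < r ->
  (forall w, cmod w < r1 -> holo F w) -> (forall w, cmod w < r1 -> F w != 0) ->
  rmean (fun t => ln (cmod (F (circ r t))) * pker r z t) = ln (cmod (F z)).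
Proof.
move=> r0 rr1 zr hF F0.
pose k w := cderive F w / F w.
have hk w : cmod w < r1 -> holo k w.
  move=> wr; apply: holoM; last by apply: holoV; [exact: F0|exact: hF].
  pose rw := (cmod w + r1) / 2.
  have rw1 : cmod w < rw by rewrite /rw; lra.
  have rw2 : rw < r1 by rewrite /rw; lra.
  have rw0 : 0 < rw by apply: le_lt_trans rw1; exact: cmod_ge0.
  apply: (holo_cderive rw0) rw1 => y yr; apply: hF; exact: le_lt_trans rw2.
pose r2 := (r + r1) / 2; have rr2 : r < r2 by rewrite /r2; lra.
have r21 : r2 < r1 by rewrite /r2; lra.
have r20 : 0 < r2 by lra.
have [K K0 HK] : exists2 K, 0 <= K & forall w, cmod w <= r2 -> cmod (k w) <= K.
  apply: (@holo_bounded k r2 ((r2 + r1) / 2)) => //; first by lra.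
  by move=> w wr; apply: hk; lra.
(* Two-sided derivatives at [s = 0] and [s = 1] require an open interval of dilations around
   [[0, 1]]; for [|s| < sg] the dilated disc stays inside radius [r2]. *)
pose sg := r2 / r; have sg1 : 1 < sg by rewrite /sg ltr_pdivlMr// mul1r.
have scal s w : `|s| < sg -> cmod w <= r -> cmod (s%:C * w) < r2.
  move=> ss wr; rewrite cmodM cmod_real.
  apply: le_lt_trans (_ : _ <= `|s| * r) _; first by rewrite ler_wpM2l.
  by move: ss; rewrite ltr_pdivlMr.
have dcurve (s : R) w : `|s| < sg -> cmod w <= r ->
    is_derive s 1 (fun s => ln (cmod (F (s%:C * w)))) (Re (w * k (s%:C * w))).
  move=> ss wr; have sw := lt_trans (scal _ _ ss wr) r21.
  have dl : cder (fun s : R => s%:C) s 1.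
    by split => /=; [exact: is_derive_id|exact: is_derive_cst].
  have dg := cderM dl (cder_cst w s).
  rewrite mulr0 add0r mulr1 in dg.
  have := is_derive_ln_cmod (cder_comp (holo_hasder (hF _ sw)) dg) (F0 _ sw).
  by rewrite /k mulrA [w * _]mulrC.
have cr t : cmod (circ r t) <= r by rewrite cmod_circ gtr0_norm.
pose f s t := ln (cmod (F (s%:C * circ r t))) * pker r z t.
pose L s := rmean (f s) - ln (cmod (F (s%:C * z))).
have cFs s : `|s| < sg -> cont_on 0 (2 * pi) (f s).
  move=> ss; apply: cont_onM; last exact (@cont_pker _ _ _ r0 zr _ _).
  apply: cont_ln_cmod.
    apply: holo_ccont; first exact (ccontM (@ccont_cst _ _ _ _) (@circ_ccont _ _ _ _)).
    by move=> t _; apply: hF; exact: lt_trans (scal _ _ ss (cr t)) r21.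
  by move=> t _; apply: F0; exact: lt_trans (scal _ _ ss (cr t)) r21.
have dfs (s t : R) : `|s| < sg ->
    is_derive s 1 (f ^~ t) (Re (circ r t * k (s%:C * circ r t)) * pker r z t).
  move=> ss; rewrite /f; under eq_fun do rewrite mulrC.
  refine (is_derive_eq (is_deriveZ (pker r z t) (dcurve _ _ ss (cr t))) _).
  by rewrite /GRing.scale/= mulrC.
have dL (s : R) : `|s| < sg -> is_derive s 1 L 0.
  move=> ss.
  pose G : R -> R := fun=> r * K * ((r + cmod z) / (r - cmod z)).
  have zz0 : 0 < r - cmod z by rewrite subr_gt0.
  have G0 t : 0 <= G t.
    rewrite /G mulr_ge0//; first by rewrite mulr_ge0// ltW.
    by rewrite divr_ge0 ?(ltW zz0)// addr_ge0 ?cmod_ge0// ltW.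
  have Ia : `](- sg), sg[%classic s by rewrite /= in_itv/= -ltr_norml.
  have intf x : `](- sg), sg[%classic x ->
      lebesgue_measure.-integrable `[0, (2 * pi)] (EFin \o f x).
    rewrite /= in_itv/= -ltr_norml => xs; exact (integrable_cont (cFs x xs)).
  have derf (x y : R) : `](- sg), sg[%classic x -> `[0, (2 * pi)]%classic y ->
      derivable (f ^~ y) x 1.
    rewrite /= in_itv/= -ltr_norml => xs _; exact (@ex_derive _ _ _ _ _ _ _ (dfs x y xs)).
  have intG : lebesgue_measure.-integrable `[0, (2 * pi)] (EFin \o G).
    by apply: integrable_cont => t _; exact: cvg_cst.
  have d1E x y : `|x| < sg -> partial1of2 f x y =
      Re (circ r y * k (x%:C * circ r y)) * pker r z y.
    by move=> xs; rewrite /partial1of2 derive1E; have [] := dfs x y xs.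
  have Gub x y : `](- sg), sg[%classic x -> `[0, (2 * pi)]%classic y ->
      `|partial1of2 f x y| <= G y.
    rewrite /= in_itv/= -ltr_norml => xs _; rewrite d1E// normrM.
    apply: ler_pM; rewrite ?normr_ge0//.
      apply: le_trans (Re_le_cmod _) _; rewrite cmodM.
      by apply: ler_pM; rewrite ?cmod_ge0 ?cr// HK// ltW// scal.
    by rewrite ger0_norm ?pker_ge0// pker_le.
  have mB : measurable (`[0, (2 * pi)]%classic : set R) by [].
  have D1 := @derivable_under_integral R _ _ lebesgue_measure f _ mB s (- sg) sg
    Ia intf derf G G0 intG Gub.
  have D2 := @differentiation_under_integral R _ _ lebesgue_measure f _ mB s (- sg) sg
    Ia intf derf G G0 intG Gub.
  have D3 : is_derive s 1 (fun s => rint 0 (2 * pi) (f s))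
      (rint 0 (2 * pi) (fun t => Re (circ r t * k (s%:C * circ r t)) * pker r z t)).
    apply: DeriveDef; first exact: D1.
    rewrite -derive1E D2; apply: eq_Rint => t _.
    by rewrite -/(partial1of2 f s t) d1E.
  have hks w : cmod w <= r -> holo (fun w => w * k (s%:C * w)) w.
    move=> wr; apply: holoM; first exact: holo_id.
    apply: holo_comp; first by apply: hk; exact: lt_trans (scal _ _ ss wr) r21.
    exact (holoM (holo_cst _ _) (holo_id _)).
  have P := poisson_Re r0 zr hks.
  refine (is_derive_eq (is_deriveB (is_deriveZ (2 * pi)^-1 D3) (dcurve _ _ ss (ltW zr))) _).
  by rewrite -P /rmean subrr.
have L01 : L 1 = L 0.
  have : rint 0 1 (fun=> 0) = L 1 - L 0.
    apply: Rint_FTC => //.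
      by move=> t /andP[t0 t1]; apply: dL; rewrite ger0_norm//; exact: le_lt_trans sg1.
    by move=> t _; exact: cvg_cst.
  by rewrite Rint_cst// mul0r => /esym/eqP; rewrite subr_eq0 => /eqP.
have L0 : L 0 = 0.
  rewrite /L mul0r; apply/eqP; rewrite subr_eq0; apply/eqP.
  rewrite (@eq_rmean _ _ (fun t => ln (cmod (F 0)) * pker r z t)); last first.
    by move=> t; rewrite /f mul0r.
  rewrite rmeanZ; last exact (@cont_pker _ _ _ r0 zr _ _).
  by rewrite pker_mean// mulr1.
have : L 1 = 0 by rewrite L01.
rewrite /L mul1r => /eqP; rewrite subr_eq0 => /eqP <-.
by apply: eq_rmean => t; rewrite /f mul1r.
Qed.

(* The Poisson integral at z of ln |zeta - a| over |zeta| = r. *)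
Definition bln r (a z : R[i]) : R :=
  if cmod a < r then ln (cmod (r%:C - conjc a * z / r%:C)) else ln (cmod (z - a)).

Lemma real_neq0 r : 0 < r -> r%:C != 0 :> R[i].
Proof. by move=> r0; rewrite eq_complex /= eqxx andbT gt_eqF. Qed.

Lemma cmod_circ_reflect r a t : 0 < r ->
  cmod (circ r t - a) = cmod (r%:C - conjc a * circ r t / r%:C).
Proof.
move=> r0; have rn := real_neq0 r0.
have c0 : circ r t != 0 by rewrite -cmod_gt0 cmod_circ gtr0_norm.
have cc : circ r t * conjc (circ r t) = r%:C * r%:C.
  by rewrite mulC_conj cmod_circ real_normK ?num_real// -rmorphM expr2.
have E : r%:C - conjc a * circ r t / r%:C = circ r t * conjc (circ r t - a) / r%:C.
  by rewrite conjCB mulrBr cc mulrBl mulfK// [conjc a * _]mulrC.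
rewrite E !cmodM cmodJ cmodV cmod_real cmod_circ.
by rewrite mulrC mulKf// normr_eq0 gt_eqF.
Qed.

(** For [a] inside the circle, [z - a] is replaced by [r - conj a * z / r], which has the same
    modulus on the circle and no zero in the disc. *)
Lemma poisson_ln_sub r a z : 0 < r -> cmod a != r -> cmod z < r ->
  rmean (fun t => ln (cmod (circ r t - a)) * pker r z t) = bln r a z.
Proof.
move=> r0 ar zr; rewrite /bln; case: ltP => ra.
  have rn := real_neq0 r0.
  pose F w := r%:C - conjc a * w / r%:C.
  have a0 := cmod_ge0 a.
  (* The zero of [F] is the reflection of [a], of modulus [r^2 / |a|] when [a] is not 0; [r1] lies
     strictly between [r] and that modulus. *)
  pose r1 := r ^+ 2 / ((cmod a + r) / 2).
  have m0 : 0 < (cmod a + r) / 2 by lra.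
  have rr1 : r < r1.
    by rewrite /r1 ltr_pdivlMr// expr2 ltr_pM2l//; lra.
  rewrite (@eq_rmean _ _ (fun t => ln (cmod (F (circ r t))) * pker r z t)); last first.
    by move=> t; rewrite cmod_circ_reflect.
  apply: (poisson_ln r0 rr1 zr) => w wr.
    exact (holoB (holo_cst _ _) (holoM (holoM (holo_cst _ _) (holo_id _)) (holo_cst _ _))).
  rewrite /F -cmod_gt0; apply: lt_le_trans (lerB_cmod _ _).
  rewrite !cmodM cmodJ cmodV cmod_real (gtr0_norm r0) subr_gt0 ltr_pdivrMr//.
  apply: le_lt_trans (_ : _ <= (cmod a + r) / 2 * cmod w) _.
    by rewrite ler_wpM2r ?cmod_ge0//; lra.
  by rewrite mulrC -ltr_pdivlMr// -expr2.
have {}ra : r < cmod a by rewrite lt_neqAle eq_sym ar ra.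
apply: (@poisson_ln (fun w => w - a) r (cmod a) z r0 ra zr) => w wa.
  exact (holoB (holo_id _) (holo_cst _ _)).
by rewrite subr_eq0; apply: contraTneq wa => ->; rewrite ltxx.
Qed.

Lemma bln0 r a : 0 < r -> bln r a 0 = ln (Num.max r (cmod a)).
Proof.
move=> r0; rewrite /bln; case: ltP => ra.
  by rewrite mulr0 mul0r subr0 cmod_real gtr0_norm.
by rewrite sub0r cmodN.
Qed.

Lemma pker0 r t : 0 < r -> pker r 0 t = 1.
Proof.
move=> r0; rewrite /pker cmod0 subr0 expr0n subr0 cmod_circ gtr0_norm//.
by rewrite divff// expf_neq0// gt_eqF.
Qed.

Lemma mean_ln_sub r a : 0 < r -> cmod a != r ->
  rmean (fun t => ln (cmod (circ r t - a))) = ln (Num.max r (cmod a)).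
Proof.
move=> r0 ar; rewrite -bln0// -poisson_ln_sub ?cmod0//.
by apply: eq_rmean => t; rewrite pker0// mulr1.
Qed.

End PoissonLog.

(** * Local structure of meromorphic functions *)

Section Meromorphic.
Variable R : realType.
Implicit Types (f g w : R[i] -> R[i]) (p z a : R[i]) (d : R) (m : int).

Definition regular_at f p := exists2 d, 0 < d &
  forall z, cmod (z - p) < d -> holo f z /\ f z != 0.

(** The identity is not asked at [p] itself, where the value of [f] at a pole is arbitrary. Positive
    [m] is a zero, negative [m] a pole. *)
Definition mero_order f p m := exists g d, [/\ 0 < d,
  forall z, cmod (z - p) < d -> holo g z,
  forall z, cmod (z - p) < d -> g z != 0 &
  forall z, cmod (z - p) < d -> z != p -> f z = (z - p) ^ m * g z].

Lemma dnbhsCP p (A : set R[i]) :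
  dnbhs (p : R[i]^o) A <->
  exists2 d : R, 0 < d & forall z, cmod (z - p) < d -> z != p -> A z.
Proof.
split.
  move=> H; have [d d0 Hd] := (nbhsCP p (fun z => z != p -> A z)).1 H.
  by exists d.
move=> [d d0 Hd]; apply: (nbhsCP p (fun z => z != p -> A z)).2.
by exists d.
Qed.

Lemma holo_neq0_near f p d : 0 < d -> (forall z, cmod (z - p) < d -> holo f z) ->
  f p != 0 -> regular_at f p.
Proof.
move=> d0 hf fp; have hp : holo f p by apply: hf; rewrite subrr cmod0.
have /continuousCP := derivable_cvgC (holo_derivable hp).
have c0 : 0 < cmod (f p) by rewrite cmod_gt0.
move=> /(_ _ c0) /(nbhsCP p _).1 [q q0 Hq].
exists (Num.min d q); first by rewrite lt_min d0.
move=> z; rewrite lt_min => /andP[zd zq]; split; first exact: hf.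
by apply: contraTneq (Hq _ zq) => ->; rewrite sub0r cmodN ltxx.
Qed.

Lemma regular_mero f p : regular_at f p -> mero_order f p 0.
Proof.
move=> [d d0 H]; exists f, d; split => //.
- by move=> z /H[].
- by move=> z /H[].
- by move=> z _ _; rewrite expr0z mul1r.
Qed.

Lemma holo_mero f p d : 0 < d -> (forall z, cmod (z - p) < d -> holo f z) ->
  (exists n : nat, mero_order f p n) \/
  (exists2 d', 0 < d' & forall z, cmod (z - p) < d' -> f z = 0).
Proof.
move=> d0 hf; pose r := d / 2; have r0 : 0 < r by rewrite divr_gt0.
have rd : r < d by rewrite /r; lra.
have hF (y : R[i]) : cmod y <= r -> holo (fun z => f (p + z)) y.
  move=> wr; apply: holo_comp; last exact (holoD (holo_cst _ _) (holo_id _)).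
  by apply: hf; rewrite addrC addKr; exact: le_lt_trans rd.
have [[n [g [hg g0 E]]]|E] := holo_zero_order r0 hF; last first.
  right; exists r => // z zr; have := E _ zr.
  by rewrite addrC subrK.
left; exists n.
have hG z : cmod (z - p) < r -> holo (fun z => g (z - p)) z.
  move=> zr; apply: (@holo_comp _ g (fun z => z - p)); first exact: hg.
  exact (holoB (holo_id _) (holo_cst _ _)).
have G0 : g (p - p) != 0 by rewrite subrr.
have [d' d'0 H] := holo_neq0_near r0 hG G0.
exists (fun z => g (z - p)), (Num.min r d'); split.
- by rewrite lt_min r0.
- by move=> z; rewrite lt_min => /andP[zr _]; exact: hG.
- by move=> z; rewrite lt_min => /andP[_ /H[]].
- move=> z; rewrite lt_min => /andP[zr _] _.
  by have := E _ zr; rewrite [p + _]addrC subrK.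
Qed.

(** The function [(z - p) / f z], set to 0 at [p], is differentiable at [p] with derivative 0
    because [|f|] tends to infinity; the extra factor [z - p] makes this immediate. If it has a zero
    of order [n], then [f] has order [1 - n]. *)
Lemma pole_mero f p : is_pole f p -> exists m, mero_order f p m.
Proof.
move=> [Hd Hinf].
have [d1 d10 H1] := (dnbhsCP p _).1 Hd.
have big (A : R) : exists2 d, 0 < d &
    forall z, cmod (z - p) < d -> z != p -> A < cmod (f z).
  by apply: (dnbhsCP p (fun z => A < cmod (f z))).1; move/cvgryPgt : Hinf; apply.
have [d2 d20 H2] := big 0.
pose d := Num.min d1 d2; have d0 : 0 < d by rewrite lt_min d10.
have f0 z : cmod (z - p) < d -> z != p -> f z != 0.
  by rewrite lt_min => /andP[_ zd] zp; rewrite -cmod_gt0; exact: H2.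
have hf z : cmod (z - p) < d -> z != p -> holo f z.
  by rewrite lt_min => /andP[zd _] zp; split; exact: H1.
pose k z := if z == p then 0 else (z - p) / f z.
have hk z : cmod (z - p) < d -> holo k z.
  move=> zd; have [->|zp] := eqVneq z p.
    apply: (@hasder_holo _ _ _ 0) => e e0.
    have [q q0 Hq] := big e^-1.
    exists q => // y yq; rewrite /k eqxx mul0r !subr0.
    have [->|yp] := eqVneq y p; first by rewrite subrr cmod0 mulr0.
    have K := Hq _ yq yp; have fy : 0 < cmod (f y).
      by apply: lt_trans K; rewrite invr_gt0.
    rewrite cmodM cmodV mulrC ler_wpM2r ?cmod_ge0// -[leRHS]invrK.
    by rewrite lef_pV2 ?posrE ?invr_gt0// ltW.
  have zp0 : 0 < cmod (z - p) by rewrite cmod_gt0 subr_eq0.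
  apply: (@holo_near _ (fun z => (z - p) / f z) _ _ _ zp0).
    move=> y yz; rewrite /k; case: eqVneq => // yp.
    by move: yz; rewrite yp cmodB_sym ltxx.
  have hzp := holoB (holo_id z) (holo_cst p z).
  exact (holoM hzp (holoV (f0 _ zd zp) (hf _ zd zp))).
have k0 z : cmod (z - p) < d -> z != p -> k z != 0.
  move=> zd zp; rewrite /k (negbTE zp) mulf_neq0 ?subr_eq0 ?invr_eq0//.
  exact: f0.
have [[n [g [d' [d'0 hg g0 E]]]]|[d' d'0 E]] := holo_mero d0 hk; last first.
  exfalso; pose y := p + (Num.min d d' / 2)%:C.
  have m0 : 0 < Num.min d d' / 2 by rewrite divr_gt0// lt_min d0.
  have yp : cmod (y - p) = Num.min d d' / 2.
    by rewrite /y addrC addKr cmod_real gtr0_norm.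
  have ym : cmod (y - p) < Num.min d d'.
    by rewrite yp ltr_pdivrMr// ltr_pMr ?ltr1n// lt_min d0.
  move: ym; rewrite lt_min => /andP[yd yd'].
  have ynp : y != p by rewrite -subr_eq0 -cmod_gt0 yp.
  by have := k0 _ yd ynp; rewrite (E _ yd') eqxx.
exists (1 - n%:Z), (fun z => (g z)^-1), (Num.min d d'); split.
- by rewrite lt_min d0.
- by move=> z; rewrite lt_min => /andP[_ zd]; exact: holoV (g0 _ zd) (hg _ zd).
- by move=> z; rewrite lt_min => /andP[_ zd]; rewrite invr_eq0 g0.
- move=> z; rewrite lt_min => /andP[zd zd'] zp.
  have := E _ zd' zp; rewrite /k (negbTE zp) => Ez.
  have zp0 : z - p != 0 by rewrite subr_eq0.
  have -> : f z = (z - p) / ((z - p) / f z) by rewrite invfM invrK mulVKf.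
  by rewrite Ez expfzDr// expr1z -invr_expz invfM mulrA.
Qed.

Lemma mero_local w p : meromorphic w ->
  (exists m, mero_order w p m) \/
  (exists2 d, 0 < d & forall z, cmod (z - p) < d -> w z = 0).
Proof.
move=> /(_ p)[H|/pole_mero]; last by left.
have [d d0 Hd] := (nbhsCP p _).1 H.
have [|[n Hn]|] := holo_mero d0 (f := w) (p := p).
- by move=> z zd; split; exact: Hd.
- by left; exists n.
- by right.
Qed.

End Meromorphic.

(** * Factoring out zeros and poles *)

Section Factorization.
Variable R : realType.
Implicit Types (f g w : R[i] -> R[i]) (p q z a : R[i]) (d : R) (m k : int).

Lemma disc_in p q d : cmod (q - p) < d -> exists2 d', 0 < d' &
  forall z, cmod (z - q) < d' -> cmod (z - p) < d.
Proof.
move=> qd; exists (d - cmod (q - p)); first by rewrite subr_gt0.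
move=> z zq; have -> : z - p = (z - q) + (q - p) by ring.
by apply: le_lt_trans (cmodD _ _) _; lra.
Qed.

Lemma mero_order_nonzero w p m d' : mero_order w p m -> 0 < d' ->
  exists z, [/\ cmod (z - p) < d', z != p & w z != 0].
Proof.
move=> [g [d [d0 hg g0 E]]] d'0.
pose e := Num.min d d' / 2.
have m0 : 0 < Num.min d d' by rewrite lt_min d0.
have e0 : 0 < e by rewrite divr_gt0.
have em : e < Num.min d d' by rewrite ltr_pdivrMr// ltr_pMr ?ltr1n.
move: em; rewrite lt_min => /andP[ed ed'].
have zp : cmod (p + e%:C - p) = e by rewrite addrC addKr cmod_real gtr0_norm.
have zne : p + e%:C != p by rewrite -subr_eq0 -cmod_gt0 zp.
exists (p + e%:C); rewrite zp; split => //.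
have zd : cmod (p + e%:C - p) < d by rewrite zp.
by rewrite (E _ zd zne) mulf_neq0 ?g0// expfz_neq0// subr_eq0.
Qed.

(** An identity theorem: local vanishing at [p] propagates along the segment from [p] to [z0], where
    [w] is nonzero. *)
Lemma mero_order_all w : meromorphic w -> (exists z, w z != 0) ->
  forall p, exists m, mero_order w p m.
Proof.
move=> mw [z0 wz0] p; have [//|Zp] := mero_local p mw; exfalso.
pose Z q := exists2 d, 0 < d & forall z, cmod (z - q) < d -> w z = 0.
pose ga (t : R) := p + t%:C * (z0 - p).
have gaB s t : cmod (ga s - ga t) = `|s - t| * cmod (z0 - p).
  have -> : ga s - ga t = (s - t)%:C * (z0 - p) by rewrite /ga rmorphB/=; ring.
  by rewrite cmodM cmod_real.
have ZE q : Z q -> w q = 0 by move=> [d d0]; apply; rewrite subrr cmod0.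
have ga0 : ga 0 = p by rewrite /ga mul0r addr0.
have ga1 : ga 1 = z0 by rewrite /ga mul1r addrC subrK.
have L0 : 0 < cmod (z0 - p).
  rewrite cmod_gt0 subr_eq0; apply: contraNneq wz0 => ->.
  by rewrite ZE.
set L := cmod (z0 - p) in L0 gaB.
pose T : set R := [set t | 0 <= t <= 1 /\ forall s, 0 <= s <= t -> Z (ga s)].
have T0 : T 0.
  split; first by rewrite lexx ler01.
  by move=> s; rewrite -eq_le => /eqP <-; rewrite ga0.
have Tub : has_ubound T by exists 1 => t [/andP[]].
have Tsup : has_sup T by split => //; exists 0.
pose ts := sup T.
have ts0 : 0 <= ts by exact: ub_le_sup.
have ts1 : ts <= 1 by apply: ge_sup; [exists 0|move=> t [/andP[]]].
have near_ts e : 0 < e -> exists2 t, T t & ts - e < t.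
  by move=> e0; exact: sup_adherent.
(* At the supremum a finite order is excluded: [w] vanishes near [ga ts] itself or near points of
   the segment just before it, against nonvanishing on a punctured disc. Local vanishing at [ga ts]
   reaches [z0] or passes beyond the supremum. *)
have [[m Hm]|[d d0 Hd]] := mero_local (ga ts) mw.
  have [g [d [d0 hg g0 E]]] := Hm.
  have [t [t01 Ht] tts] := near_ts (d / L) ltac:(by rewrite divr_gt0).
  have tle : t <= ts by apply: ub_le_sup.
  have /andP[t0 t1] := t01.
  have Zt := Ht t ltac:(by rewrite t0 lexx).
  have [tE|tN] := eqVneq t ts.
    move: Zt; rewrite tE => -[d' d'0 Hd'].
    have [y [yd' _]] := mero_order_nonzero Hm d'0.
    by rewrite (Hd' _ yd') eqxx.
  have near_t : cmod (ga t - ga ts) < d.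
    rewrite gaB -ltr_pdivlMr// ler0_norm ?subr_le0//.
    by move: tts; lra.
  have nt : ga t != ga ts.
    by rewrite -subr_eq0 -cmod_gt0 gaB mulr_gt0// normr_gt0 subr_eq0.
  have := E _ near_t nt; rewrite (ZE _ Zt) => /esym/eqP.
  by rewrite mulf_eq0 (negbTE (g0 _ near_t)) orbF expfz_eq0 subr_eq0 (negbTE nt) andbF.
have Zts s : cmod (ga s - ga ts) < d -> Z (ga s).
  by move=> sd; have [d' d'0 Hd'] := disc_in sd; exists d' => // z /Hd' /Hd.
have [tsE|tsN] := eqVneq ts 1.
  by move: wz0; rewrite -ga1 -tsE ZE ?eqxx//; exists d.
pose t' := Num.min 1 (ts + d / (2 * L)).
have tlt : ts < t'.
  by rewrite lt_min ltrDl divr_gt0 ?mulr_gt0// lt_neqAle tsN ts1.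
suff : T t' by move=> /(ub_le_sup Tub); rewrite leNgt tlt.
split; first by rewrite (le_trans ts0 (ltW tlt))/= ge_min lexx.
move=> s /andP[s0 st'].
have [sts|tss] := ltP s ts.
  have [t [t01 Ht] tts] := near_ts (ts - s) ltac:(by rewrite subr_gt0).
  by apply: Ht; rewrite s0/=; move: tts; lra.
apply: Zts; rewrite gaB -ltr_pdivlMr// ger0_norm ?subr_ge0//.
have t2 : t' <= ts + d / (2 * L) by rewrite ge_min lexx orbT.
have -> : d / L = d / (2 * L) + d / (2 * L) by field; rewrite gt_eqF.
have e0 : 0 < d / (2 * L) by rewrite divr_gt0// mulr_gt0.
by move: st' t2 e0; lra.
Qed.

Lemma holo_expz k q z : z != q -> holo (fun z => (z - q) ^ k) z.
Proof.
move=> zq; have hz : holo (fun z => z - q) z by exact (holoB (holo_id _) (holo_cst _ _)).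
case: k => n; first exact (holoX n hz).
apply: (holoV _ (holoX n.+1 hz)).
by rewrite expf_neq0// subr_eq0.
Qed.

Lemma mero_order_punctured w p m : mero_order w p m -> exists2 d, 0 < d &
  forall z, cmod (z - p) < d -> z != p -> regular_at w z.
Proof.
move=> [g [d [d0 hg g0 E]]]; exists d => // z zd zp.
have [d' d'0 Hd'] := disc_in zd.
have zp0 : 0 < cmod (z - p) by rewrite cmod_gt0 subr_eq0.
have yp y : cmod (y - z) < cmod (z - p) -> y != p.
  by apply: contraTneq => ->; rewrite cmodB_sym ltxx.
exists (Num.min d' (cmod (z - p))); first by rewrite lt_min d'0.
move=> y; rewrite lt_min => /andP[/Hd' yd yz]; have ynp := yp _ yz; split.
  have [e e0 He] := disc_in yd.
  have q0 : 0 < Num.min e (cmod (y - p)) by rewrite lt_min e0 cmod_gt0 subr_eq0.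
  apply: (@holo_near _ (fun z => (z - p) ^ m * g z) _ _ _ q0).
    move=> x; rewrite lt_min => /andP[/He xd xy]; rewrite E//.
    by apply: contraTneq xy => ->; rewrite cmodB_sym ltxx.
  exact (holoM (holo_expz m ynp) (hg _ yd)).
by rewrite E// mulf_neq0 ?g0// expfz_neq0// subr_eq0.
Qed.

Lemma mero_order_ext f g p m d : 0 < d ->
  (forall z, cmod (z - p) < d -> z != p -> f z = g z) ->
  mero_order f p m -> mero_order g p m.
Proof.
move=> d0 fg [h [d' [d'0 hh h0 E]]]; exists h, (Num.min d d'); split.
- by rewrite lt_min d0.
- by move=> z; rewrite lt_min => /andP[_]; exact: hh.
- by move=> z; rewrite lt_min => /andP[_]; exact: h0.
- by move=> z; rewrite lt_min => /andP[zd zd'] zp; rewrite -fg// E.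
Qed.

Lemma regular_ext f g p d : 0 < d ->
  (forall z, cmod (z - p) < d -> f z = g z) ->
  regular_at f p -> regular_at g p.
Proof.
move=> d0 fg [d' d'0 H]; exists (Num.min d d'); first by rewrite lt_min d0.
move=> z; rewrite lt_min => /andP[zd zd']; have [hf f0] := H _ zd'.
rewrite -fg//; split => //.
have [e e0 He] := disc_in zd.
by apply: holo_near e0 _ hf => y /He /fg.
Qed.

Lemma regular_mul_expz f p q k : p != q -> regular_at f p ->
  regular_at (fun z => f z * (z - q) ^ k) p.
Proof.
move=> pq [d d0 H]; have pq0 : 0 < cmod (p - q) by rewrite cmod_gt0 subr_eq0.
exists (Num.min d (cmod (p - q))); first by rewrite lt_min d0.
move=> z; rewrite lt_min => /andP[/H[hf f0] zp].
have zq : z != q by apply: contraTneq zp => ->; rewrite cmodB_sym ltxx.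
split; first exact (holoM hf (holo_expz k zq)).
by rewrite mulf_neq0// expfz_neq0// subr_eq0.
Qed.

Lemma mero_order_mul_expz w p q k m : p != q -> mero_order w p m ->
  mero_order (fun z => w z * (z - q) ^ k) p m.
Proof.
move=> pq [g [d [d0 hg g0 E]]].
have pq0 : 0 < cmod (p - q) by rewrite cmod_gt0 subr_eq0.
have zq z : cmod (z - p) < cmod (p - q) -> z != q.
  by apply: contraTneq => ->; rewrite cmodB_sym ltxx.
exists (fun z => g z * (z - q) ^ k), (Num.min d (cmod (p - q))); split.
- by rewrite lt_min d0.
- by move=> z; rewrite lt_min => /andP[zd /zq zn]; exact (holoM (hg _ zd) (holo_expz k zn)).
- move=> z; rewrite lt_min => /andP[zd /zq zn].
  by rewrite mulf_neq0 ?g0// expfz_neq0// subr_eq0.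
- by move=> z; rewrite lt_min => /andP[zd _] zp; rewrite E// mulrA.
Qed.

Lemma factorization s : forall w (P : R[i] -> Prop), uniq s ->
  (forall p, exists m, mero_order w p m) ->
  (forall z, P z -> z \notin s -> regular_at w z) ->
  exists F (m : R[i] -> int), [/\ forall z, P z -> regular_at F z,
    forall z, z \notin s -> w z = F z * \prod_(a <- s) (z - a) ^ m a &
    forall a, a \in s -> mero_order w a (m a)].
Proof.
elim: s => [|a s IH] w P.
  move=> _ _ H; exists w, (fun=> 0); split => //; first by move=> z /H; apply.
  by move=> z _; rewrite big_nil mulr1.
move=> /= /andP[as_ us] Hw Hreg; have [ma Hma] := Hw a.
have [g [d [d0 hg g0 E]]] := Hma.
pose w1 z := if z == a then g a else w z * (z - a) ^ (- ma).
have w1a z : cmod (z - a) < d -> g z = w1 z.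
  move=> zd; rewrite /w1; case: eqVneq => [->//|za].
  by rewrite E// mulrAC -expfzDr ?subr_eq0// subrr expr0z mul1r.
have rega : regular_at w1 a.
  by apply: (regular_ext d0 w1a); exists d => // z zd; split; [exact: hg|exact: g0].
have offa p z : cmod (z - p) < cmod (p - a) -> w z * (z - a) ^ (- ma) = w1 z.
  move=> zp; rewrite /w1; case: eqVneq => // za.
  by move: zp; rewrite za cmodB_sym ltxx.
have pa0 p : p != a -> 0 < cmod (p - a) by rewrite cmod_gt0 subr_eq0.
have Hw1 p : exists m, mero_order w1 p m.
  have [->|pa] := eqVneq p a; first by exists 0; exact: regular_mero.
  have [m Hm] := Hw p; exists m.
  by apply: mero_order_ext (pa0 _ pa) (fun z zp _ => offa p z zp) _; exact: mero_order_mul_expz.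
have Hreg1 z : P z -> z \notin s -> regular_at w1 z.
  move=> Pz zs; have [->//|za] := eqVneq z a.
  apply: (regular_ext (pa0 _ za) (offa z)); apply: regular_mul_expz => //.
  by apply: Hreg => //; rewrite inE negb_or za.
have [F [m1 [HF HE Hm1]]] := IH w1 P us Hw1 Hreg1.
exists F, (fun x => if x == a then ma else m1 x); split => //.
- move=> z; rewrite inE negb_or => /andP[za zs]; rewrite big_cons eqxx.
  rewrite (eq_big_seq (fun b => (z - b) ^ m1 b)); last first.
    by move=> b bs; case: eqVneq => // ba; move: as_; rewrite -ba bs.
  rewrite mulrCA -HE// /w1 (negbTE za) mulrC -mulrA -expfzDr ?subr_eq0//.
  by rewrite addNr expr0z mulr1.
- move=> b; rewrite inE => /predU1P[->|bs]; first by rewrite eqxx.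
  have ba : b != a by apply: contraNneq as_ => <-.
  rewrite (negbTE ba).
  apply: (@mero_order_ext (fun z => w1 z * (z - a) ^ ma) w b (m1 b) _ (pa0 _ ba)).
    move=> z zb _; rewrite -(offa b)// -mulrA -expfzDr ?addNr ?expr0z ?mulr1//.
    by rewrite subr_eq0; apply: contraTneq zb => ->; rewrite cmodB_sym ltxx.
  by apply: mero_order_mul_expz => //; exact: Hm1.
Qed.

(** Each point has a punctured neighbourhood of regular points, so only the centres of a finite
    subcover can be irregular. Compactness is carried over from a real square containing the
    disc. *)
Lemma finite_irregular w (rho : R) : (forall p, exists m, mero_order w p m) ->
  exists2 s : seq R[i], uniq s &
    forall z, cmod z <= rho -> z \notin s -> regular_at w z.
Proof.
move=> Hw.
have /choice[r Hr] : forall p, exists d, 0 < d /\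
    forall z, cmod (z - p) < d -> z != p -> regular_at w z.
  by move=> p; have [m /mero_order_punctured[d d0 H]] := Hw p; exists d.
pose phi (xy : R * R) : R[i] := xy.1 +i* xy.2.
pose Q : set (R * R) := `[- rho, rho]%classic `*` `[- rho, rho]%classic.
have cQ : compact Q by apply: compact_setX; exact: segment_compact.
have cphi : continuous (phi : R * R -> R[i]^o).
  by move=> xy; apply: continuous_Complex; [exact: cvg_fst|exact: cvg_snd].
have cK : compact ((phi : R * R -> R[i]^o) @` Q).
  by apply: continuous_compact => //; exact: continuous_subspaceT.
move: cK; rewrite compact_cover => cK.
pose B p : set R[i]^o := [set z : R[i]^o | cmod (z - p) < r p].
have oB p : open (B p).
  rewrite openE => z zB; have [d d0 Hd] := disc_in zB.
  by apply: (nbhsCP z (B p)).2; exists d.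
have [|D _ HD] := cK R[i] setT B (fun p _ => oB p).
  by move=> z _; exists z => //; rewrite /B /= subrr cmod0; have [] := Hr z.
exists (undup (finmap.enum_fset D)); first exact: undup_uniq.
move=> z zrho; rewrite mem_undup => zD.
have [] := HD z.
  exists (Re z, Im z); last by rewrite /phi /= -complex_eta.
  split => /=; rewrite in_itv/= -ler_norml.
    exact: le_trans (Re_le_cmod _) zrho.
  exact: le_trans (Im_le_cmod _) zrho.
move=> p /= pD zp; have [_ H] := Hr p; apply: H => //.
by apply: contraNneq zD => ->.
Qed.

End Factorization.

(** * Orders of poles and divisors of a disc *)

Section Divisors.
Variable R : realType.
Implicit Types (f g w F : R[i] -> R[i]) (p q z a : R[i]) (d r rho t : R).
Implicit Types (m : int) (s : seq R[i]) (M : R[i] -> int).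

Lemma holo_cont_near f p e : holo f p -> 0 < e -> exists2 d, 0 < d &
  forall z, cmod (z - p) < d -> cmod (f z - f p) < e.
Proof.
move=> hp e0; have /continuousCP := derivable_cvgC (holo_derivable hp).
by move=> /(_ _ e0) /(nbhsCP p _).1.
Qed.

Lemma mero_order_bounds w p m : mero_order w p m -> exists A B d,
  [/\ 0 < A, 0 < B, 0 < d & forall z, cmod (z - p) < d -> z != p ->
     A * cmod (z - p) ^ m <= cmod (w z) <= B * cmod (z - p) ^ m].
Proof.
move=> [g [d [d0 hg g0 E]]].
have pd : cmod (p - p) < d by rewrite subrr cmod0.
have gp : 0 < cmod (g p) by rewrite cmod_gt0 g0.
have [d' d'0 Hd'] := holo_cont_near (hg _ pd) (divr_gt0 gp (ltr0n R 2)).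
exists (cmod (g p) / 2), (2 * cmod (g p)), (Num.min d d'); split.
- by rewrite divr_gt0.
- by rewrite mulr_gt0.
- by rewrite lt_min d0.
move=> z; rewrite lt_min => /andP[zd zd'] zp; rewrite E//.
have -> : cmod ((z - p) ^ m * g z) = cmod (g z) * cmod (z - p) ^ m.
  rewrite cmodM mulrC; congr (_ * _); case: m {E} => n; first exact: cmodX.
  by rewrite !NegzE -!invr_expz cmodV cmodX.
have K := Hd' _ zd'; have e0 : 0 <= cmod (z - p) ^ m by rewrite exprz_ge0// cmod_ge0.
have l1 := lerB_cmod (g p) (g z); have l2 := lerB_cmod (g z) (g p).
rewrite cmodB_sym in l1.
by rewrite !ler_wpM2r//; lra.
Qed.

Lemma pole_divergence w p : is_pole w p -> forall A, exists2 d, 0 < d &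
  forall z, cmod (z - p) < d -> z != p -> A < cmod (w z).
Proof.
move=> [_ Hinf] A; apply: (dnbhsCP p (fun z => A < cmod (w z))).1.
by move/cvgryPgt : Hinf; apply.
Qed.

Lemma puncture p d : 0 < d -> exists z, cmod (z - p) < d /\ z != p.
Proof.
move=> d0; exists (p + (d / 2)%:C).
have E : cmod (p + (d / 2)%:C - p) = d / 2.
  by rewrite addrC addKr cmod_real gtr0_norm// divr_gt0.
rewrite E ltr_pdivrMr// ltr_pMr ?ltr1n//; split => //.
by rewrite -subr_eq0 -cmod_gt0 E divr_gt0.
Qed.

Lemma exprz_le1 (x : R) m : 0 <= x <= 1 -> 0 <= m -> x ^ m <= 1.
Proof. by case: m => // n /andP[x0 x1] _; exact: exprn_ile1. Qed.

Lemma is_poleP w p m : mero_order w p m -> is_pole w p <-> m < 0.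
Proof.
move=> Hm; have [A [B [d [A0 B0 d0 HAB]]]] := mero_order_bounds Hm; split.
  move=> Hp; rewrite ltNge; apply/negP => m0.
  have [d' d'0 Hd'] := pole_divergence Hp B.
  have [z [+ zp]] : exists z, cmod (z - p) < Num.min 1 (Num.min d d') /\ z != p.
    by apply: puncture; rewrite !lt_min ltr01 d0.
  rewrite !lt_min => /and3P[z1 zd zd'].
  have := Hd' _ zd' zp; rewrite ltNge => /negP; apply.
  have /andP[_ K] := HAB _ zd zp; apply: le_trans K _.
  rewrite -[leRHS]mulr1 ler_pM2l// exprz_le1//.
  by rewrite cmod_ge0 ltW.
move=> m0; split.
  have [e e0 He] := mero_order_punctured Hm.
  apply: (dnbhsCP p (fun z => derivable (w : R[i]^o -> R[i]^o) z 1)).2.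
  exists e => // z zd zp; have [e' e'0 He'] := He _ zd zp.
  by have [[hz] _] := He' z ltac:(by rewrite subrr cmod0).
apply/cvgryPgt => K; apply: (dnbhsCP p (fun z => K < cmod (w z))).2.
exists (Num.min 1 (Num.min d (A / (`|K| + 1)))).
  by rewrite !lt_min ltr01 d0 divr_gt0// ltr_wpDl.
move=> z; rewrite !lt_min => /and3P[z1 zd zA] zp.
have /andP[+ _] := HAB _ zd zp; apply: lt_le_trans.
have zp0 : 0 < cmod (z - p) by rewrite cmod_gt0 subr_eq0.
apply: le_lt_trans (ler_norm K) _.
apply: lt_le_trans (_ : A * (cmod (z - p))^-1 <= _); last first.
  rewrite ler_pM2l//.
  case: m {Hm HAB} m0 => // n _; rewrite NegzE -invr_expz -exprnP.
  rewrite lef_pV2 ?posrE ?exprn_gt0// exprSr.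
  rewrite ler_piMl ?exprn_ile1 ?ltW//.
rewrite ltr_pdivlMr//; move: zA; rewrite ltr_pdivlMr ?ltr_wpDl// mulrC.
by apply: le_lt_trans; rewrite ler_wpM2r ?ltW// ltr_pwDr.
Qed.

(** As [pole_order] is a choice, uniqueness of the exponent is the point: [|w|] is comparable to
    [|z - p|^m], so a smaller exponent makes the product unbounded and a larger one makes it tend to
    0. *)
Lemma pole_orderE w p m : mero_order w p m -> m < 0 -> pole_order w p = `|m|%N.
Proof.
move=> Hm m0; have [g [d [d0 hg g0 E]]] := Hm.
case: m m0 Hm E => // n _ Hm E; rewrite NegzE abszN absz_nat.
have pd : cmod (p - p) < d by rewrite subrr cmod0.
have gE z : cmod (z - p) < d -> z != p -> (z - p) ^+ n.+1 * w z = g z.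
  move=> zd zp; rewrite E// NegzE -invr_expz mulrA divff ?mul1r//.
  by rewrite expf_neq0// subr_eq0.
pose P : set nat := [set k | (0 < k)%N /\ exists2 l : R[i]^o, l != 0 &
    ((z - p) ^+ k * w z : R[i]^o) @[z --> (p : R[i]^o)^'] --> l].
have limP k (l : R[i]) : ((z - p) ^+ k * w z : R[i]^o) @[z --> (p : R[i]^o)^'] --> (l : R[i]^o) ->
    forall e, 0 < e -> exists2 d, 0 < d &
    forall z, cmod (z - p) < d -> z != p -> cmod ((z - p) ^+ k * w z - l) < e.
  move=> H e e0; apply: (dnbhsCP p (fun z => cmod ((z - p) ^+ k * w z - l) < e)).1.
  exact: (continuousCP _ _ _).1 H e e0.
have Pn : P n.+1.
  split => //; exists (g p); first exact: g0.
  apply/continuousCP => e e0.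
  have [q q0 Hq] := holo_cont_near (hg _ pd) e0.
  apply: (dnbhsCP p (fun z => cmod ((z - p) ^+ n.+1 * w z - g p) < e)).2.
  exists (Num.min q d); first by rewrite lt_min q0.
  by move=> z; rewrite lt_min => /andP[zq zd] zp; rewrite gE// Hq.
have [A [B [d1 [A0 B0 d10 HAB]]]] := mero_order_bounds Hm.
have uniq k : P k -> k = n.+1.
  move=> [k0 [l l0 Hl]]; have cl : 0 < cmod l by rewrite cmod_gt0.
  have HAB' z : cmod (z - p) < d1 -> z != p ->
      A * (cmod (z - p) ^+ n.+1)^-1 <= cmod (w z) <= B * (cmod (z - p) ^+ n.+1)^-1.
    by move=> zd zp; have := HAB _ zd zp; rewrite NegzE -invr_expz.
  have [d2 d20 H2] := limP _ _ Hl _ (divr_gt0 cl (ltr0n R 2)).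
  have [kn|nk|//] := ltngtP k n.+1; exfalso.
    pose D := Num.min (Num.min 1 (A / (2 * cmod l))) (Num.min d1 d2).
    have [z [+ zp]] : exists z, cmod (z - p) < D /\ z != p.
      by apply: puncture; rewrite !lt_min ltr01 divr_gt0 ?mulr_gt0 ?d10.
    rewrite !lt_min -!andbA => /and4P[z1 zA zd1 zd2].
    have zp0 : 0 < cmod (z - p) by rewrite cmod_gt0 subr_eq0.
    have K1 := H2 _ zd2 zp; have /andP[K2 _] := HAB' _ zd1 zp.
    have K3 : A / cmod (z - p) <= cmod ((z - p) ^+ k * w z).
      rewrite cmodM cmodX [leRHS]mulrC.
      apply: (le_trans _ (ler_wpM2r (exprn_ge0 _ (ltW zp0)) K2)).
      rewrite -mulrA ler_pM2l//.
      have E1 : n.+1 = (k + (n - k).+1)%N.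
        by rewrite addnS; congr S; apply/esym/subnKC; move: kn; rewrite ltnS.
      rewrite E1 exprD invfM mulrAC mulVf ?mul1r ?expf_neq0 ?gt_eqF//.
      rewrite lef_pV2 ?posrE ?exprn_gt0// exprSr.
      by rewrite ler_piMl ?exprn_ile1 ?ltW.
    move: zA; rewrite ltr_pdivlMr ?mulr_gt0// => zA.
    have K4 : 2 * cmod l < A / cmod (z - p) by rewrite ltr_pdivlMr// mulrC.
    by have := lerB_cmod ((z - p) ^+ k * w z) l; lra.
  pose D := Num.min (Num.min 1 (cmod l / (2 * B))) (Num.min d1 d2).
  have [z [+ zp]] : exists z, cmod (z - p) < D /\ z != p.
    by apply: puncture; rewrite !lt_min ltr01 divr_gt0 ?mulr_gt0 ?d10.
  rewrite !lt_min -!andbA => /and4P[z1 zA zd1 zd2].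
  have zp0 : 0 < cmod (z - p) by rewrite cmod_gt0 subr_eq0.
  have K1 := H2 _ zd2 zp; have /andP[_ K2] := HAB' _ zd1 zp.
  have K3 : cmod ((z - p) ^+ k * w z) <= B * cmod (z - p).
    rewrite cmodM cmodX [leLHS]mulrC.
    apply: le_trans (ler_wpM2r (exprn_ge0 _ (ltW zp0)) K2) _.
    rewrite -mulrA ler_pM2l//.
    have -> : k = (n.+1 + (k - n.+2).+1)%N by rewrite addnS -addSn subnKC.
    rewrite exprD mulrA mulVf ?mul1r ?expf_neq0 ?gt_eqF//.
    by rewrite exprSr ler_piMl ?exprn_ile1 ?ltW.
  move: zA; rewrite ltr_pdivlMr ?mulr_gt0// => zA.
  have := lerB_cmod l ((z - p) ^+ k * w z).
  by rewrite cmodB_sym; lra.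
by apply: uniq; apply: (@xgetPex _ 0%N P); exists n.+1.
Qed.

(** This rests on the exclusion of removable singularities: [p] is no pole, so [w] is continuous
    there, and [w p] cannot be 0 while [|w|] stays above [A] nearby. Hence points of a divisor have
    nonzero order. *)
Lemma order0_regular w p : meromorphic w -> mero_order w p 0 -> regular_at w p.
Proof.
move=> /(_ p)[H|Hp] H0; last by have := (is_poleP H0).1 Hp; rewrite ltxx.
have [d1 d10 Hd1] := (nbhsCP p _).1 H.
have hw z : cmod (z - p) < d1 -> holo w z by move=> zd; split; exact: Hd1.
apply: (holo_neq0_near d10 hw).
have [A [B [d [A0 B0 d0 HAB]]]] := mero_order_bounds H0.
apply/eqP => wp0.
have pd : cmod (p - p) < d1 by rewrite subrr cmod0.
have [q q0 Hq] := holo_cont_near (hw _ pd) A0.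
have dq0 : 0 < Num.min d q by rewrite lt_min d0.
have [z [+ zp]] := puncture p dq0.
rewrite lt_min => /andP[zd zq].
have /andP[+ _] := HAB _ zd zp; rewrite expr0z mulr1 leNgt => /negP; apply.
by have := Hq _ zq; rewrite wp0 subr0.
Qed.

(* s consists of zeros and poles of w and contains all those of the closed disc of
   radius rho; M gives their orders (negative at poles), and the holomorphic cofactor
   F has no zeros in the disc. *)
Record divisor w rho s F M : Prop := Divisor {
  div_uniq : uniq s;
  div_irregular : forall a, a \in s -> ~ regular_at w a;
  div_regular : forall z, cmod z <= rho -> z \notin s -> regular_at w z;
  div_cofactor : forall z, cmod z <= rho -> regular_at F z;
  div_factor : forall z, z \notin s -> w z = F z * \prod_(a <- s) (z - a) ^ M a;
  div_order : forall a, a \in s -> mero_order w a (M a) }.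

Lemma divisor_ex w rho : meromorphic w -> (exists z, w z != 0) ->
  exists s F M, divisor w rho s F M.
Proof.
move=> mw w0; have Hw := mero_order_all mw w0.
have [s0 us0 H0] := finite_irregular rho Hw.
pose s := [seq a <- s0 | ~~ `[< regular_at w a >]].
have us : uniq s by exact: filter_uniq.
have Hreg z : cmod z <= rho -> z \notin s -> regular_at w z.
  move=> zr; rewrite mem_filter negb_and negbK => /orP[/asboolP//|].
  exact: H0.
have [F [M [HF HE HM]]] := @factorization _ s w (fun z => cmod z <= rho) us Hw Hreg.
exists s, F, M; split => //.
by move=> a; rewrite mem_filter => /andP[/asboolPn].
Qed.

End Divisors.

(** * The Poisson-Jensen formula *)

Section Counting.
Variable R : realType.
Implicit Types (f w F : R[i] -> R[i]) (p z a : R[i]) (r rho t x : R).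
Implicit Types (s : seq R[i]) (M : R[i] -> int).

Lemma integral_rint (a b : R) (u : R -> R) : cont_on a b u ->
  (\int[lebesgue_measure]_(x in `[a, b]) (u x)%:E)%E = (rint a b u)%:E.
Proof.
by move=> cu; rewrite /rint /Rintegral fineK//; apply: integrable_fin_num => //; exact: integrable_cont.
Qed.

Lemma cont_measurable (A : set R) (u : R -> R) : measurable A ->
  (forall t, A t -> {for t, continuous u}) -> measurable_fun A u.
Proof.
move=> mA cu; apply: subspace_continuous_measurable_fun => //.
by apply: continuous_in_subspaceT => t /set_mem /cu.
Qed.

Lemma rint_inv (a b : R) : 0 < a -> a <= b -> rint a b (fun t => t^-1) = ln (b / a).
Proof.
move=> a0 ab; have b0 := lt_le_trans a0 ab.
rewrite ln_div ?posrE//; apply: Rint_FTC => //.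
  by move=> t /andP[at_ _]; apply: is_derive1_ln; exact: lt_le_trans at_.
by move=> t /andP[at_ _]; apply: cvgV; [rewrite gt_eqF// (lt_le_trans a0)|exact: cvg_id].
Qed.

Definition multneg M a : R := if M a < 0 then `|M a|%N%:R else 0.
Definition multpos M a : R := if 0 < M a then `|M a|%N%:R else 0.

Lemma multneg_ge0 M a : 0 <= multneg M a.
Proof. by rewrite /multneg; case: ifP. Qed.

Lemma multpos_ge0 M a : 0 <= multpos M a.
Proof. by rewrite /multpos; case: ifP. Qed.

Lemma mult_split M a : (M a)%:~R = multpos M a - multneg M a.
Proof.
rewrite /multpos /multneg; case: (ltgtP (M a) 0) => [M0|M0|M0].
- by rewrite sub0r; case: (M a) M0 => // n _; rewrite NegzE mulrNz.
- by rewrite subr0; case: (M a) M0.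
- by rewrite M0 subr0 mulr0z.
Qed.

Section WithDivisor.
Variables (w : R[i] -> R[i]) (rho : R) (s : seq R[i]) (F : R[i] -> R[i]).
Variable (M : R[i] -> int).
Hypothesis D : divisor w rho s F M.

Lemma pole_in_div p : cmod p <= rho -> is_pole w p -> p \in s /\ M p < 0.
Proof.
move=> pr Hp.
have ps : p \in s.
  apply: contraT => /(div_regular D pr)/regular_mero/is_poleP H.
  by have := H.1 Hp; rewrite ltxx.
by split => //; exact: (is_poleP (div_order D ps)).1 Hp.
Qed.

Lemma pole_countE t : t <= rho ->
  pole_count t w = (\sum_(a <- s | (cmod a <= t)) multneg M a)%:E.
Proof.
move=> tr; rewrite /pole_count.
pose s' := [seq a <- s | (M a < 0) && (cmod a <= t)].
have -> : [set p | is_pole w p /\ cmod p <= t] = [set` s'].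
  apply/seteqP; split => p /=; rewrite mem_filter.
    by move=> [Hp pt]; have [-> ->] := pole_in_div (le_trans pt tr) Hp; rewrite pt.
  move=> /andP[/andP[m0 pt] ps]; split => //.
  exact: (is_poleP (div_order D ps)).2.
rewrite esum_fset//; last exact: finite_seq.
rewrite -fsbig_seq; last by rewrite filter_uniq// (div_uniq D).
rewrite big_filter -sumEFin [RHS]big_mkcond [LHS]big_mkcond /=.
apply: eq_big_seq => a as_; rewrite /multneg.
case: ifPn => [/andP[m0 ->]|]; first by rewrite m0 (pole_orderE (div_order D as_) m0).
by rewrite negb_and => /orP[/negbTE->|/negbTE->]//; case: ifP.
Qed.

(** The integrated count of a simple pole at [a]: the integral of [1 / t] from [|a|] to [r], or the
    separate [ln r] term for a pole at the origin. *)
Definition radial r a : R :=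
  if cmod a <= r then (if a == 0 then ln r else ln (r / cmod a)) else 0.

Lemma int_pole_countE r : 0 < r -> r <= rho ->
  int_pole_count r w = (\sum_(a <- s) multneg M a * radial r a)%:E.
Proof.
move=> r0 rr; rewrite /int_pole_count.
have z0 a : (cmod a <= 0) = (a == 0).
  by rewrite le_eqVlt ltNge cmod_ge0 orbF cmod_eq0.
rewrite (pole_countE (le_trans (ltW r0) rr)).
under eq_bigl do rewrite z0.
(* The integrand is split into one step function over [t] for each pole, so that the finite sum can
   be exchanged with the integral. *)
pose h a t : \bar R := if (a != 0) && (cmod a <= t) then (multneg M a * t^-1)%:E else 0%E.
have E1 : (\int[lebesgue_measure]_(t in `]0%R, r]) ((pole_count t w -
     (\sum_(a <- s | a == 0) multneg M a)%:E) * (t^-1)%:E) =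
   \int[lebesgue_measure]_(t in `]0%R, r]) (\sum_(a <- s) h a t))%E.
  apply: eq_integral => t /set_mem /=; rewrite in_itv/= => /andP[t0 tr].
  rewrite pole_countE ?(le_trans tr)// -EFinB -EFinM.
  have -> : \sum_(a <- s | cmod a <= t) multneg M a - \sum_(a <- s | a == 0) multneg M a
      = \sum_(a <- s | (a != 0) && (cmod a <= t)) multneg M a.
    rewrite [X in X - _](bigID (fun a => a == 0)) /=.
    rewrite (eq_bigl (fun a => a == 0)); last first.
      by move=> a /=; case: eqVneq => [->|]; rewrite ?andbF// cmod0 ltW.
    by rewrite addrAC subrr add0r; apply: eq_bigl => a; rewrite andbC.
  rewrite big_distrl /= -sumEFin big_mkcond /=.
  by apply: eq_bigr => a _; rewrite /h; case: ifP.
rewrite E1 ge0_integral_sum//; last 2 first.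
- move=> a; rewrite /h.
  case: (a == 0) => /=; first exact: measurable_cst.
  apply: measurable_fun_if => //.
  + by apply: (@measurable_fun_ler _ _ _ _ (cst (cmod a)) id).
  + apply: (@measurable_funS _ _ _ _ `]0%R, r]%classic) => //.
    apply/measurable_EFinP; apply: measurable_funM => //.
    apply: cont_measurable => // t; rewrite /= in_itv/= => /andP[t0 _].
    by apply: cvgV; [rewrite gt_eqF|exact: cvg_id].
- move=> a t; rewrite /= in_itv/= => /andP[t0 _]; rewrite /h; case: ifP => // _.
  by rewrite lee_fin mulr_ge0 ?multneg_ge0// invr_ge0 ltW.
have E2 a : (\int[lebesgue_measure]_(t in `]0%R, r]) h a t)%E =
    (if a == 0 then 0 else multneg M a * radial r a)%:E.
  rewrite /h; case: eqVneq => [->|a0] /=; first by rewrite integral0.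
  have ca : 0 < cmod a by rewrite cmod_gt0.
  rewrite /radial (negbTE a0); case: leP => ar; last first.
    rewrite mulr0; apply: integral0_eq => t /=; rewrite in_itv/= => /andP[_ tr].
    by rewrite leNgt (le_lt_trans tr ar).
  transitivity (\int[lebesgue_measure]_(t in `]0%R, r] `&` `[cmod a, r]) (multneg M a * t^-1)%:E)%E.
    rewrite integral_mkcondr; apply: eq_integral => t /set_mem /=.
    rewrite in_itv/= => /andP[t0 tr]; rewrite patchE.
    case: (boolP (cmod a <= t)) => at_; first by rewrite mem_set//= in_itv/= at_.
    by rewrite memNset//= in_itv/= (negbTE at_).
  have -> : `]0%R, r]%classic `&` `[cmod a, r]%classic = `[cmod a, r]%classic.
    apply/seteqP; split => t /=; rewrite !in_itv/=; first by case.
    by move=> /andP[at_ tr]; rewrite at_ tr (lt_le_trans ca).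
  have ci : cont_on (cmod a) r (fun t : R => t^-1).
    by move=> t /andP[at_ _]; apply: cvgV; [rewrite gt_eqF// (lt_le_trans ca)|exact: cvg_id].
  rewrite integral_rint; last by move=> t tar; apply: cvgMr; exact: ci.
  by rewrite RintZ// rint_inv.
rewrite (eq_bigr _ (fun a _ => E2 a)).
rewrite sumEFin -EFinM -EFinD; congr (_%:E).
rewrite big_distrl /= [X in _ + X]big_mkcond -big_split /=.
apply: eq_bigr => a _; rewrite /radial; case: eqVneq => [->|_]; last by rewrite addr0.
by rewrite cmod0 (ltW r0) add0r.
Qed.

End WithDivisor.

End Counting.

(** * The Poisson-Jensen and Jensen formulas *)

Section Jensen.
Variable R : realType.
Implicit Types (f F : R[i] -> R[i]) (p z a : R[i]) (r rho t x : R).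
Implicit Types (s : seq R[i]) (M : R[i] -> int).

Lemma ln_cmod_expz z (m : int) : z != 0 -> ln (cmod (z ^ m)) = m%:~R * ln (cmod z).
Proof.
move=> z0; have cz : 0 < cmod z by rewrite cmod_gt0.
case: m => n; first by rewrite -exprnP cmodX lnXn// mulr_natl.
by rewrite NegzE -invr_expz -exprnP cmodV cmodX lnV ?posrE ?exprn_gt0// lnXn// mulrNz mulNr mulr_natl.
Qed.

Lemma ln_cmod_prod s (g : R[i] -> R[i]) : (forall a, a \in s -> g a != 0) ->
  ln (cmod (\prod_(a <- s) g a)) = \sum_(a <- s) ln (cmod (g a)).
Proof.
elim: s => [|a s IH] H; first by rewrite !big_nil cmod1 ln1.
have H' b : b \in s -> g b != 0 by move=> bs; apply: H; rewrite inE bs orbT.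
rewrite !big_cons cmodM lnM ?IH// posrE cmod_gt0; first by rewrite H// mem_head.
by rewrite prodf_seq_neq0; apply/allP => b /H' ->.
Qed.

Lemma cont_on_sum s (a b : R) (k : R[i] -> R) (u : R[i] -> R -> R) :
  (forall c, c \in s -> cont_on a b (u c)) ->
  cont_on a b (fun t => \sum_(c <- s) k c * u c t).
Proof.
elim: s => [|c s IH] H.
  have -> : (fun t => \sum_(c <- [::]) k c * u c t) = (fun=> 0).
    by apply/funext => t; rewrite big_nil.
  by move=> t _; exact: cvg_cst.
have -> : (fun t => \sum_(d <- c :: s) k d * u d t) =
    (fun t => k c * u c t + \sum_(d <- s) k d * u d t).
  by apply/funext => t; rewrite big_cons.
have Hs : cont_on a b (fun t => \sum_(d <- s) k d * u d t).
  by apply: IH => d ds; apply: H; rewrite inE ds orbT.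
have Hc := H c (mem_head c s).
by move=> t tab; apply: cvgD; [apply: cvgMr; exact: Hc|exact: Hs].
Qed.

Lemma cont_onD (a b : R) (u v : R -> R) : cont_on a b u -> cont_on a b v ->
  cont_on a b (fun t => u t + v t).
Proof. by move=> cu cv t tab; apply: cvgD; [exact: cu|exact: cv]. Qed.

Lemma cont_onZ (a b : R) (k : R) (u : R -> R) : cont_on a b u ->
  cont_on a b (fun t => k * u t).
Proof. by move=> cu t tab; apply: cvgMr; exact: cu. Qed.

Lemma cont_on_norm (a b : R) (u : R -> R) : cont_on a b u ->
  cont_on a b (fun t => `|u t|).
Proof. by move=> cu t tab; apply: cvg_norm; exact: cu. Qed.

Lemma rmean_sum s (k : R[i] -> R) (u : R[i] -> R -> R) :
  (forall c, c \in s -> cont_on 0 (2 * pi) (u c)) ->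
  rmean (fun t => \sum_(c <- s) k c * u c t) = \sum_(c <- s) k c * rmean (u c).
Proof.
elim: s => [|c s IH] H.
  by rewrite big_nil (@eq_rmean _ _ (fun=> 0)) ?rmean_cst// => t; rewrite big_nil.
have H' d : d \in s -> cont_on 0 (2 * pi) (u d).
  by move=> ds; apply: H; rewrite inE ds orbT.
have Hc := H c (mem_head c s).
rewrite big_cons -IH// -rmeanZ// -rmeanD; last 2 first.
- exact (cont_onZ Hc).
- exact (cont_on_sum H').
by apply: eq_rmean => t; rewrite big_cons.
Qed.

Lemma log_plusE x : log_plus x = (ln x + `|ln x|) / 2.
Proof. by rewrite /log_plus; case: (ltP (ln x) 0) => h; [rewrite ltr0_norm//|rewrite ger0_norm//]; lra. Qed.

Lemma log_plus_ge0 x : 0 <= log_plus x.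
Proof. by rewrite /log_plus le_max lexx. Qed.

Lemma ln_le_log_plus x : ln x <= log_plus x.
Proof. by rewrite /log_plus le_max lexx orbT. Qed.

Section WithDivisor.
Variables (w : R[i] -> R[i]) (rho : R) (s : seq R[i]) (F : R[i] -> R[i]).
Variable (M : R[i] -> int).
Hypothesis D : divisor w rho s F M.

Lemma cofactor_holo z : cmod z <= rho -> holo F z.
Proof. by move=> /(div_cofactor D)[d d0 H]; have [] := H z ltac:(by rewrite subrr cmod0). Qed.

Lemma cofactor_neq0 z : cmod z <= rho -> F z != 0.
Proof. by move=> /(div_cofactor D)[d d0 H]; have [] := H z ltac:(by rewrite subrr cmod0). Qed.

Lemma off_div_holo z : cmod z <= rho -> z \notin s -> holo w z /\ w z != 0.
Proof.
by move=> zr zs; have [d d0 H] := div_regular D zr zs; apply: H; rewrite subrr cmod0.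
Qed.

Lemma ln_factor z : cmod z <= rho -> z \notin s ->
  ln (cmod (w z)) = ln (cmod (F z)) + \sum_(a <- s) (M a)%:~R * ln (cmod (z - a)).
Proof.
move=> zr zs.
have za a : a \in s -> z - a != 0.
  by move=> as_; rewrite subr_eq0; apply: contraNneq zs => ->.
have zaM a : a \in s -> (z - a) ^ M a != 0 by move=> /za; exact: expfz_neq0.
rewrite (div_factor D zs) cmodM lnM ?posrE ?cmod_gt0 ?cofactor_neq0//; last first.
  by rewrite prodf_seq_neq0; apply/allP => b /zaM ->.
rewrite ln_cmod_prod//; congr (_ + _); apply: eq_big_seq => a /za.
exact: ln_cmod_expz.
Qed.

Definition div_good r := forall a, a \in s -> cmod a != r.

Lemma circ_notin r t : 0 < r -> div_good r -> circ r t \notin s.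
Proof.
by move=> r0 gr; apply/negP => /gr; rewrite cmod_circ gtr0_norm// eqxx.
Qed.

Lemma cont_ln_circ (a b : R) r : 0 < r -> r <= rho -> div_good r ->
  cont_on a b (fun t => ln (cmod (w (circ r t)))).
Proof.
move=> r0 rr gr.
have cr t : cmod (circ r t) <= rho by rewrite cmod_circ gtr0_norm.
have H t := off_div_holo (cr t) (circ_notin t r0 gr).
apply: cont_ln_cmod; last by move=> t _; have [] := H t.
apply: holo_ccont; first exact: circ_ccont.
by move=> t _; have [] := H t.
Qed.

Lemma cont_log_plus_circ (a b : R) r : 0 < r -> r <= rho -> div_good r ->
  cont_on a b (fun t => log_plus (cmod (w (circ r t)))).
Proof.
move=> r0 rr gr; have cl := @cont_ln_circ a b r r0 rr gr.
have -> : (fun t => log_plus (cmod (w (circ r t)))) =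
   (fun t => 2^-1 * (ln (cmod (w (circ r t))) + `|ln (cmod (w (circ r t)))|)).
  by apply/funext => t; rewrite log_plusE mulrC.
exact (cont_onZ (cont_onD cl (cont_on_norm cl))).
Qed.

Lemma cont_ln_circB (a b : R) r p : 0 < r -> cmod p != r ->
  cont_on a b (fun t => ln (cmod (circ r t - p))).
Proof.
move=> r0 pr; apply: cont_ln_cmod.
  exact (ccontB (@circ_ccont _ _ _ _) (@ccont_cst _ _ _ _)).
move=> t _; rewrite subr_eq0; apply: contraNneq pr => <-.
by rewrite cmod_circ gtr0_norm.
Qed.

Lemma poisson_div r z : 0 < r -> r < rho -> div_good r -> cmod z < r ->
  rmean (fun t => ln (cmod (w (circ r t))) * pker r z t) =
  ln (cmod (F z)) + \sum_(a <- s) (M a)%:~R * bln r a z.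
Proof.
move=> r0 rr gr zr.
have cr t : cmod (circ r t) <= rho by rewrite cmod_circ gtr0_norm// ltW.
have cp := @cont_pker _ _ _ r0 zr 0 (2 * pi).
have E t : ln (cmod (w (circ r t))) * pker r z t =
    ln (cmod (F (circ r t))) * pker r z t +
    \sum_(a <- s) (M a)%:~R * (ln (cmod (circ r t - a)) * pker r z t).
  rewrite (ln_factor (cr t) (circ_notin t r0 gr)).
  rewrite mulrDl big_distrl /=; congr (_ + _).
  by apply: eq_bigr => a _; rewrite -mulrA.
have ca a : a \in s ->
    cont_on 0 (2 * pi) (fun t => ln (cmod (circ r t - a)) * pker r z t).
  by move=> as_; exact (cont_onM (@cont_ln_circB _ _ _ _ r0 (gr _ as_)) cp).
rewrite (eq_rmean E) rmeanD; last 2 first.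
- apply: (cont_onM _ cp); apply: cont_ln_cmod.
    by apply: holo_ccont; [exact: circ_ccont|move=> t _; exact: cofactor_holo].
  by move=> t _; exact: cofactor_neq0.
- exact (cont_on_sum ca).
rewrite rmean_sum//; congr (_ + _).
  by apply: (poisson_ln r0 rr zr) => y yr; [exact/cofactor_holo/ltW|exact/cofactor_neq0/ltW].
apply: eq_big_seq => a as_; congr (_ * _); apply: poisson_ln_sub => //.
exact: gr.
Qed.

(* Green function of the disc of radius r with pole a; it is 0 when r <= |a|. *)
Definition green r a z := bln r a z - ln (cmod (z - a)).

Lemma poisson_jensen r z : 0 < r -> r < rho -> div_good r -> cmod z < r -> z \notin s ->
  ln (cmod (w z)) = rmean (fun t => ln (cmod (w (circ r t))) * pker r z t)
    - \sum_(a <- s) (M a)%:~R * green r a z.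
Proof.
move=> r0 rr gr zr zs; rewrite poisson_div// ln_factor//; last exact: ltW (lt_trans zr rr).
rewrite /green -addrA; congr (_ + _); rewrite -sumrB.
by apply: eq_bigr => a _; ring.
Qed.

Lemma jensen r : 0 < r -> r < rho -> div_good r ->
  rmean (fun t => ln (cmod (w (circ r t)))) =
  ln (cmod (F 0)) + \sum_(a <- s) (M a)%:~R * ln (Num.max r (cmod a)).
Proof.
move=> r0 rr gr; have c0 : cmod (0 : R[i]) < r by rewrite cmod0.
rewrite (_ : rmean _ = rmean (fun t => ln (cmod (w (circ r t))) * pker r 0 t)).
  by rewrite poisson_div//; congr (_ + _); apply: eq_bigr => a _; rewrite bln0.
by apply: eq_rmean => t; rewrite pker0// mulr1.
Qed.

(* Agrees with the characteristic only on circles that avoid s. *)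
Definition rchar r : R := rmean (fun t => log_plus (cmod (w (circ r t)))) +
  \sum_(a <- s) multneg M a * radial r a.

Lemma characteristicE r : 0 < r -> r <= rho -> div_good r ->
  characteristic r w = (rchar r)%:E.
Proof.
move=> r0 rr gr; rewrite /characteristic (int_pole_countE D)// EFinD; congr (_ + _)%E.
rewrite /proximity /rmean EFinM -integral_rint; last exact: cont_log_plus_circ.
congr (_ * _)%E; apply: eq_integral => t _; by rewrite circ.unlock.
Qed.

(* For r0 <= r, the part of the integrated counting weight of a that comes from the
   radii between r0 and r. *)
Definition annular r0 r a : R := ln (Num.max r (cmod a)) - ln (Num.max r0 (cmod a)).

Lemma annular_ge0 r0 r a : 0 < r0 -> r0 <= r -> 0 <= annular r0 r a.
Proof.
move=> r00 rr; rewrite subr_ge0 ler_ln ?posrE ?lt_max ?r00//.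
  by rewrite ge_max !le_max rr lexx orbT.
by rewrite (lt_le_trans r00).
Qed.

Lemma radial_ge0 r a : 1 <= r -> 0 <= radial r a.
Proof.
move=> r1; rewrite /radial; case: (leP (cmod a) r) => // ar; case: ifPn => [_|a0]; apply: ln_ge0 => //.
by rewrite ler_pdivlMr ?cmod_gt0// mul1r.
Qed.

Lemma annular_le_radial r0 r a : 1 <= r0 -> r0 <= r -> annular r0 r a <= radial r a.
Proof.
move=> r01 rr; have r00 : 0 < r0 by exact: lt_le_trans r01.
have rp : 0 < r by exact: lt_le_trans rr.
rewrite /annular /radial; case: (leP (cmod a) r) => ar; last first.
  by rewrite (max_r (ltW (le_lt_trans rr ar))) subrr.
case: ifPn => [/eqP ->|a0].
  by rewrite cmod0 max_l ?(ltW r00)// lerBlDr lerDl ln_ge0.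
have ca : 0 < cmod a by rewrite cmod_gt0.
rewrite ln_div ?posrE// lerD2l lerN2 ler_ln ?posrE ?lt_max ?r00//.
by rewrite le_max lexx orbT.
Qed.

(** Jensen's formula is subtracted at [r0] and [r]: [F 0] disappears, a zero or pole at the origin
    needs no special case, and only the constant [J] remains. The identity
    [|ln x| = 2 * log_plus x - ln x] controls the mean of [|ln |w||]; the zeros are controlled
    through their difference with the poles. *)
Lemma jensen_bounds r0 r : 1 <= r0 -> r0 < r -> r < rho -> div_good r0 -> div_good r ->
  let J := rmean (fun t => ln (cmod (w (circ r0 t)))) in
  rmean (fun t => `|ln (cmod (w (circ r t)))|) <= 2 * rchar r + `|J| /\
  \sum_(a <- s) `|(M a)%:~R| * annular r0 r a <= 2 * rchar r + `|J|.
Proof.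
move=> r01 r0r rr g0 gr J.
have r00 : 0 < r0 by exact: lt_le_trans r01.
have rp : 0 < r by exact: lt_trans r0r.
have cl := @cont_ln_circ 0 (2 * pi) r rp (ltW rr) gr.
have cp := @cont_log_plus_circ 0 (2 * pi) r rp (ltW rr) gr.
set mp := rmean (fun t => log_plus (cmod (w (circ r t)))).
have E1 : rmean (fun t => `|ln (cmod (w (circ r t)))|) =
    2 * mp - rmean (fun t => ln (cmod (w (circ r t)))).
  rewrite -rmeanZ// -rmeanB//; last exact (cont_onZ cp).
  by apply: eq_rmean => t; rewrite log_plusE; lra.
have E2 : rmean (fun t => ln (cmod (w (circ r t)))) =
    J + \sum_(a <- s) (M a)%:~R * annular r0 r a.
  rewrite /J !jensen ?(lt_trans r0r)// -addrA -big_split /=; congr (_ + _).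
  by apply: eq_bigr => a _; rewrite -mulrDr /annular addrC subrK.
set Sp := \sum_(a <- s) multpos M a * annular r0 r a.
set Sn := \sum_(a <- s) multneg M a * annular r0 r a.
have E3 : \sum_(a <- s) (M a)%:~R * annular r0 r a = Sp - Sn.
  by rewrite /Sp /Sn -sumrB; apply: eq_bigr => a _; rewrite mult_split mulrBl.
have E4 : \sum_(a <- s) `|(M a)%:~R| * annular r0 r a = Sp + Sn.
  rewrite /Sp /Sn -big_split /=; apply: eq_bigr => a _; rewrite -mulrDl; congr (_ * _).
  rewrite mult_split /multpos /multneg; case: ltgtP => _; rewrite ?subr0 ?sub0r ?addr0 ?add0r ?normrN ?normr0//.
    by rewrite ger0_norm.
  by rewrite ger0_norm.
have Sp0 : 0 <= Sp.
  by apply: sumr_ge0 => a _; rewrite mulr_ge0 ?multpos_ge0// annular_ge0// ltW.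
have Sn0 : 0 <= Sn.
  by apply: sumr_ge0 => a _; rewrite mulr_ge0 ?multneg_ge0// annular_ge0// ltW.
have Sr : Sn <= \sum_(a <- s) multneg M a * radial r a.
  by apply: ler_sum => a _; rewrite ler_wpM2l ?multneg_ge0// annular_le_radial// ltW.
have mp0 : 0 <= mp by apply: rmean_ge0 => t _; exact: log_plus_ge0.
have TE : rchar r = mp + \sum_(a <- s) multneg M a * radial r a by [].
have abs0 : 0 <= rmean (fun t => `|ln (cmod (w (circ r t)))|).
  by apply: rmean_ge0 => t _.
have lpos : rmean (fun t => ln (cmod (w (circ r t)))) <= mp.
  by apply: le_rmean => // t _; exact: ln_le_log_plus.
have J1 := ler_norm J; have J2 := ler_norm (- J); rewrite normrN in J2.
rewrite E4; rewrite E3 in E2.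
by split; lra.
Qed.

End WithDivisor.
End Jensen.

(** * Circle means of extended real functions *)

Section CircleMean.
Variable R : realType.
Implicit Types (z a b : R[i]) (r rho x : R) (u v : R -> R) (U V : R -> \bar R).

Definition emean U : \bar R :=
  (((2 * pi)^-1)%:E * \int[lebesgue_measure]_(t in `[0%R, (2 * pi)%R]) U t)%E.

Let I2pi : set R := `[0, 2 * pi]%classic.

Let mI : measurable I2pi.
Proof. exact: measurable_itv. Qed.

Let i0 : (0 <= ((2 * pi)^-1)%:E :> \bar R)%E.
Proof. by rewrite lee_fin invr_ge0 ltW// pi2_gt0. Qed.

(** The integral of a nonnegative function is a supremum over simple functions below it, so no
    measurability enters. The lemma is applied to the shifted quotient, whose measurability is never
    established. *)
Lemma le_emean U V : (forall t, 0 <= t <= 2 * pi -> (0 <= U t)%E) ->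
  (forall t, 0 <= t <= 2 * pi -> (U t <= V t)%E) -> (emean U <= emean V)%E.
Proof.
move=> U0 UV; rewrite /emean lee_pmul2l//; last by rewrite lte_fin invr_gt0 pi2_gt0.
rewrite ge0_integralE; last by move=> t /=; rewrite in_itv/= => /U0.
rewrite ge0_integralE; last first.
  by move=> t /=; rewrite in_itv/= => /[dup] /U0 + /UV; exact: le_trans.
apply: le_ereal_sup => _ /= [h Hh <-]; exists h => //= t.
apply: le_trans (Hh t) _; rewrite !patchE; case: ifPn => // /set_mem /=.
by rewrite in_itv/=; exact: UV.
Qed.

Lemma emeanD U V : (forall t, 0 <= t <= 2 * pi -> (0 <= U t)%E) ->
  (forall t, 0 <= t <= 2 * pi -> (0 <= V t)%E) ->
  measurable_fun I2pi U -> measurable_fun I2pi V ->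
  emean (fun t => U t + V t)%E = (emean U + emean V)%E.
Proof.
move=> U0 V0 mU mV; rewrite /emean ge0_integralD//.
  rewrite ge0_muleDr//; apply: integral_ge0 => t /=; rewrite in_itv/=; first [exact: U0|exact: V0].
Qed.

Lemma emeanZ (k : R) U : 0 <= k -> (forall t, 0 <= t <= 2 * pi -> (0 <= U t)%E) ->
  measurable_fun I2pi U -> emean (fun t => k%:E * U t)%E = (k%:E * emean U)%E.
Proof.
by move=> k0 U0 mU; rewrite /emean ge0_integralZl// muleCA.
Qed.

Lemma emean_EFin u : cont_on 0 (2 * pi) u -> emean (fun t => (u t)%:E) = (rmean u)%:E.
Proof. by move=> cu; rewrite /emean integral_rint. Qed.

Lemma emean_sum (s : seq R[i]) (k : R[i] -> R) (U : R[i] -> R -> \bar R) :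
  (forall a, 0 <= k a) ->
  (forall a t, 0 <= t <= 2 * pi -> (0 <= U a t)%E) ->
  (forall a, measurable_fun I2pi (U a)) ->
  emean (fun t => \sum_(a <- s) (k a)%:E * U a t)%E = (\sum_(a <- s) (k a)%:E * emean (U a))%E
  /\ measurable_fun I2pi (fun t => \sum_(a <- s) (k a)%:E * U a t)%E.
Proof.
move=> k0 U0 mU; have mk a : measurable_fun I2pi (fun t => (k a)%:E * U a t)%E.
  exact: measurable_funeM.
elim: s => [|a s [IH mIH]].
  rewrite big_nil; split; last by under eq_fun do rewrite big_nil; exact: measurable_cst.
  rewrite /emean; under eq_integral do rewrite big_nil.
  by rewrite integral0 mule0.
have E : (fun t => \sum_(b <- a :: s) (k b)%:E * U b t)%E =
    (fun t => (k a)%:E * U a t + \sum_(b <- s) (k b)%:E * U b t)%E.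
  by apply/funext => t; rewrite big_cons.
rewrite E big_cons; split; last exact: emeasurable_funD.
rewrite emeanD//.
- by rewrite IH emeanZ// => t; exact: U0.
- by move=> t tI; rewrite mule_ge0 ?lee_fin ?U0.
- by move=> t tI; apply: sume_ge0 => b _; rewrite mule_ge0 ?lee_fin ?U0.
Qed.

Lemma cmod_sqr_circB r z t :
  cmod (circ r t - z) ^+ 2 = r ^+ 2 + cmod z ^+ 2 - 2 * r * (cos t * Re z + sin t * Im z).
Proof.
rewrite !cmod_sqr cReD cImD cReN cImN ReC_circ ImC_circ.
transitivity (r ^+ 2 * (cos t ^+ 2 + sin t ^+ 2) + (Re z ^+ 2 + Im z ^+ 2) -
  2 * r * (cos t * Re z + sin t * Im z)); first by ring.
by rewrite cos2Dsin2 mulr1.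
Qed.

Lemma circ_chord rho r s t :
  cmod (circ rho t - circ r s) ^+ 2 = rho ^+ 2 + r ^+ 2 - 2 * rho * r * cos (t - s).
Proof.
rewrite cmod_sqr_circB cmod_circ real_normK ?num_real// ReC_circ ImC_circ cosB.
by ring.
Qed.

(** Only the cosine of the difference of the angles matters; hence the Poisson kernel is symmetric
    in the angles on the two circles. *)
Lemma chord_sym rho r s t :
  cmod (circ rho t - circ r s) = cmod (circ rho s - circ r t).
Proof.
apply/eqP; rewrite -(@eqrXn2 _ 2) ?cmod_ge0// !circ_chord.
by rewrite -cosN opprB.
Qed.

(** * Circle means of Poisson integrals *)

Section PoissonMean.
Variables (r rho : R) (u : R -> R).
Hypotheses (r0 : 0 < r) (rrho : r < rho) (cu : cont_on 0 (2 * pi) u).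
Hypothesis u0 : forall t, 0 <= t <= 2 * pi -> 0 <= u t.

Let rho0 : 0 < rho := lt_trans r0 rrho.

Let cr s : cmod (circ r s) < rho.
Proof. by rewrite cmod_circ gtr0_norm. Qed.

Definition poisson_avg (s : R) := rmean (fun t => u t * pker rho (circ r s) t).

(** The integrand for Tonelli's theorem: [u] is cut off outside the interval and the chord is
    expanded by the cosine, which shows joint measurability; the power [-1] is the inverse. *)
Let K (st : R * R) : \bar R :=
  (((u \_ I2pi) st.2 * (rho ^+ 2 - r ^+ 2)) *
   (rho ^+ 2 + r ^+ 2 - 2 * rho * r * cos (st.2 - st.1)) `^ (-1))%:E.

Let KE s t : K (s, t) = (((u \_ I2pi) t) * pker rho (circ r s) t)%:E.
Proof.
rewrite /K /= -circ_chord powR_inv1 ?exprn_ge0 ?cmod_ge0// /pker.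
by rewrite cmod_circ real_normK ?num_real// mulrA.
Qed.

Let patch_ge0 t : 0 <= (u \_ I2pi) t.
Proof. by rewrite patchE; case: ifPn => // /set_mem; rewrite /I2pi/= in_itv/=; exact: u0. Qed.

Let K0 st : (0 <= K st)%E.
Proof.
by case: st => s t; rewrite KE lee_fin mulr_ge0// pker_ge0.
Qed.

Let mpatch : measurable_fun setT (u \_ I2pi).
Proof.
have mu : measurable_fun I2pi u.
  by apply: (cont_measurable mI) => t; rewrite /I2pi /= in_itv/=; exact: cu.
exact ((measurable_restrictT u mI).1 mu).
Qed.

Let mK : measurable_fun setT K.
Proof.
apply/measurable_EFinP; apply: measurable_funM.
  apply: measurable_funM => //.
  exact: measurableT_comp.
pose c (st : R * R) : R := st.2 - st.1.
have mc : measurable_fun setT c by exact: measurable_funB.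
have mcos := measurableT_comp (continuous_measurable_fun (@continuous_cos R)) mc.
pose g (st : R * R) : R := rho ^+ 2 + r ^+ 2 - 2 * rho * r * (cos \o c) st.
have mg : measurable_fun setT g.
  by apply: measurable_funB => //; exact: measurable_funM.
exact (measurableT_comp (@measurable_powR R (-1)) mg).
Qed.

Let inner s : (\int[lebesgue_measure]_t K (s, t) = (2 * pi * poisson_avg s)%:E)%E.
Proof.
rewrite /poisson_avg /rmean mulrA divff ?gt_eqF ?pi2_gt0// mul1r.
rewrite -integral_rint; last exact (cont_onM cu (@cont_pker _ _ _ rho0 (cr s) _ _)).
rewrite [RHS]integral_mkcond; apply: eq_integral => t _; rewrite KE !patchE /I2pi.
by case: ifP => //; rewrite mul0r.
Qed.

Let outer t : (\int[lebesgue_measure]_(s in I2pi) K (s, t) =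
  (2 * pi)%:E * ((u \_ I2pi) t)%:E)%E.
Proof.
under eq_integral => s _.
  rewrite KE (_ : pker rho (circ r s) t = pker rho (circ r t) s); last first.
    by rewrite /pker !cmod_circ chord_sym.
over.
have cp := @cont_pker _ _ _ rho0 (cr t) 0 (2 * pi).
rewrite (@integral_rint R 0 (2 * pi) (fun s => (u \_ I2pi) t * pker rho (circ r t) s)).
  rewrite RintZ// -EFinM; congr (_%:E).
  have := pker_mean rho0 (cr t); rewrite /rmean.
  move=> /(congr1 (fun x => 2 * pi * x)).
  by rewrite mulrA divff ?gt_eqF ?pi2_gt0// mul1r mulr1 => ->; rewrite mulrC.
exact (cont_onZ cp).
Qed.

Lemma poisson_avg_ge0 s : 0 <= poisson_avg s.
Proof.
by apply: rmean_ge0 => t t2; rewrite mulr_ge0 ?u0// pker_ge0.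
Qed.

Lemma measurable_poisson_avg : measurable_fun I2pi (fun s => (poisson_avg s)%:E).
Proof.
apply: measurable_funTS.
have -> : (fun s => (poisson_avg s)%:E) =
    (fun s => ((2 * pi)^-1)%:E * \int[lebesgue_measure]_t K (s, t))%E.
  apply/funext => s; rewrite inner -EFinM mulrA mulVf ?mul1r//.
  by rewrite gt_eqF// pi2_gt0.
apply: measurable_funeM.
exact: (@measurable_fun_fubini_tonelli_F _ _ _ _ _ lebesgue_measure K mK K0).
Qed.

(** By Tonelli's theorem the mean over the inner circle may be taken first; by symmetry of the
    kernel it is the mean of a Poisson kernel, which is 1. *)
Lemma emean_poisson_avg : emean (fun s => (poisson_avg s)%:E) = (rmean u)%:E.
Proof.
pose K' (st : R * R) : \bar R := (((\1_I2pi st.1 : R))%:E * K st)%E.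
have mK' : measurable_fun setT K'.
  apply: emeasurable_funM => //; apply/measurable_EFinP.
  have m1 : measurable_fun setT (\1_I2pi : R -> R) by exact: measurable_indic.
  have m2 : measurable_fun setT (fun st : R * R => st.1) by exact: measurable_fst.
  exact (measurableT_comp m1 m2).
have K'0 st : (0 <= K' st)%E by rewrite mule_ge0.
have p0 : (0 <= (2 * pi)%:E :> \bar R)%E by rewrite lee_fin ltW// pi2_gt0.
have E1 : (\int[lebesgue_measure]_x \int[lebesgue_measure]_y K' (x, y) =
   (2 * pi)%:E * \int[lebesgue_measure]_(s in I2pi) ((poisson_avg s)%:E))%E.
  rewrite -ge0_integralZl//; last 2 first.
  - exact: measurable_poisson_avg.
  - by move=> s _; rewrite lee_fin poisson_avg_ge0.
  rewrite [RHS]integral_mkcond; apply: eq_integral => s _.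
  rewrite patchE /K' /= indicE; case: ifP => sI /=.
    by under eq_integral do rewrite mul1e; rewrite inner EFinM.
  by under eq_integral do rewrite mul0e; rewrite integral0.
have E2 : (\int[lebesgue_measure]_y \int[lebesgue_measure]_x K' (x, y) =
   (2 * pi)%:E * \int[lebesgue_measure]_(t in I2pi) ((u t)%:E))%E.
  have mu : measurable_fun I2pi (fun t => (u t)%:E).
    apply/measurable_EFinP; apply: (cont_measurable mI) => t.
    by rewrite /I2pi /= in_itv/=; exact: cu.
  have ue0 t : I2pi t -> (0 <= (u t)%:E)%E.
    by rewrite /I2pi /= in_itv/= => /u0; rewrite lee_fin.
  rewrite -ge0_integralZl//.
  rewrite [RHS]integral_mkcond; apply: eq_integral => t _.
  transitivity (\int[lebesgue_measure]_(s in I2pi) K (s, t))%E.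
    rewrite [RHS]integral_mkcond; apply: eq_integral => s _.
    by rewrite patchE /K' /= indicE; case: ifP => sI; rewrite ?mul1e ?mul0e.
  by rewrite outer !patchE; case: ifP => // _; rewrite mule0.
have := etrans (esym E1) (etrans
  (@fubini_tonelli _ _ _ _ _ lebesgue_measure lebesgue_measure K' mK' K'0) E2).
clear E1 E2; move=> /(congr1 (fun y : \bar R => ((2 * pi)^-1 * (2 * pi)^-1)%:E * y)%E).
rewrite !muleA -!EFinM -!mulrA mulVf ?mulr1; last by rewrite gt_eqF// pi2_gt0.
by move=> H; rewrite -emean_EFin// /emean -/I2pi H.
Qed.

End PoissonMean.

End CircleMean.

(** * Circle means of the logarithmic kernel *)

Section LogMean.
Variable R : realType.
Implicit Types (z a b : R[i]) (r rho x A : R).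

Lemma cmodZ (k : R) z : 0 <= k -> cmod (k%:C * z) = k * cmod z.
Proof. by move=> k0; rewrite cmodM cmod_real ger0_norm. Qed.

Lemma cont_log_kernel (lo hi : R) r A b : 0 < r -> cmod b != r ->
  cont_on lo hi (fun t => ln (1 + A ^+ 2 / cmod (circ r t - b) ^+ 2)).
Proof.
move=> r0 br.
have cB : ccont_on lo hi (fun t => circ r t - b).
  exact (ccontB (@circ_ccont _ _ _ _) (@ccont_cst _ _ _ _)).
have c0 t : 0 < cmod (circ r t - b).
  rewrite cmod_gt0 subr_eq0; apply: contraNneq br => <-.
  by rewrite cmod_circ gtr0_norm.
have cc t : lo <= t <= hi -> {for t, continuous (fun t => cmod (circ r t - b))}.
  move=> tab.
  exact: (@continuous_comp _ _ _ ((fun t => circ r t - b) : R -> R[i]^o) (fun z : R[i]^o => cmod z) t (cB _ tab) (@continuous_cmod _ _)).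
move=> t tab.
have cq : {for t, continuous (fun t => 1 + A ^+ 2 / cmod (circ r t - b) ^+ 2)}.
  apply: cvgD; first exact: cvg_cst.
  apply: cvgMr; apply: cvgV; first by rewrite expf_neq0// gt_eqF.
  under eq_fun do rewrite expr2; rewrite expr2; apply: cvgM; exact: cc.
apply: (@continuous_comp _ _ _ (fun t => 1 + A ^+ 2 / cmod (circ r t - b) ^+ 2) (@ln R) t cq).
by apply: continuous_ln; rewrite ltr_wpDr// divr_ge0// ?sqr_ge0.
Qed.

(* Comparing |zeta - b|^2 + A^2 with |u zeta - v b|^2 reduces the mean to two
   means of log |zeta - b|. *)
Lemma log_kernel_mean_scaled r A b (u v : R) : 0 < r -> 0 < u -> 0 < v -> u * v = 1 ->
  cmod b != r -> v * cmod b != u * r ->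
  A ^+ 2 <= (u ^+ 2 - 1) * r ^+ 2 + (v ^+ 2 - 1) * cmod b ^+ 2 ->
  rmean (fun t => ln (1 + A ^+ 2 / cmod (circ r t - b) ^+ 2)) <=
  2 * (ln (Num.max (u * r) (v * cmod b)) - ln (Num.max r (cmod b))).
Proof.
move=> r0 u0 v0 uv br vub HA.
have ur0 : 0 < u * r by rewrite mulr_gt0.
have vb : cmod (v%:C * b) = v * cmod b by rewrite cmodZ// ltW.
have vbn : cmod (v%:C * b) != u * r by rewrite vb.
have c1 := @cont_ln_circB R 0 (2 * pi) (u * r) (v%:C * b) ur0 vbn.
have c2 := @cont_ln_circB R 0 (2 * pi) r b r0 br.
rewrite -vb -(mean_ln_sub ur0 vbn) -(mean_ln_sub r0 br) -rmeanB// -rmeanZ; last first.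
  by move=> t tab; apply: cvgB; [exact: c1|exact: c2].
apply: le_rmean; first exact: cont_log_kernel.
  by apply: cont_onZ => t tab; apply: cvgB; [exact: c1|exact: c2].
move=> t _.
have D0 : 0 < cmod (circ r t - b).
  rewrite cmod_gt0 subr_eq0; apply: contraNneq br => <-.
  by rewrite cmod_circ gtr0_norm.
have E0 : 0 < cmod (circ (u * r) t - v%:C * b).
  rewrite cmod_gt0 subr_eq0; apply: contraNneq vbn => <-.
  by rewrite cmod_circ gtr0_norm.
have DE : cmod (circ r t - b) ^+ 2 + A ^+ 2 <= cmod (circ (u * r) t - v%:C * b) ^+ 2.
  have -> : cmod (circ (u * r) t - v%:C * b) ^+ 2 = cmod (circ r t - b) ^+ 2 +
      ((u ^+ 2 - 1) * r ^+ 2 + (v ^+ 2 - 1) * cmod b ^+ 2).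
    rewrite !cmod_sqr_circB vb !cReM !cImM /= !mul0r subr0 addr0.
    transitivity (u ^+ 2 * r ^+ 2 + v ^+ 2 * cmod b ^+ 2 -
      2 * r * (u * v) * (cos t * Re b + sin t * Im b)); first by ring.
    by rewrite uv; ring.
  by rewrite lerD2l.
have -> : 2 * (ln (cmod (circ (u * r) t - v%:C * b)) - ln (cmod (circ r t - b))) =
    ln (cmod (circ (u * r) t - v%:C * b) ^+ 2 / cmod (circ r t - b) ^+ 2).
  by rewrite ln_div ?posrE ?exprn_gt0// !lnXn// mulrBr !mulr_natl.
rewrite ler_ln ?posrE ?divr_gt0 ?exprn_gt0//; last first.
  by rewrite ltr_wpDr// divr_ge0// ?sqr_ge0.
rewrite ler_pdivlMr ?exprn_gt0// mulrDl mul1r divfK//.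
by rewrite expf_neq0// gt_eqF.
Qed.

Lemma log_kernel_mean r A b : 0 < r -> 0 < A -> cmod b != r ->
  rmean (fun t => ln (1 + A ^+ 2 / cmod (circ r t - b) ^+ 2)) <=
  A / r + (A / r) ^+ 2.
Proof.
move=> r0 A0 br; set x := A / r; have x0 : 0 < x by rewrite divr_gt0.
have AE : A = x * r by rewrite /x divfK// gt_eqF.
(* With factors [al] and [al^-1], the larger one on the larger of [r] and [|b|], the scaling lemma
   asks for [x^2 <= T^2 / (1 + T)]. This [T] satisfies it, and the resulting bound
   [2 * ln al = ln (1 + T)] is at most [T]. *)
pose T := x + x ^+ 2; have T0 : 0 < T by rewrite addr_gt0// exprn_gt0.
pose al := Num.sqrt (1 + T).
have al2 : al ^+ 2 = 1 + T by rewrite sqr_sqrtr// addr_ge0// ltW.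
have al0 : 0 < al by rewrite sqrtr_gt0 addr_gt0.
have al1 : 1 < al.
  have T1 : 0 < 1 + T by rewrite addr_gt0.
  by rewrite /al -[ltLHS]sqrtr1 (ltr_sqrt _ T1) ltrDl.
have ai0 : 0 < al^-1 by rewrite invr_gt0.
have ai1 : al^-1 < 1 by rewrite invf_lt1.
have lnal : 2 * ln al <= T.
  have -> : 2 * ln al = ln (1 + T) by rewrite -al2 lnXn// mulr_natl.
  by apply: le_ln1Dx; rewrite (lt_trans _ T0)// ltrN10.
have xT : x ^+ 2 <= T * (1 - (1 + T)^-1).
  have -> : T * (1 - (1 + T)^-1) = T ^+ 2 / (1 + T).
    by field; rewrite gt_eqF// addr_gt0.
  rewrite ler_pdivlMr; last by rewrite addr_gt0.
  rewrite /T.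
  have -> : (x + x ^+ 2) ^+ 2 = x ^+ 2 * (1 + (x + x ^+ 2) + x) by ring.
  by rewrite ler_wpM2l ?sqr_ge0// lerDl ltW.
have ai2 : al^-1 ^+ 2 = (1 + T)^-1 by rewrite exprVn al2.
have TT0 : 0 <= T / (1 + T).
  by apply: divr_ge0; [exact: ltW|rewrite addr_ge0// ltW].
have b0 := cmod_ge0 b.
have [brlt|rb] := ltP (cmod b) r.
  have bb : al^-1 * cmod b < al * r.
    apply: le_lt_trans (_ : cmod b < _); first by rewrite ler_piMl// ltW.
    by apply: lt_trans brlt _; rewrite ltr_pMl.
  have uv : al * al^-1 = 1 by rewrite divff// gt_eqF.
  have ne : al^-1 * cmod b != al * r by rewrite lt_eqF.
  have HA : A ^+ 2 <= (al ^+ 2 - 1) * r ^+ 2 + (al^-1 ^+ 2 - 1) * cmod b ^+ 2.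
    rewrite al2 ai2 AE exprMn.
    have -> : 1 + T - 1 = T by ring.
    apply: (le_trans (ler_wpM2r (sqr_ge0 r) xT)).
    have -> : T * (1 - (1 + T)^-1) = T - T / (1 + T) by ring.
    have -> : (1 + T)^-1 - 1 = - (T / (1 + T)) by field; rewrite gt_eqF// addr_gt0.
    have rb2 : cmod b ^+ 2 <= r ^+ 2 by rewrite ler_pXn2r ?nnegrE// ltW.
    by rewrite mulrBl mulNr lerD2l lerN2; exact: (ler_wpM2l TT0 rb2).
  apply: le_trans (log_kernel_mean_scaled r0 al0 ai0 uv br ne HA) _.
  rewrite (max_l (ltW bb)) (max_l (ltW brlt)) lnM ?posrE//.
  by rewrite -addrA subrr addr0.
have {}rb : r < cmod b by rewrite lt_neqAle eq_sym br.
have bp : 0 < cmod b by exact: lt_trans rb.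
have bb : al^-1 * r < al * cmod b.
  apply: le_lt_trans (_ : r < _); first by rewrite ler_piMl// ltW.
  by apply: lt_trans rb _; rewrite ltr_pMl.
have uv : al^-1 * al = 1 by rewrite mulVf// gt_eqF.
have ne : al * cmod b != al^-1 * r by rewrite gt_eqF.
have HA : A ^+ 2 <= (al^-1 ^+ 2 - 1) * r ^+ 2 + (al ^+ 2 - 1) * cmod b ^+ 2.
  rewrite al2 ai2 AE exprMn.
  have -> : 1 + T - 1 = T by ring.
  have -> : (1 + T)^-1 - 1 = - (T / (1 + T)) by field; rewrite gt_eqF// addr_gt0.
  have rb2 : r ^+ 2 <= cmod b ^+ 2 by rewrite ler_pXn2r ?nnegrE// ltW.
  apply: (le_trans (ler_pM (sqr_ge0 x) (sqr_ge0 r) xT rb2)).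
  have -> : T * (1 - (1 + T)^-1) = T - T / (1 + T) by ring.
  by rewrite mulrBl mulNr addrC lerD2r lerN2; exact: (ler_wpM2l TT0 rb2).
apply: le_trans (log_kernel_mean_scaled r0 ai0 al0 uv br ne HA) _.
rewrite (max_r (ltW bb)) (max_r (ltW rb)) lnM ?posrE//.
by rewrite -addrA subrr addr0.
Qed.

(* The value +oo at the point b absorbs the shifted points z + c that are zeros or
   poles of w, where w (z + c) is a junk value. *)
Definition log_kernel r A b (t : R) : \bar R :=
  if circ r t == b then +oo%E else (ln (1 + A ^+ 2 / cmod (circ r t - b) ^+ 2))%:E.

Lemma log_kernel_ge0 r A b t : (0 <= log_kernel r A b t)%E.
Proof.
rewrite /log_kernel; case: ifP => // _; rewrite lee_fin ln_ge0// lerDl.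
by rewrite divr_ge0 ?sqr_ge0.
Qed.

(** A centre on the circle is approached radially from outside. The kernels converge at every angle,
    with limit [+oo] where the circle passes through [b]. *)
Lemma log_kernel_approx r A b : 0 < r -> 0 < A -> exists bn : nat -> R[i],
  (forall n, cmod (bn n) != r) /\
  (forall t, (ln (1 + A ^+ 2 / cmod (circ r t - bn n) ^+ 2))%:E @[n --> \oo]
     --> log_kernel r A b t).
Proof.
move=> r0 A0; have [br|br] := eqVneq (cmod b) r; last first.
  exists (fun=> b); split => // t; rewrite /log_kernel ifF; first exact: cvg_cst.
  by apply: contraNF br => /eqP <-; rewrite cmod_circ gtr0_norm.
pose bn n : R[i] := (1 + n.+1%:R^-1)%:C * b.
have bnB n : cmod (b - bn n) = r * n.+1%:R^-1.
  have -> : b - bn n = - (n.+1%:R^-1)%:C * b.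
    by rewrite /bn rmorphD /= mulrDl mul1r opprD addrA subrr add0r mulNr.
  by rewrite mulNr cmodN cmodZ// br mulrC.
exists bn; split => [n|t].
  rewrite /bn cmodZ ?addr_ge0// br gt_eqF// ltr_pMl//.
  by rewrite ltrDl invr_gt0.
rewrite /log_kernel; case: eqVneq => [->|tb].
  apply/cvgeryP/cvgryPgt => K.
  near=> n.
  rewrite bnB exprMn exprVn invfM invrK mulrA.
  have nK : expR K * r ^+ 2 / A ^+ 2 <= n.+1%:R.
    near: n; exists (Num.bound (expR K * r ^+ 2 / A ^+ 2)) => // n /= hn.
    have p0 : 0 <= expR K * r ^+ 2 / A ^+ 2.
      by rewrite divr_ge0 ?sqr_ge0// mulr_ge0 ?expR_ge0 ?sqr_ge0.
    apply: le_trans (ltW (archi_boundP p0)) _.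
    by rewrite ler_nat leqW.
  rewrite -[ltLHS]expRK ltr_ln ?posrE ?expR_gt0//; last first.
    by rewrite ltr_wpDr// mulr_ge0 ?exprn_ge0// mulr_ge0 ?invr_ge0 ?sqr_ge0.
  apply: le_lt_trans (_ : _ <= A ^+ 2 / r ^+ 2 * n.+1%:R ^+ 2) _; last by rewrite ltrDr.
  have n1 : n.+1%:R <= n.+1%:R ^+ 2 :> R by rewrite expr2 ler_peMl// ler1n.
  apply: le_trans (_ : _ <= A ^+ 2 / r ^+ 2 * n.+1%:R) _; last first.
    by rewrite ler_wpM2l// divr_ge0 ?sqr_ge0.
  rewrite mulrC -ler_pdivrMr ?divr_gt0 ?exprn_gt0// invf_div mulrA.
  exact: nK.
have d0 : 0 < cmod (circ r t - b) by rewrite cmod_gt0 subr_eq0.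
apply: cvg_EFin; first exact: nearW.
have cD : cmod (circ r t - bn n) @[n --> \oo] --> cmod (circ r t - b).
  apply/cvgrPdist_le => e e0.
  near=> n.
  have K : `|cmod (circ r t - b) - cmod (circ r t - bn n)| <= cmod (b - bn n).
    have -> : b - bn n = (circ r t - bn n) - (circ r t - b) by ring.
    have h1 := lerB_cmod (circ r t - bn n) (circ r t - b).
    have h2 := lerB_cmod (circ r t - b) (circ r t - bn n).
    rewrite [cmod (circ r t - b - _)]cmodB_sym in h2.
    by rewrite ler_norml h2 andbT lerNl opprB.
  apply: le_trans K _; rewrite bnB -ler_pdivlMl//.
  near: n; exists (Num.bound (r / e)) => // n /= hn.
  have p0 : 0 <= r / e by rewrite divr_ge0// ltW.
  rewrite -[leRHS]invrK lef_pV2 ?posrE ?invr_gt0 ?mulr_gt0 ?invr_gt0//.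
  rewrite invfM invrK; apply: le_trans (ltW (archi_boundP p0)) _.
  by rewrite ler_nat leqW.
have cS : cmod (circ r t - bn n) ^+ 2 @[n --> \oo] --> cmod (circ r t - b) ^+ 2.
  exact (cvgM cD cD).
have cI : (1 + A ^+ 2 / cmod (circ r t - bn n) ^+ 2) @[n --> \oo] -->
    1 + A ^+ 2 / cmod (circ r t - b) ^+ 2.
  apply: cvgD; first exact: cvg_cst.
  by apply: cvgMr; apply: cvgV cS; rewrite gt_eqF// exprn_gt0.
have P : 0 < 1 + A ^+ 2 / cmod (circ r t - b) ^+ 2.
  by rewrite ltr_wpDr// divr_ge0// ?sqr_ge0.
exact (cvg_comp _ _ cI (continuous_ln P)).
Unshelve. all: by end_near. Qed.

(** The bound for centres off the circle is uniform, so Fatou's lemma extends it to all centres. *)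
Lemma log_kernel_emean r A b : 0 < r -> 0 < A ->
  measurable_fun `[0, 2 * pi] (log_kernel r A b) /\
  (emean (log_kernel r A b) <= (A / r + (A / r) ^+ 2)%:E)%E.
Proof.
move=> r0 A0; have [bn [bnr Hlim]] := log_kernel_approx b r0 A0.
pose f n t := (ln (1 + A ^+ 2 / cmod (circ r t - bn n) ^+ 2))%:E.
have mf n : measurable_fun `[0, 2 * pi] (f n).
  apply/measurable_EFinP; apply: cont_measurable; first exact: measurable_itv.
  by move=> t; rewrite /= in_itv/=; exact: cont_log_kernel.
have f0 n t : (0 <= f n t)%E.
  by rewrite lee_fin ln_ge0// lerDl divr_ge0 ?sqr_ge0.
have mL : measurable_fun `[0, 2 * pi] (log_kernel r A b).
  by apply: (emeasurable_fun_cvg f) => // t _; exact: Hlim.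
split => //.
have mI : measurable (`[0, 2 * pi]%classic : set R) by exact: measurable_itv.
have fat := @fatou _ _ R lebesgue_measure `[0, 2 * pi] mI f mf (fun n t _ => f0 n t).
have E : (\int[lebesgue_measure]_(t in `[0%R, (2 * pi)%R]) log_kernel r A b t =
    \int[lebesgue_measure]_(t in `[0%R, (2 * pi)%R]) limn_einf (f ^~ t))%E.
  apply: eq_integral => t _; rewrite is_cvg_limn_einfE; last by apply/cvg_ex; exists (log_kernel r A b t); exact: Hlim.
  by apply/esym/cvg_lim => //; exact: Hlim.
rewrite /emean E -lee_pdivlMl ?invr_gt0 ?pi2_gt0//.
apply: le_trans fat _; rewrite limn_einf_lim.
apply: lime_le; first exact: is_cvg_einfs.
near=> n; apply: ereal_inf_le.
exists (\int[lebesgue_measure]_(t in `[0%R, (2 * pi)%R]) f n t)%E.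
  by exists n => /=.
rewrite integral_rint; last exact: cont_log_kernel.
rewrite lee_fin invrK -ler_pdivrMl ?pi2_gt0//.
exact: log_kernel_mean.
Unshelve. all: by end_near. Qed.

End LogMean.

(** * Increments of the Poisson and Green kernels *)

Section Green.
Variable R : realType.
Implicit Types (z a : R[i]) (r rho x : R).

Lemma green0 rho a z : rho <= cmod a -> green rho a z = 0.
Proof. by move=> ra; rewrite /green /bln ltNge ra /= subrr. Qed.

Lemma reflect_ge rho a z : 0 < rho -> cmod a < rho -> cmod z < rho ->
  rho - cmod z <= cmod (rho%:C - conjc a * z / rho%:C).
Proof.
move=> r0 ar zr; apply: le_trans (lerB_cmod _ _).
rewrite !cmodM cmodJ cmodV !cmod_real (gtr0_norm r0) lerD2l lerN2.
by rewrite ler_pdivrMr// mulrC ler_wpM2l ?cmod_ge0// ltW.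
Qed.

Lemma reflect_lip rho a z z' : 0 < rho -> cmod a < rho ->
  cmod (rho%:C - conjc a * z' / rho%:C) - cmod (z' - z) <=
  cmod (rho%:C - conjc a * z / rho%:C).
Proof.
move=> r0 ar; rewrite lerBlDr.
have -> : rho%:C - conjc a * z' / rho%:C =
    (rho%:C - conjc a * z / rho%:C) - conjc a * (z' - z) / rho%:C by ring.
apply: le_trans (cmodD _ _) _; rewrite cmodN lerD2l !cmodM cmodJ cmodV cmod_real (gtr0_norm r0).
by rewrite ler_pdivrMr// mulrC ler_wpM2l ?cmod_ge0// ltW.
Qed.

(** After multiplication by [rho^2], the difference of the squared moduli is the product
    [(rho^2 - |a|^2) * (rho^2 - |z|^2)]. *)
Lemma cmodB_le_reflect rho a z : 0 < rho -> cmod a < rho -> cmod z < rho ->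
  cmod (z - a) <= cmod (rho%:C - conjc a * z / rho%:C).
Proof.
move=> r0 ar zr.
rewrite -(@ler_pXn2r _ 2) ?nnegrE ?cmod_ge0//.
have rn : rho != 0 by rewrite gt_eqF.
have -> : rho%:C - conjc a * z / rho%:C = (rho%:C * rho%:C - conjc a * z) * (rho^-1)%:C.
  by rewrite (fmorphV (@real_complex R)) /= mulrBl mulfK ?real_neq0.
rewrite cmodM cmod_real exprMn real_normK ?num_real// exprVn.
rewrite ler_pdivlMr ?exprn_gt0//.
have h1 : cmod a ^+ 2 < rho ^+ 2 by rewrite ltr_pXn2r ?nnegrE ?cmod_ge0// ltW.
have h2 : cmod z ^+ 2 < rho ^+ 2 by rewrite ltr_pXn2r ?nnegrE ?cmod_ge0// ltW.
move: h1 h2 {ar zr}; rewrite !cmod_sqr; case: a z => [a1 a2] [z1 z2] /= h1 h2.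
have -> : (rho * rho - 0 * 0 - (a1 * z1 - - a2 * z2)) ^+ 2 +
  (rho * 0 + 0 * rho - (a1 * z2 + - a2 * z1)) ^+ 2 =
  ((z1 - a1) ^+ 2 + (z2 - a2) ^+ 2) * rho ^+ 2 +
  (rho ^+ 2 - (a1 ^+ 2 + a2 ^+ 2)) * (rho ^+ 2 - (z1 ^+ 2 + z2 ^+ 2)) by ring.
by rewrite lerDl mulr_ge0// subr_ge0 ltW.
Qed.

Lemma green_ge0 rho a z : 0 < rho -> cmod z < rho -> z != a -> 0 <= green rho a z.
Proof.
move=> r0 zr za; have [ar|/green0 ->//] := ltP (cmod a) rho.
have D0 : 0 < cmod (rho%:C - conjc a * z / rho%:C).
  by apply: lt_le_trans (reflect_ge r0 ar zr); rewrite subr_gt0.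
by rewrite /green /bln ar subr_ge0 ler_ln ?posrE ?cmodB_le_reflect// cmod_gt0 subr_eq0.
Qed.

(** The exponential of the increment is a cross ratio [D' * |z - a| / (D * |z' - a|)]. Its numerator
    exceeds the denominator by at most [2 * (rho - |a|) * |z' - z|], and one factor [D] is traded
    for [|z' - a|]. *)
Lemma green_increment rho a z z' : 0 < rho -> cmod a < rho -> cmod z < rho ->
  cmod z' < rho -> cmod (z' - z) <= rho - cmod z -> z != a -> z' != a ->
  green rho a z' - green rho a z <=
    ln (1 + 4 * cmod (z' - z) * (rho - cmod a) / cmod (z' - a) ^+ 2).
Proof.
move=> r0 ar zr z'r cz za z'a; rewrite /green /bln ar.
set D := cmod (rho%:C - conjc a * z / rho%:C).
set D' := cmod (rho%:C - conjc a * z' / rho%:C).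
have rn := real_neq0 r0.
have d0 : 0 < cmod (z - a) by rewrite cmod_gt0 subr_eq0.
have d'0 : 0 < cmod (z' - a) by rewrite cmod_gt0 subr_eq0.
have hD : rho - cmod z <= D := reflect_ge r0 ar zr.
have hD' : rho - cmod z' <= D' := reflect_ge r0 ar z'r.
have D0 : 0 < D by apply: lt_le_trans hD; lra.
have D'0 : 0 < D' by apply: lt_le_trans hD'; lra.
have hdD : cmod (z' - a) <= D' := cmodB_le_reflect r0 ar z'r.
have hlip : D' - cmod (z' - z) <= D := reflect_lip z z' r0 ar.
(* The step [z' - z] is at most [rho - |z| <= D], so [|z' - a| <= D' <= D + |z' - z| <= 2 * D]. *)
have dD : cmod (z' - a) <= 2 * D by lra.
have -> : ln D' - ln (cmod (z' - a)) - (ln D - ln (cmod (z - a))) =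
    ln (D' * cmod (z - a) / (D * cmod (z' - a))).
  by rewrite ln_div ?posrE ?mulr_gt0// !lnM ?posrE//; ring.
have c0 := cmod_ge0 (z' - z); have a0 := cmod_ge0 a.
have num : D' * cmod (z - a) <= D * cmod (z' - a) + 2 * (rho - cmod a) * cmod (z' - z).
  rewrite /D' /D -!cmodM.
  have -> : (rho%:C - conjc a * z' / rho%:C) * (z - a) =
    (rho%:C - conjc a * z / rho%:C) * (z' - a) +
    ((a * conjc a) / rho%:C - rho%:C) * (z' - z) by field.
  apply: le_trans (cmodD _ _) _; rewrite lerD2l cmodM ler_wpM2r//.
  have -> : a * conjc a / rho%:C - rho%:C = (cmod a ^+ 2 / rho - rho)%:C.
    by rewrite mulC_conj -(fmorphV (@real_complex R)) -rmorphM -rmorphB.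
  rewrite cmod_real ler0_norm; last first.
    by rewrite subr_le0 ler_pdivrMr// -expr2 ler_pXn2r ?nnegrE// ltW.
  rewrite opprB -(ler_pM2r r0) mulrBl divfK ?gt_eqF//.
  have -> : rho * rho - cmod a ^+ 2 = (rho - cmod a) * (rho + cmod a) by ring.
  rewrite -mulrA [2 * _]mulrCA ler_wpM2l; lra.
rewrite ler_ln ?posrE; last 2 first.
- by rewrite divr_gt0 ?mulr_gt0.
- by rewrite ltr_wpDr// divr_ge0 ?sqr_ge0// !mulr_ge0//; lra.
rewrite ler_pdivrMr ?mulr_gt0//; apply: le_trans num _.
rewrite [leRHS]mulrDl mul1r lerD2l.
have -> : 4 * cmod (z' - z) * (rho - cmod a) / cmod (z' - a) ^+ 2 * (D * cmod (z' - a)) =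
  (2 * (rho - cmod a) * cmod (z' - z)) * (2 * D / cmod (z' - a)).
  by field; rewrite gt_eqF.
rewrite ler_peMr//; first by rewrite !mulr_ge0//; lra.
by rewrite ler_pdivlMr// mul1r.
Qed.

Lemma mean_green r rho a : 0 < r -> r < rho -> cmod a != r ->
  rmean (fun t => green rho a (circ r t)) = annular r rho a.
Proof.
move=> r0 rr ar; have rho0 := lt_trans r0 rr; rewrite /annular.
have [ra|ra] := leP rho (cmod a).
  rewrite (max_r (ltW (lt_le_trans rr ra))) subrr -[RHS]rmean_cst.
  by apply: eq_rmean => t; exact: green0.
pose F z := rho%:C - conjc a * z / rho%:C.
have hF z : holo F z.
  exact (holoB (holo_cst _ _) (holoM (holoM (holo_cst _ _) (holo_id _)) (holo_cst _ _))).
have F0 z : cmod z < rho -> F z != 0.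
  by move=> zr; rewrite -cmod_gt0; apply: lt_le_trans (reflect_ge rho0 ra zr); rewrite subr_gt0.
have -> : (fun t => green rho a (circ r t)) =
    (fun t => ln (cmod (F (circ r t))) - ln (cmod (circ r t - a))).
  by apply/funext => t; rewrite /green /bln ra.
rewrite rmeanB; last 2 first.
- apply: cont_ln_cmod.
    by apply: holo_ccont; [exact: circ_ccont|move=> t _; exact: hF].
  by move=> t _; apply: F0; rewrite cmod_circ gtr0_norm.
- exact: cont_ln_circB.
rewrite mean_ln_sub//; congr (_ - _).
have c0 : cmod (0 : R[i]) < r by rewrite cmod0.
have := @poisson_ln R F r rho 0 r0 rr c0 (fun z _ => hF z) F0.
rewrite {2}/F mulr0 mul0r subr0 cmod_real gtr0_norm// => <-.
by apply: eq_rmean => t; rewrite pker0// mulr1.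
Qed.

Lemma radialD r rho a : 0 < r -> r <= rho ->
  radial rho a = radial r a + annular r rho a.
Proof.
move=> r0 rr; have rho0 := lt_le_trans r0 rr; rewrite /radial /annular.
have [ar|ar] := leP (cmod a) r.
  rewrite (max_l (le_trans ar rr)) (le_trans ar rr).
  case: ifPn => [_|a0]; first by rewrite addrC subrK.
  have ca : 0 < cmod a by rewrite cmod_gt0.
  by rewrite !ln_div ?posrE//; ring.
rewrite add0r; have ca : 0 < cmod a by exact: lt_trans ar.
have -> : (a == 0) = false by rewrite -cmod_eq0 gt_eqF.
by have [ar'|ar'] := leP (cmod a) rho; rewrite ?subrr// ln_div ?posrE.
Qed.

(** The kernel is the real part of [(q + z) / (q - z)], with increment
    [2 * q * (z' - z) / ((q - z') * (q - z))]. The step is at most half the distance to the circle,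
    so [|q - z| <= 2 * |q - z'|]; the bound keeps the kernel as a factor, whose mean is 1. *)
Lemma pker_increment rho z z' t : 0 < rho -> cmod z < rho -> 
  2 * cmod (z' - z) <= rho - cmod z -> cmod z' < rho ->
  `|pker rho z' t - pker rho z t| <= 4 * cmod (z' - z) / (rho - cmod z) * pker rho z t.
Proof.
move=> r0 zr cz z'r.
set q := circ rho t.
have qr : cmod q = rho by rewrite cmod_circ gtr0_norm.
have qz : q - z != 0 := circB_neq0 r0 zr t.
have qz' : q - z' != 0 := circB_neq0 r0 z'r t.
have PE (y : R[i]) : q - y != 0 -> pker rho y t = Re ((q + y) / (q - y)).
  move=> qy; rewrite /pker -/q.
  have cy : 0 < cmod (q - y) by rewrite cmod_gt0.
  have -> : (q + y) / (q - y) = ((cmod (q - y) ^+ 2)^-1)%:C * ((q + y) * conjc (q - y)).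
    rewrite (fmorphV (@real_complex R)) /= -mulC_conj.
    have : conjc (q - y) != 0 by rewrite -cmod_gt0 cmodJ.
    by move: (conjc _) => C C0; field; rewrite C0 qy.
  have ReZ (k : R) (x : R[i]) : Re (k%:C * x) = k * Re x by rewrite cReM /= mul0r subr0.
  rewrite ReZ mulrC; congr (_ * _).
  rewrite -qr !cmod_sqr; case: (q) (y) => [q1 q2] [y1 y2] /=; ring.
rewrite !PE// -cReN -cReD.
have -> : (q + z') / (q - z') - (q + z) / (q - z) =
    2 * q * (z' - z) / ((q - z') * (q - z)).
  by field; rewrite qz qz'.
apply: le_trans (Re_le_cmod _) _.
rewrite -PE// /pker -/q.
have c0 : 0 < cmod (q - z) by rewrite cmod_gt0.
have c'0 : 0 < cmod (q - z') by rewrite cmod_gt0.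
have z0 := cmod_ge0 z; have d0 := cmod_ge0 (z' - z).
have h1 : rho - cmod z <= cmod (q - z) by rewrite -qr lerB_cmod.
have h2 : cmod (q - z) <= 2 * cmod (q - z').
  have : cmod (q - z) <= cmod (q - z') + cmod (z' - z).
    by rewrite (_ : q - z = (q - z') + (z' - z)); [exact: cmodD|ring].
  lra.
rewrite cmodM cmodV !cmodM qr.
have -> : cmod (2 : R[i]) = 2.
  by rewrite -[2]/(2%:R : R[i]) -(rmorph_nat (@real_complex R)) cmod_real ger0_norm.
have -> : 4 * cmod (z' - z) / (rho - cmod z) * ((rho ^+ 2 - cmod z ^+ 2) / cmod (q - z) ^+ 2)
  = 2 * (2 * cmod (z' - z)) * (rho + cmod z) / cmod (q - z) ^+ 2.
  by field; rewrite !gt_eqF//; lra.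
rewrite ler_pdivrMr ?mulr_gt0//.
have -> : 2 * (2 * cmod (z' - z)) * (rho + cmod z) / cmod (q - z) ^+ 2 *
   (cmod (q - z') * cmod (q - z)) =
   2 * cmod (z' - z) * (rho + cmod z) * (2 * cmod (q - z') / cmod (q - z)).
  by field; rewrite gt_eqF.
apply: le_trans (_ : 2 * cmod (z' - z) * (rho + cmod z) <= _); last first.
  rewrite ler_peMr//; first by rewrite !mulr_ge0//; lra.
  by rewrite ler_pdivlMr// mul1r.
by rewrite mulrAC ler_wpM2l ?mulr_ge0// lerDl.
Qed.

End Green.

(** * Monotonicity of the characteristic *)

Section Monotone.
Variable R : realType.
Implicit Types (z a c : R[i]) (r rho x : R).

Lemma cont_green (lo hi : R) r rho a : 0 < r -> r < rho -> cmod a != r ->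
  cont_on lo hi (fun t => green rho a (circ r t)).
Proof.
move=> r0 rr ar; have rho0 := lt_trans r0 rr.
have [ra|ra] := ltP (cmod a) rho; last first.
  have -> : (fun t => green rho a (circ r t)) = (fun=> 0).
    by apply/funext => t; exact: green0.
  by move=> t _; exact: cvg_cst.
have cl := @cont_ln_circB R lo hi r a r0 ar.
have -> : (fun t => green rho a (circ r t)) = (fun t =>
    ln (cmod (rho%:C - conjc a * circ r t / rho%:C)) + -1 * ln (cmod (circ r t - a))).
  by apply/funext => t; rewrite /green /bln ra mulN1r.
apply: cont_onD (cont_onZ cl).
have cR : ccont_on lo hi (fun t => rho%:C - conjc a * circ r t / rho%:C).
  exact (ccontB (@ccont_cst _ _ _ _) (ccontM (ccontM (@ccont_cst _ _ _ _)
    (@circ_ccont _ _ _ _)) (@ccont_cst _ _ _ _))).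
apply: (cont_ln_cmod cR) => t _; rewrite -cmod_gt0.
have cz : cmod (circ r t) < rho by rewrite cmod_circ gtr0_norm.
by apply: lt_le_trans (reflect_ge rho0 ra cz); rewrite subr_gt0.
Qed.

Variables (w : R[i] -> R[i]) (rmax : R) (s : seq R[i]) (F : R[i] -> R[i]).
Variable (M : R[i] -> int).
Hypothesis D : divisor w rmax s F M.

(** In the Poisson-Jensen formula the zeros contribute with a negative sign and are dropped; the
    poles stay with their Green functions. *)
Lemma log_plus_bound rho z : 0 < rho -> rho < rmax -> div_good s rho ->
  cmod z < rho -> z \notin s ->
  log_plus (cmod (w z)) <= rmean (fun t => log_plus (cmod (w (circ rho t))) * pker rho z t)
    + \sum_(a <- s) multneg M a * green rho a z.
Proof.
move=> r0 rr gr zr zs.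
have za a : a \in s -> z != a by move=> as_; apply: contraNneq zs => ->.
have cl := cont_ln_circ (a := 0) (b := 2 * pi) D r0 (ltW rr) gr.
have cp := cont_log_plus_circ (a := 0) (b := 2 * pi) D r0 (ltW rr) gr.
have ck := @cont_pker _ _ _ r0 zr 0 (2 * pi).
rewrite {1}/log_plus ge_max; apply/andP; split.
  apply: addr_ge0.
    apply: rmean_ge0 => t _; apply: mulr_ge0; first exact: log_plus_ge0.
    exact: pker_ge0.
  rewrite big_seq; apply: sumr_ge0 => a as_; rewrite mulr_ge0 ?multneg_ge0//.
  by apply: green_ge0 => //; exact: za.
rewrite (poisson_jensen D r0 rr gr zr zs); apply: lerD.
  apply: le_rmean; [exact (cont_onM cl ck)|exact (cont_onM cp ck)|] => t _.
  apply: ler_wpM2r; [exact: pker_ge0|exact: ln_le_log_plus].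
rewrite -sumrN big_seq [leRHS]big_seq; apply: ler_sum => a as_.
rewrite -mulNr ler_wpM2r//; first by apply: green_ge0 => //; exact: za.
by rewrite (mult_split M) opprB lerBlDr lerDl multpos_ge0.
Qed.

(** Averaging [log_plus_bound] over [|z| = r] turns the Green function of each pole into its annular
    weight, which is exactly what the counting term gains from [r] to [rho]. *)
Lemma rchar_mono r rho : 0 < r -> r < rho -> rho < rmax ->
  div_good s r -> div_good s rho -> rchar w s M r <= rchar w s M rho.
Proof.
move=> r0 rr rm gr grho; have rho0 := lt_trans r0 rr.
have cl := cont_log_plus_circ (a := 0) (b := 2 * pi) D r0 (ltW (lt_trans rr rm)) gr.
have cp := cont_log_plus_circ (a := 0) (b := 2 * pi) D rho0 (ltW rm) grho.
have lp0 t : 0 <= t <= 2 * pi -> 0 <= log_plus (cmod (w (circ rho t))).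
  by move=> _; exact: log_plus_ge0.
have cg a : a \in s -> cont_on 0 (2 * pi) (fun t => green rho a (circ r t)).
  by move=> /gr; exact: cont_green.
pose S t := \sum_(a <- s) multneg M a * green rho a (circ r t).
have cS : cont_on 0 (2 * pi) S by exact (cont_on_sum cg).
have cz t : cmod (circ r t) < rho by rewrite cmod_circ gtr0_norm.
have S0 t : 0 <= S t.
  rewrite /S big_seq; apply: sumr_ge0 => a as_; rewrite mulr_ge0 ?multneg_ge0//.
  apply: green_ge0 => //.
  by have := circ_notin t r0 gr; apply: contraNneq => ->.
have meanS : rmean S = \sum_(a <- s) multneg M a * annular r rho a.
  rewrite rmean_sum//; apply: eq_big_seq => a /gr ar.
  by rewrite mean_green.
suff H : rmean (fun t => log_plus (cmod (w (circ r t)))) <=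
    rmean (fun t => log_plus (cmod (w (circ rho t)))) + rmean S.
  rewrite /rchar; apply: le_trans (lerD H (lexx _)) _.
  rewrite meanS -addrA lerD2l -big_split /= ler_sum// => a _.
  by rewrite -mulrDr (radialD _ r0 (ltW rr)) addrC.
rewrite -lee_fin EFinD -(emean_EFin cl) -(emean_poisson_avg r0 rr cp lp0) -(emean_EFin cS).
rewrite -emeanD; last 4 first.
- by move=> t _; rewrite lee_fin; exact: poisson_avg_ge0.
- by move=> t _; rewrite lee_fin.
- exact: measurable_poisson_avg.
- apply/measurable_EFinP; apply: cont_measurable; first exact: measurable_itv.
  by move=> t; rewrite /= in_itv/=; exact: cS.
apply: le_emean => t _; first by rewrite lee_fin log_plus_ge0.
rewrite -EFinD lee_fin; apply: log_plus_bound => //.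
exact: circ_notin.
Qed.

End Monotone.

(** * Pointwise bound for the shifted quotient *)

Section Shift.
Variable R : realType.
Implicit Types (z a : R[i]) (x : R).
Variables (w : R[i] -> R[i]) (rmax : R) (s : seq R[i]) (F : R[i] -> R[i]).
Variable (M : R[i] -> int).
Hypotheses (mw : meromorphic w) (D : divisor w rmax s F M).

(** Keeps the coefficient of an infinite [log_kernel] away from 0, as the product would otherwise be
    0 instead of [+oo]. *)
Lemma mult_ge1 a : a \in s -> 1 <= `|(M a)%:~R| :> R.
Proof.
move=> as_; have Ma : M a != 0.
  apply/eqP => M0; apply: (div_irregular D as_).
  by by apply: (order0_regular mw); have := div_order D as_; rewrite M0.
rewrite -intr_norm ler1z.
by case: (M a) Ma => [[]|].
Qed.

Variables (r rho H : R) (c : R[i]).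
Hypotheses (r0 : 0 < r) (rH : r + H <= rho) (rhom : rho < rmax).
Hypotheses (gr : div_good s r) (grho : div_good s rho).
Hypotheses (c0 : c != 0) (cH : 2 * cmod c <= H).

Let cp : 0 < cmod c.
Proof. by rewrite cmod_gt0. Qed.

Let rr : r < rho.
Proof. by have := cp; move: rH cH; lra. Qed.

Let rho0 : 0 < rho := lt_trans r0 rr.

Definition shift_radius a : R := Num.sqrt (4 * cmod c * (rho - cmod a)).

Lemma shift_increment z : cmod z = r -> z \notin s -> z + c \notin s ->
  ln (cmod (w (z + c))) - ln (cmod (w z)) <=
  4 * cmod c / H * rmean (fun t => `|ln (cmod (w (circ rho t)))| * pker rho z t) +
  \sum_(a <- s | cmod a < rho) `|(M a)%:~R| *
    (ln (1 + shift_radius a ^+ 2 / cmod (z + c - a) ^+ 2) +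
     ln (1 + shift_radius a ^+ 2 / cmod (z - a) ^+ 2)).
Proof.
move=> cz zs z's; set z' := z + c.
have zz : z' - z = c by rewrite /z' addrC addKr.
have zr : cmod z < rho by rewrite cz.
have z'r1 : cmod z' <= r + cmod c by rewrite -cz; exact: cmodD.
have H0 : 0 < H by move: cp cH; lra.
have z'r : cmod z' < rho by move: cp cH rH z'r1; lra.
have za a : a \in s -> z != a by move=> as_; apply: contraNneq zs => ->.
have z'a a : a \in s -> z' != a by move=> as_; apply: contraNneq z's => E; rewrite -/z' E.
have cl := cont_ln_circ (a := 0) (b := 2 * pi) D rho0 (ltW rhom) grho.
have ca := cont_on_norm cl.
have ck := @cont_pker _ _ _ rho0 zr 0 (2 * pi).
have ck' := @cont_pker _ _ _ rho0 z'r 0 (2 * pi).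
rewrite (poisson_jensen D rho0 rhom grho zr zs) (poisson_jensen D rho0 rhom grho z'r z's).
have sub4 (x y u v : R) : (x - y) - (u - v) = (x - u) + (v - y) by ring.
rewrite sub4 -sumrB -rmeanB; last 2 first.
- exact (cont_onM cl ck').
- exact (cont_onM cl ck).
apply: lerD.
  rewrite -rmeanZ; last exact (cont_onM ca ck).
  apply: le_rmean; last move=> t _.
  - have -> : (fun t => ln (cmod (w (circ rho t))) * pker rho z' t -
        ln (cmod (w (circ rho t))) * pker rho z t) =
        (fun t => ln (cmod (w (circ rho t))) * pker rho z' t +
        -1 * (ln (cmod (w (circ rho t))) * pker rho z t)).
      by apply/funext => t; rewrite mulN1r.
    exact (cont_onD (cont_onM cl ck') (cont_onZ (cont_onM cl ck))).
  - exact (cont_onZ (cont_onM ca ck)).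
  rewrite -mulrBr; apply: le_trans (ler_norm _) _.
  rewrite normrM mulrCA ler_wpM2l//.
  have zc2 : 2 * cmod (z' - z) <= rho - cmod z by rewrite zz cz; move: cH rH; lra.
  apply: le_trans (pker_increment t rho0 zr zc2 z'r) _.
  apply: ler_wpM2r; first exact: pker_ge0.
  have c4 : 0 <= 4 * cmod c by rewrite mulr_ge0 ?ltW.
  rewrite zz cz; apply: (ler_wpM2l c4).
  by rewrite lef_pV2 ?posrE//; move: rH H0; lra.
rewrite [leRHS]big_mkcond /= big_seq [leRHS]big_seq; apply: ler_sum => a as_.
rewrite -mulrBr; case: ifPn => [ar|]; last first.
  by rewrite -leNgt => ar; rewrite !green0// subrr mulr0.
have A2 : shift_radius a ^+ 2 = 4 * cmod c * (rho - cmod a).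
  by rewrite sqr_sqrtr// !mulr_ge0 ?subr_ge0 ?ltW.
have l0 y : 0 <= ln (1 + shift_radius a ^+ 2 / cmod (y - a) ^+ 2).
  by rewrite ln_ge0// lerDl divr_ge0 ?sqr_ge0.
apply: le_trans (ler_norm _) _; rewrite normrM ler_wpM2l//.
have h1 : green rho a z' - green rho a z <= ln (1 + shift_radius a ^+ 2 / cmod (z' - a) ^+ 2).
  rewrite A2 -zz; apply: green_increment => //; [|exact: za|exact: z'a].
  by rewrite zz cz; move: cH rH cp; lra.
(* Exchanging [z] and [z'] bounds the opposite increment; the two kernels together bound its
   absolute value, whatever the sign of [M a]. *)
have h2 : green rho a z - green rho a z' <= ln (1 + shift_radius a ^+ 2 / cmod (z - a) ^+ 2).
  rewrite A2 -zz cmodB_sym; apply: green_increment => //; [|exact: z'a|exact: za].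
  rewrite cmodB_sym zz; move: cH rH cp z'r1; lra.
have h3 := l0 z; have h4 := l0 z'.
by rewrite ler_norml; apply/andP; split; lra.
Qed.

Lemma shift_pointwise t :
  ((log_plus (cmod (w (circ r t + c) / w (circ r t))))%:E <=
   (4 * cmod c / H)%:E * (poisson_avg r rho (fun t => `|ln (cmod (w (circ rho t)))|) t)%:E +
   \sum_(a <- [seq a <- s | (cmod a < rho)%R]) `|(M a)%:~R|%:E *
    (log_kernel r (shift_radius a) (a - c)%R t + log_kernel r (shift_radius a) a t))%E.
Proof.
set z := circ r t.
have cz : cmod z = r by rewrite /z cmod_circ gtr0_norm.
have zs : z \notin s by exact: circ_notin.
have zr : cmod z < rho by rewrite cz.
have H0 : 0 < H by move: cp cH; lra.
have P0 : 0 <= 4 * cmod c / H * poisson_avg r rho (fun t => `|ln (cmod (w (circ rho t)))|) t.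
  apply: mulr_ge0; first by rewrite divr_ge0 ?mulr_ge0 ?ltW.
  by apply: rmean_ge0 => x _; apply: mulr_ge0 => //; exact: pker_ge0.
have k0 a : (0 <= `|(M a)%:~R|%:E * (log_kernel r (shift_radius a) (a - c)%R t +
    log_kernel r (shift_radius a) a t))%E.
  by rewrite mule_ge0// adde_ge0// log_kernel_ge0.
rewrite -EFinM.
have [z's|z's] := boolP (z + c \in s).
  have cr : cmod (z + c) < rho.
    have : cmod (z + c) <= cmod z + cmod c by exact: cmodD.
    by move: cp cH rH cz; lra.
  have z'f : z + c \in [seq a <- s | (cmod a < rho)%R] by rewrite mem_filter cr.
  rewrite (big_rem _ z'f) /= addrK {1}/log_kernel eqxx addye; last first.
    by rewrite gt_eqF// (lt_le_trans _ (log_kernel_ge0 _ _ _ _)) ?ltNy0.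
  rewrite gt0_muley; last by rewrite lte_fin (lt_le_trans _ (mult_ge1 z's)).
  rewrite addye ?addey ?leey//.
  by rewrite gt_eqF// (lt_le_trans _ (sume_ge0 _ _)) ?ltNy0.
have E a : a \in s -> (log_kernel r (shift_radius a) (a - c)%R t +
    log_kernel r (shift_radius a) a t)%E =
    (ln (1 + shift_radius a ^+ 2 / cmod (z + c - a) ^+ 2) +
     ln (1 + shift_radius a ^+ 2 / cmod (z - a) ^+ 2))%:E.
  move=> as_; rewrite /log_kernel -/z.
  have -> : (z == a) = false by apply: contraNF zs => /eqP ->.
  have -> : (z == a - c) = false by apply: contraNF z's => /eqP ->; rewrite subrK.
  by rewrite opprB addrA addrAC -EFinD.
rewrite big_filter big_seq_cond.
under eq_bigr => a /andP[as_ _] do rewrite (E a as_) -EFinM.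
rewrite -big_seq_cond sumEFin -EFinD lee_fin.
have [_ wz] := off_div_holo D (ltW (lt_trans zr rhom)) zs.
have z'm : cmod (z + c) <= rmax.
  have : cmod (z + c) <= cmod z + cmod c by exact: cmodD.
  by move: cp cH rH cz rhom; lra.
have [_ wz'] := off_div_holo D z'm z's.
rewrite /log_plus ge_max; apply/andP; split.
  apply: addr_ge0 => //; apply: sumr_ge0 => a _; apply: mulr_ge0 => //.
  by apply: addr_ge0; rewrite ln_ge0// lerDl divr_ge0 ?sqr_ge0.
rewrite cmodM cmodV ln_div ?posrE ?cmod_gt0//.
exact: shift_increment.
Qed.

End Shift.

(** * The proximity function of the shifted quotient *)

Section ShiftMean.
Variable R : realType.
Implicit Types (z a c : R[i]) (x r rho : R) (f w : R[i] -> R[i]).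

Lemma proximityE r f :
  proximity r f = emean (fun t => (log_plus (cmod (f (circ r t))))%:E).
Proof.
rewrite /proximity /emean; congr (_ * _)%E.
by apply: eq_integral => t _; rewrite circ.unlock.
Qed.

Lemma emean0 : emean (fun=> 0%E) = 0%E :> \bar R.
Proof. by rewrite /emean integral0 mule0. Qed.

Lemma proximity_ratio r w : proximity r (fun z => w z / w z) = 0%E.
Proof.
rewrite proximityE -[RHS]emean0; congr emean; apply/funext => t.
(* At a zero the quotient is 0 by convention, and [ln 0 = 0], so [log_plus] is 0 there too. *)
have [->|w0] := eqVneq (w (circ r t)) 0.
  by rewrite mul0r cmod0 /log_plus ln0// maxxx.
by rewrite divff// cmod1 /log_plus ln1 maxxx.
Qed.

Lemma lerDsqr x : 0 <= x -> x <= 2 -> x + x ^+ 2 <= 3 * x.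
Proof. by move=> x0 x2; have := ler_wpM2l x0 x2; rewrite expr2; lra. Qed.

(** From [ln y <= y - 1] with [y = m / rho], [m] being the maximum of [r0] and [|a|]. The factor 2
    pays for replacing [|a|] by [r0] when [a] lies inside the reference circle, as
    [2 * r0 <= rho]. *)
Lemma annular_weight r0 rho a : 0 < r0 -> 2 * r0 <= rho -> cmod a < rho ->
  rho - cmod a <= 2 * rho * annular r0 rho a.
Proof.
move=> r00 rr ar; have a0 := cmod_ge0 a.
have rho0 : 0 < rho by lra.
have r0r : r0 < rho by lra.
rewrite /annular (max_l (ltW ar)).
set m := Num.max r0 (cmod a).
have m0 : 0 < m by rewrite lt_max r00.
have h : 1 - m / rho <= ln rho - ln m.
  rewrite -ln_div ?posrE// -[rho / m]invf_div lnV ?posrE ?divr_gt0//.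
  have y0 : 0 < m / rho by rewrite divr_gt0.
  have y1 : -1 < m / rho - 1 by lra.
  by have := le_ln1Dx y1; rewrite (_ : 1 + (m / rho - 1) = m / rho); [lra|ring].
have h2 : 2 * rho * (1 - m / rho) <= 2 * rho * (ln rho - ln m).
  by rewrite ler_wpM2l//; lra.
apply: le_trans h2.
have -> : 2 * rho * (1 - m / rho) = 2 * (rho - m) by field; rewrite gt_eqF.
by rewrite /m; case: (leP r0 (cmod a)) => h3; lra.
Qed.

(** The 8 is 2 from the square root in [shift_radius] times 4 from [annular_weight] with
    [rho' <= 2 * r]. The second bound lets the quadratic term of the kernel mean be absorbed by the
    linear one. *)
Lemma shift_radius_weight r0 r rho rho' H c a : 0 < r0 -> 2 * r0 <= rho' ->
  rho' <= 2 * r -> 0 < H -> rho + H <= rho' -> 2 * cmod c <= r -> cmod a < rho ->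
  shift_radius rho c a / r <= 8 * Num.sqrt (cmod c / H) * annular r0 rho' a /\
  shift_radius rho c a / r <= 2.
Proof.
move=> r00 r0r rr H0 rH cr ar; have a0 := cmod_ge0 a; have c0 := cmod_ge0 c.
have rho'0 : 0 < rho' by lra.
have rp : 0 < r by lra.
have ar' : cmod a < rho' by lra.
have N0 : 0 <= annular r0 rho' a by apply: annular_ge0 => //; lra.
have W := annular_weight r00 r0r ar'.
have A2 : shift_radius rho c a ^+ 2 = 4 * cmod c * (rho - cmod a).
  by rewrite sqr_sqrtr// !mulr_ge0 ?subr_ge0 ?(ltW ar).
have Ap : 0 <= shift_radius rho c a by exact: sqrtr_ge0.
have d1 : 0 <= rho - cmod a by lra.
have d2 : rho - cmod a <= rho' - cmod a by lra.
have d3 : H <= rho' - cmod a by lra.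
have d4 : rho - cmod a <= 2 * r by lra.
have c2 : cmod c <= r / 2 by lra.
have d0 : 0 <= rho' - cmod a by lra.
clear r0r rH cr ar ar' a0.
move: (shift_radius rho c a) Ap A2 => A Ap A2.
split; rewrite ler_pdivrMr//.
  apply: (@le_trans _ _ (2 * Num.sqrt (cmod c / H) * (rho' - cmod a))).
    rewrite -(@ler_pXn2r _ 2) ?nnegrE//; last by rewrite !mulr_ge0 ?sqrtr_ge0.
    rewrite A2 !exprMn sqr_sqrtr ?divr_ge0 ?(ltW H0)//.
    have -> : 2 ^+ 2 * (cmod c / H) * (rho' - cmod a) ^+ 2 =
       4 * cmod c * ((rho' - cmod a) ^+ 2 / H) by field; rewrite gt_eqF.
    rewrite ler_wpM2l ?mulr_ge0// ler_pdivlMr// expr2.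
    exact: (ler_pM d1 (ltW H0) d2 d3).
  have -> : 8 * Num.sqrt (cmod c / H) * annular r0 rho' a * r =
    2 * Num.sqrt (cmod c / H) * (2 * (2 * r) * annular r0 rho' a) by ring.
  rewrite ler_wpM2l ?mulr_ge0 ?sqrtr_ge0//; apply: le_trans W _.
  by rewrite ler_wpM2r// ler_pM2l.
rewrite -(@ler_pXn2r _ 2) ?nnegrE ?mulr_ge0 ?(ltW rp)// A2 exprMn.
have -> : 2 ^+ 2 * r ^+ 2 = 4 * (r / 2) * (2 * r) by field.
by apply: (ler_pM _ d1 _ d4); rewrite ?mulr_ge0// ler_pM2l.
Qed.

Variables (w : R[i] -> R[i]) (rmax : R) (s : seq R[i]) (F : R[i] -> R[i]).
Variable (M : R[i] -> int).
Hypotheses (mw : meromorphic w) (D : divisor w rmax s F M).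

Lemma shift_proximity r0 r rho rho' H c : 1 <= r0 -> 2 * r0 <= r ->
  r + H <= rho -> rho + H <= rho' -> rho' <= 2 * r -> rho' < rmax ->
  0 < H -> 2 * cmod c <= H ->
  div_good s r0 -> div_good s r -> div_good s rho -> div_good s rho' ->
  (proximity r (fun z => (w (z + c) / w z)%R) <=
   (52 * Num.sqrt (cmod c / H) * (2 * rchar w s M rho' +
     `|rmean (fun t => ln (cmod (w (circ r0 t))))|))%:E)%E.
Proof.
move=> r01 r0r rH rhoH rho'r rho'm H0 cH g0 gr grho grho'.
set J := rmean _; have rp : 0 < r by lra.
have rrho : r < rho by lra.
have rho0 : 0 < rho by lra.
have rm : rho < rmax by lra.
have rr' : rho < rho' by lra.
have r0rho : r0 < rho by lra.
have r0rho' : r0 < rho' by lra.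
have r00 : 0 < r0 := lt_le_trans ltr01 r01.
have r0r' : 2 * r0 <= rho' by lra.
have cr : 2 * cmod c <= r by lra.
have [B1 _] := jensen_bounds D r01 r0rho rm g0 grho.
have [_ B2] := jensen_bounds D r01 r0rho' rho'm g0 grho'.
have mono := rchar_mono D rho0 rr' rho'm grho grho'.
rewrite -/J in B1 B2; set K := 2 * rchar w s M rho' + `|J| in B2 *.
have {}B1 : rmean (fun t => `|ln (cmod (w (circ rho t)))|) <= K.
  by apply: le_trans B1 _; rewrite /K; lra.
have K0 : 0 <= K by apply: le_trans B1; apply: rmean_ge0.
(* The zero shift is separate because the kernel means require a positive [shift_radius]. *)
have [->|c0] := eqVneq c 0.
  under [X in proximity _ X]eq_fun do rewrite addr0.
  by rewrite proximity_ratio lee_fin !mulr_ge0 ?sqrtr_ge0.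
have cp : 0 < cmod c by rewrite cmod_gt0.
set q := cmod c / H.
have q0 : 0 < q by rewrite divr_gt0.
have q1 : q <= 1 by rewrite ler_pdivrMr// mul1r; lra.
set sq := Num.sqrt q.
have sq0 : 0 < sq by rewrite sqrtr_gt0.
have sq2 : sq ^+ 2 = q by rewrite sqr_sqrtr ?ltW.
have sq1 : sq <= 1 by rewrite -[leRHS]sqrtr1 ler_sqrt.
have qsq : q <= sq by rewrite -sq2 expr2 ler_piMl ?(ltW sq0).
have A0 a : cmod a < rho -> 0 < shift_radius rho c a.
  by move=> ar; rewrite sqrtr_gt0 !mulr_gt0// subr_gt0.
have cl := cont_ln_circ (a := 0) (b := 2 * pi) D rho0 (ltW rm) grho.
have ca := cont_on_norm cl.
have ca0 t : 0 <= t <= 2 * pi -> 0 <= `|ln (cmod (w (circ rho t)))| by [].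
pose U a t := if (cmod a < rho)%R then (log_kernel r (shift_radius rho c a) (a - c)%R t +
  log_kernel r (shift_radius rho c a) a t)%E else 0%E.
have mLK a b : cmod a < rho -> measurable_fun `[0, 2 * pi]
    (log_kernel r (shift_radius rho c a) b).
  by move=> ar; have [] := log_kernel_emean b rp (A0 _ ar).
have mU a : measurable_fun `[0, 2 * pi] (U a).
  rewrite /U; have [ar|_] := ltP (cmod a) rho; last exact: measurable_cst.
  by apply: emeasurable_funD; exact: mLK.
have U0 a t : 0 <= t <= 2 * pi -> (0 <= U a t)%E.
  by move=> _; rewrite /U; case: ifP => // _; rewrite adde_ge0// log_kernel_ge0.
pose s' := [seq a <- s | (cmod a < rho)%R].
have [ES mS] := @emean_sum R s' (fun a => `|(M a)%:~R|) U (fun a => normr_ge0 _) U0 mU.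
have c4 : 0 <= 4 * cmod c / H by rewrite divr_ge0 ?mulr_ge0 ?ltW.
have mP := measurable_poisson_avg rp rrho ca ca0.
have P0 t : (0 <= (poisson_avg r rho (fun t => `|ln (cmod (w (circ rho t)))|) t)%:E)%E.
  by rewrite lee_fin; exact (poisson_avg_ge0 rp rrho ca0 t).
apply: (@le_trans _ _ (emean (fun t => (4 * cmod c / H)%:E *
   (poisson_avg r rho (fun t => `|ln (cmod (w (circ rho t)))|) t)%:E +
   \sum_(a <- s') `|(M a)%:~R|%:E * U a t)%E)).
  rewrite proximityE; apply: le_emean => t _; first by rewrite lee_fin log_plus_ge0.
  apply: le_trans (shift_pointwise mw D rp rH rm gr grho c0 cH t) _.
  rewrite leeD2l// big_seq_cond [leRHS]big_seq_cond; apply: lee_sum => a.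
  by rewrite andbT /U mem_filter => /andP[-> _].
rewrite emeanD; last 4 first.
- by move=> t _; rewrite mule_ge0.
- by move=> t tI; apply: sume_ge0 => a _; rewrite mule_ge0 ?U0.
- exact: measurable_funeM.
- exact: mS.
rewrite (emeanZ c4 (fun t _ => P0 t) mP).
rewrite (emean_poisson_avg rp rrho ca ca0) ES.
(* The 4 comes from the Poisson part, where [q <= sq]. The 48 comes from two kernels for each [a],
   each of mean at most [x + x^2 <= 3 * x], with [x] at most [8 * sq] times the annular weight. *)
have -> : 52 * sq * K = 4 * sq * K + 24 * sq * (2 * K) by ring.
rewrite EFinD; apply: leeD.
  rewrite -EFinM lee_fin -/q -[4 * _ / _]mulrA -/q.
  by apply: ler_pM => //; [rewrite mulr_ge0 ?ltW|apply: rmean_ge0|rewrite ler_pM2l].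
apply: (@le_trans _ _ (\sum_(a <- s') (24 * sq * (2 * (`|(M a)%:~R| * annular r0 rho' a)))%:E)%E); last first.
  rewrite sumEFin lee_fin -mulr_sumr ler_wpM2l ?mulr_ge0 ?(ltW sq0)// -mulr_sumr ler_pM2l//.
  apply: le_trans B2; rewrite big_filter big_mkcond /=; apply: ler_sum => a _.
  by case: ifP => // _; rewrite mulr_ge0// annular_ge0 ?(ltW r0rho').
rewrite big_seq_cond [leRHS]big_seq_cond; apply: lee_sum => a.
rewrite andbT mem_filter => /andP[ar _].
have [xle x2] := shift_radius_weight r00 r0r' rho'r H0 rhoH cr ar.
set A := shift_radius rho c a in xle x2.
have Ap : 0 < A := A0 _ ar.
set x := A / r in xle x2.
have x0 : 0 <= x by rewrite divr_ge0 ?ltW.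
have x3 : x + x ^+ 2 <= 3 * x by exact: lerDsqr.
have LK b : (emean (log_kernel r A b) <= (3 * x)%:E)%E.
  by have [_ /le_trans->//] := log_kernel_emean b rp Ap; rewrite lee_fin.
have EU : (emean (U a) <= (6 * x)%:E)%E.
  rewrite (_ : U a = (fun t => log_kernel r A (a - c)%R t + log_kernel r A a t)%E); last first.
    by apply/funext => t; rewrite /U ar.
  rewrite emeanD; [|by move=> t _; exact: log_kernel_ge0|
    by move=> t _; exact: log_kernel_ge0|exact: mLK|exact: mLK].
  have -> : 6 * x = 3 * x + 3 * x by ring.
  by rewrite EFinD leeD.
apply: le_trans (lee_wpmul2l _ EU) _; first by rewrite lee_fin.
rewrite -EFinM lee_fin.
have -> : 24 * sq * (2 * (`|(M a)%:~R| * annular r0 rho' a)) =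
  `|(M a)%:~R| * (6 * (8 * sq * annular r0 rho' a)) by ring.
by rewrite ler_wpM2l// ler_pM2l.
Qed.

End ShiftMean.

(** * The characteristic on regular circles *)

Section GoodRadii.
Variable R : realType.
Implicit Types (z a c : R[i]) (x r rho : R).
Variable w : R[i] -> R[i].
Hypotheses (mw : meromorphic w) (w0 : exists z, w z != 0).

Definition good r := 0 < r /\ forall z, cmod z = r -> regular_at w z.

Lemma good_div rmax s F M r : divisor w rmax s F M -> good r -> div_good s r.
Proof.
by move=> D [_ gr] a /(div_irregular D) na; apply/eqP => /gr.
Qed.

Lemma bad_countable : countable [set r | 0 < r /\ ~ good r].
Proof.
have /choice[s Hs] : forall n : nat, exists s : seq R[i],
    forall z, cmod z <= n%:R -> z \notin s -> regular_at w z.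
  move=> n; have [s [F [M D]]] := divisor_ex n%:R mw w0.
  by exists s; exact: div_regular D.
apply: (@sub_countable _ _ _ (\bigcup_n [set` [seq cmod a | a <- s n]])).
  apply: subset_card_le => r [r0 br].
  exists (Num.bound r) => //=.
  apply: contrapT => nr; apply: br; split=> // z zr.
  apply: (Hs (Num.bound r)); first by rewrite zr ltW// archi_boundP// ltW.
  by apply/negP => zs; apply: nr; have := map_f (@Normc.normc R) zs; rewrite zr.
apply: bigcup_countable; first exact: countableP.
by move=> n _; exact: finite_set_countable.
Qed.

(** A countable set is null and cannot contain an interval. *)
Lemma good_between x y : 0 <= x -> x < y -> exists r, [/\ good r, x < r & r < y].
Proof.
move=> x0 xy; apply: contrapT => H.
have sub : `]x, y[ `<=` [set r | 0 < r /\ ~ good r].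
  move=> r; rewrite /= in_itv/= => /andP[xr ry]; split; first exact: le_lt_trans xr.
  by move=> gr; apply: H; exists r.
have /countable_lebesgue_measure0 : countable (`]x, y[ : set R).
  exact (sub_countable (subset_card_le sub) bad_countable).
rewrite lebesgue_measure_itv /= lte_fin xy -EFinB => -[].
by apply/eqP; rewrite subr_eq0 gt_eqF.
Qed.

(* A junk value unless r is a good radius. *)
Definition chr r : R := fine (characteristic r w).

Lemma chr_div rmax s F M r : divisor w rmax s F M -> good r -> r <= rmax ->
  chr r = rchar w s M r.
Proof.
by move=> D gr rr; rewrite /chr (characteristicE D gr.1 rr)//; exact: good_div D gr.
Qed.

Lemma chrE r : good r -> characteristic r w = (chr r)%:E.
Proof.
move=> gr; have [s [F [M D]]] := divisor_ex r mw w0.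
by rewrite /chr (characteristicE D gr.1 (lexx r))//; exact: good_div D gr.
Qed.

Lemma chr_mono r rho : good r -> good rho -> r < rho -> chr r <= chr rho.
Proof.
move=> gr grho rr; have [s [F [M D]]] := divisor_ex (rho + 1) mw w0.
have rm : rho < rho + 1 by rewrite ltrDl.
rewrite (chr_div D gr (ltW (lt_trans rr rm))) (chr_div D grho (ltW rm)).
by apply: (rchar_mono D gr.1 rr rm); [exact: good_div D gr|exact: good_div D grho].
Qed.

Lemma chr_ge0 r : good r -> 1 <= r -> 0 <= chr r.
Proof.
move=> gr r1; have [s [F [M D]]] := divisor_ex r mw w0.
rewrite (chr_div D gr (lexx r)); apply: addr_ge0.
  by apply: rmean_ge0 => t _; exact: log_plus_ge0.
by apply: sumr_ge0 => a _; rewrite mulr_ge0 ?multneg_ge0 ?radial_ge0.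
Qed.

Lemma proximity_le_chr : exists r0 C, [/\ 1 <= r0, 0 <= C &
  forall r rho rho' H c, good r -> good rho -> good rho' -> 2 * r0 <= r ->
  r + H <= rho -> rho + H <= rho' -> rho' <= 2 * r -> 0 < H -> 2 * cmod c <= H ->
  (proximity r (fun z => (w (z + c) / w z)%R) <=
   (52 * Num.sqrt (cmod c / H) * (2 * chr rho' + C))%:E)%E].
Proof.
have [r0 [g0 r01 _]] := good_between ler01 (ltr1n R 2).
exists r0, `|rmean (fun t => ln (cmod (w (circ r0 t))))|; split => //; first exact: ltW.
move=> r rho rho' H c gr grho grho' rr rH rhoH rho'r H0 cH.
(* The divisor depends on [rho'], but [r0] and the constant do not: they refer to [w] alone. The
   larger disc gives the strict inequality [rho' < rmax]. *)
have [s [F [M D]]] := divisor_ex (rho' + 1) mw w0.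
have rm : rho' < rho' + 1 by rewrite ltrDl.
rewrite (chr_div D grho' (ltW rm)).
by apply: (shift_proximity mw D (ltW r01) rr rH rhoH rho'r rm H0 cH); exact: good_div D _.
Qed.

(** * Functions of bounded characteristic *)

Section Bounded.
Variable B : R.
Hypothesis chrB : forall r, good r -> 1 <= r -> chr r <= B.

(** A single pole contributes at least [ln r - ln (max 1 |p|)] to the characteristic, which is
    unbounded in [r]; [K] makes this exceed [B]. *)
Lemma bounded_chr_no_pole p : ~ is_pole w p.
Proof.
move=> Hp; pose K := Num.max 1 (cmod p) * expR (`|B| + 1).
have m1 : 1 <= Num.max 1 (cmod p) by rewrite le_max lexx.
have m0 : 0 < Num.max 1 (cmod p) by exact: lt_le_trans m1.
have e1 : 1 <= expR (`|B| + 1) by rewrite -[leLHS]expR0 ler_expR addr_ge0.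
have KM : Num.max 1 (cmod p) <= K by rewrite /K ler_peMr// ltW.
have K1 : 1 <= K by exact: le_trans KM.
have [r [gr Kr _]] := good_between (le_trans ler01 K1) (ltr_pwDr ltr01 (lexx K)).
have r1 : 1 <= r by apply: ltW; exact: le_lt_trans Kr.
have rp : 0 < r by exact: lt_le_trans r1.
have pr : cmod p <= r.
  by apply: ltW (le_lt_trans _ Kr); apply: le_trans KM; rewrite le_max lexx orbT.
have [s [F [M D]]] := divisor_ex r mw w0.
have [ps Mp] := pole_in_div D pr Hp.
have := chrB gr r1; rewrite (chr_div D gr (lexx r)); apply/negP; rewrite -ltNge.
apply: lt_le_trans (_ : radial r p <= _).
  have h : `|B| + 1 <= ln r - ln (Num.max 1 (cmod p)).
    rewrite lerBrDl -[X in _ + X]expRK -lnM ?posrE ?expR_gt0// ler_ln ?posrE ?mulr_gt0 ?expR_gt0//.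
    exact: ltW.
  have hB := ler_norm B.
  apply: lt_le_trans (_ : ln r - ln (Num.max 1 (cmod p)) <= _); first by lra.
  rewrite /radial pr; case: eqVneq => [_|p0]; first by rewrite lerBlDr lerDl ln_ge0.
  have cp : 0 < cmod p by rewrite cmod_gt0.
  by rewrite ln_div ?posrE// lerD2l lerN2 ler_ln ?posrE// le_max lexx orbT.
apply: le_trans (_ : multneg M p * radial r p <= _).
  rewrite ler_peMl ?radial_ge0// /multneg Mp ler1n absz_gt0.
  by rewrite lt_eqF.
rewrite /rchar (big_rem _ ps) /= addrCA lerDl addr_ge0//.
  by apply: rmean_ge0 => t _; exact: log_plus_ge0.
by apply: sumr_ge0 => a _; rewrite mulr_ge0 ?multneg_ge0 ?radial_ge0.
Qed.

Lemma bounded_chr_holo z : exists2 d, 0 < d & forall y, cmod (y - z) < d -> holo w y.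
Proof.
have [Hz|/bounded_chr_no_pole//] := mw z.
have [d d0 Hd] := (nbhsCP z _).1 Hz.
by exists d => // y /Hd; split.
Qed.

(** Without poles, [log_plus |w z|] is at most a Poisson integral, and for [r > 2 * |z|] the kernel
    is at most 3. *)
Lemma bounded_chr_bound z : log_plus (cmod (w z)) <= 3 * B.
Proof.
have B0 : 0 <= B.
  have [r [gr r1 _]] := good_between ler01 (ltr1n R 2).
  exact: le_trans (chr_ge0 gr (ltW r1)) (chrB gr (ltW r1)).
have [->|wz] := eqVneq (w z) 0.
  by rewrite cmod0 /log_plus ln0// maxxx mulr_ge0.
have z0 := cmod_ge0 z.
have lo : 0 <= 2 * cmod z + 1 by lra.
have [r [gr Kr _]] := good_between lo (ltr_pwDr ltr01 (lexx (2 * cmod z + 1))).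
have zr : cmod z < r by lra.
have r1 : 1 <= r by lra.
have rp := gr.1.
have [s [F [M D]]] := divisor_ex (r + 1) mw w0.
have rm : r < r + 1 by rewrite ltrDl.
have zs : z \notin s.
  apply/negP => /(div_irregular D); apply.
  by have [d d0 hw] := bounded_chr_holo z; exact: holo_neq0_near d0 hw wz.
have gd := good_div D gr.
have nM a : a \in s -> multneg M a = 0.
  move=> as_; rewrite /multneg; case: ifP => // Ma; exfalso.
  exact: (bounded_chr_no_pole ((is_poleP (div_order D as_)).2 Ma)).
have := log_plus_bound D rp rm gd zr zs.
rewrite [X in _ + X]big_seq big1 ?addr0; last by move=> a /nM ->; rewrite mul0r.
move=> /le_trans; apply.
have := chrB gr r1; rewrite (chr_div D gr (ltW rm)) /rchar.
rewrite big_seq big1 ?addr0; last by move=> a /nM ->; rewrite mul0r.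
move=> h; apply: le_trans (_ : 3 * rmean (fun t => log_plus (cmod (w (circ r t)))) <= _); last first.
  by rewrite ler_pM2l.
have cp := cont_log_plus_circ (a := 0) (b := 2 * pi) D rp (ltW rm) gd.
have ck := @cont_pker _ _ _ rp zr 0 (2 * pi).
rewrite -rmeanZ//; apply: le_rmean; [exact (cont_onM cp ck)|exact (cont_onZ cp)|] => t _.
rewrite mulrC ler_wpM2r ?log_plus_ge0//.
apply: le_trans (pker_le rp zr t) _.
by rewrite ler_pdivrMr; lra.
Qed.

Lemma bounded_chr_const z : w z = w 0.
Proof.
have hw y : holo w y by have [d d0 H] := bounded_chr_holo y; apply: H; rewrite subrr cmod0.
pose K := expR (3 * B).
have wK y : cmod (w y) <= K.
  have [->|wy] := eqVneq (w y) 0; first by rewrite cmod0 expR_ge0.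
  rewrite -[leLHS]lnK ?posrE ?cmod_gt0// ler_expR.
  exact: le_trans (ln_le_log_plus _) (bounded_chr_bound y).
have K0 : 0 < K by exact: expR_gt0.
apply/eqP; rewrite -subr_eq0; apply/eqP/eq0_cmod => e e0.
have z0 := cmod_ge0 z.
have e2 : 0 < e / 2 by rewrite divr_gt0.
(* The two Cauchy kernels at [z] and 0 differ by [z / (zeta - z)], and this radius makes
   [K * |z| / (r - |z|) <= e / 2]. *)
pose r := cmod z + 1 + K * cmod z / (e / 2).
have q0 : 0 <= K * cmod z / (e / 2) by exact: divr_ge0 (mulr_ge0 (ltW K0) z0) (ltW e2).
have zr : cmod z < r by rewrite /r; lra.
have r0 : 0 < r by rewrite /r; lra.
have c0r : cmod (0 : R[i]) < r by rewrite cmod0.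
have cw : ccont_on 0 (2 * pi) (fun t => w (circ r t)).
  by apply: holo_ccont; [exact: circ_ccont|move=> t _; exact: hw].
rewrite -(cauchy_formula r0 zr (fun y _ => hw y)) -(cauchy_formula r0 c0r (fun y _ => hw y)).
rewrite -cmeanB; last 2 first.
- exact (ccontM cw (@cauchy_kernel_ccont _ _ _ r0 zr _ _)).
- exact (ccontM cw (@cauchy_kernel_ccont _ _ _ r0 c0r _ _)).
have -> : e = 2 * (e / 2) by rewrite mulrC divfK.
apply: cmean_bound.
  exact (ccontB (ccontM cw (@cauchy_kernel_ccont _ _ _ r0 zr _ _))
    (ccontM cw (@cauchy_kernel_ccont _ _ _ r0 c0r _ _))).
move=> t _; have qz := circB_neq0 r0 zr t; have q00 := circB_neq0 r0 c0r t.
rewrite subr0 in q00 *; rewrite divff// mulr1.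
have -> : w (circ r t) * (circ r t / (circ r t - z)) - w (circ r t) =
    w (circ r t) * (z / (circ r t - z)) by field.
have /andP[h _] := cmod_circB r0 zr t.
have zr1 : 0 < r - cmod z by rewrite subr_gt0.
rewrite !cmodM cmodV.
apply: le_trans (_ : K * (cmod z / (r - cmod z)) <= _).
  apply: ler_pM; rewrite ?cmod_ge0 ?wK//.
    by rewrite mulr_ge0 ?invr_ge0 ?cmod_ge0.
  by rewrite ler_wpM2l// lef_pV2 ?posrE//; exact: lt_le_trans h.
rewrite mulrA ler_pdivrMr// [leRHS]mulrC -ler_pdivrMr//.
by rewrite lerBrDr addrC /r lerD2r lerDl.
Qed.

End Bounded.

End GoodRadii.

(** * A Borel lemma *)

Section Borel.
Variable R : realType.
Implicit Types (x r e u v : R) (k n : nat) (J : nat -> set R).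

(** The integral-test estimate for the decreasing function [v^(-e)], from [exp y >= 1 + y] and
    [ln (v / u) >= 1 - u / v]. *)
Lemma powR_decrease e u v : 0 < e -> 0 < u -> u <= v ->
  e * (v - u) / v `^ (1 + e) <= u `^ (- e) - v `^ (- e).
Proof.
move=> e0 u0 uv; have v0 := lt_le_trans u0 uv.
have vn : v != 0 by rewrite gt_eqF.
have ve0 : 0 < v `^ (- e) by exact: powR_gt0.
have -> : (v `^ (1 + e))^-1 = v `^ (- e) / v.
  rewrite powRD ?vn ?implybT// powRr1 ?(ltW v0)// powRN invfM mulrC.
  by [].
have -> : u `^ (- e) = v `^ (- e) * expR (e * (ln v - ln u)).
  by rewrite /powR !gt_eqF// -expRD; congr expR; ring.
have h1 : 1 - u / v <= ln v - ln u.
  have y1 : -1 < u / v - 1 by have := divr_gt0 u0 v0; lra.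
  have := le_ln1Dx y1; rewrite (_ : 1 + (u / v - 1) = u / v); last by ring.
  by rewrite ln_div ?posrE//; lra.
have h2 : 1 + e * (1 - u / v) <= expR (e * (ln v - ln u)).
  by apply: le_trans (expR_ge1Dx _); rewrite lerD2l ler_pM2l.
have -> : e * (v - u) * (v `^ (- e) / v) = v `^ (- e) * (1 + e * (1 - u / v)) - v `^ (- e).
  by field.
by rewrite lerD2r ler_pM2l.
Qed.

Definition borel_gap e k : R := 2 / (k%:R * ln k%:R `^ (1 + e)).

Lemma borel_gap_ge0 e k : 0 <= borel_gap e k.
Proof. by rewrite divr_ge0// mulr_ge0 ?powR_ge0. Qed.

(** [powR_decrease] at [ln k] and [ln (k + 1)], whose difference is at least [1 / (k + 1)], bounds
    each gap by a telescoping term. *)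
Lemma borel_gap_le e k : 0 < e -> (2 <= k)%N ->
  borel_gap e k.+1 <= 2 / e * (ln k%:R `^ (- e) - ln k.+1%:R `^ (- e)).
Proof.
move=> e0 k2.
have k1 : 1 < k%:R :> R by rewrite ltr1n.
have k0 : 0 < k%:R :> R by exact: lt_trans k1.
have u0 : 0 < ln (k%:R : R) by exact: ln_gt0.
have kk : 0 < k.+1%:R :> R by [].
have uv : k.+1%:R^-1 <= ln k.+1%:R - ln k%:R :> R.
  have y1 : -1 < - k.+1%:R^-1 :> R by rewrite ltrN2 invf_lt1// ltr1n leqW.
  have := le_ln1Dx y1; rewrite (_ : 1 + - k.+1%:R^-1 = k%:R / k.+1%:R); last first.
    by rewrite -natr1; field; rewrite natr1 gt_eqF.
  by rewrite ln_div ?posrE// lerNr opprB.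
have uv0 : ln (k%:R : R) <= ln k.+1%:R by rewrite -subr_ge0; apply: le_trans uv; rewrite invr_ge0.
apply: le_trans (_ : 2 / e * (e * (ln k.+1%:R - ln k%:R) / ln k.+1%:R `^ (1 + e)) <= _); last first.
  by rewrite ler_wpM2l ?divr_ge0 ?(ltW e0)// powR_decrease.
have v0 : 0 < ln (k.+1%:R : R) `^ (1 + e) by rewrite powR_gt0// (lt_le_trans u0).
have -> : 2 / e * (e * (ln k.+1%:R - ln k%:R) / ln k.+1%:R `^ (1 + e)) =
  2 * ((ln k.+1%:R - ln k%:R) / ln k.+1%:R `^ (1 + e)) by field; rewrite !gt_eqF.
by rewrite /borel_gap invfM ler_pM2l// ler_wpM2r// invr_ge0 ltW.
Qed.

Lemma borel_gap_sum e k0 n : 0 < e -> (2 <= k0)%N ->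
  \sum_(i < n) borel_gap e (k0 + i).+1 <= 2 / e * ln k0%:R `^ (- e).
Proof.
move=> e0 k2; have ei : 0 <= 2 / e by rewrite divr_ge0 ?ltW.
suff H : \sum_(i < n) borel_gap e (k0 + i).+1 <=
    2 / e * (ln k0%:R `^ (- e) - ln (k0 + n)%:R `^ (- e)).
  by apply: le_trans H _; rewrite ler_wpM2l// gerBl powR_ge0.
elim: n => [|n IH]; first by rewrite big_ord0 addn0 subrr mulr0.
rewrite big_ord_recr /= addnS.
apply: le_trans (lerD IH (borel_gap_le e0 (leq_trans k2 (leq_addr n k0)))) _.
by rewrite -mulrDr addrA subrK.
Qed.

(** The countable part is null. The sets [J n] may overlap, so they are replaced by disjoint
    differences, over which the integral becomes a series bounded by the [b n]. *)
Lemma finite_log_bigcup J (N : set R) (b : nat -> R) (B : R) :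
  (forall n, measurable (J n)) -> (forall n, J n `<=` `[1, +oo[) ->
  countable N -> N `<=` `[1, +oo[ ->
  (forall n, (\int[lebesgue_measure]_(t in J n) (t^-1)%:E <= (b n)%:E)%E) ->
  (forall n, \sum_(i < n) b i <= B) ->
  finite_log_measure (N `|` \bigcup_n J n).
Proof.
move=> mJ J1 cN N1 Jb bB.
have mN : measurable N by exact: countable_measurable.
have mU : measurable (\bigcup_n J n) by exact: bigcup_measurable.
have mf (A : set R) : A `<=` `[1, +oo[ -> measurable_fun A (fun t : R => (t^-1)%:E).
  move=> A1.
  have mf1 : measurable_fun (`[1, +oo[%classic : set R) (fun t : R => (t^-1)%:E).
    apply/measurable_EFinP; apply: cont_measurable => //= t.
    by rewrite in_itv/= andbT => t1; apply: inv_continuous; rewrite gt_eqF// (lt_le_trans _ t1).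
  exact: (measurable_funS _ A1 mf1).
have f0 t : `[1%R, +oo[%classic t -> (0 <= (t^-1)%:E :> \bar R)%E.
  by rewrite /= in_itv/= andbT => t1; rewrite lee_fin invr_ge0 (le_trans _ t1).
have U1 : \bigcup_n J n `<=` `[1, +oo[ by move=> t [n _ /J1].
have E1 : N `|` \bigcup_n J n `<=` `[1, +oo[ by move=> t [/N1|/U1].
have mE : measurable (N `|` \bigcup_n J n) by exact: measurableU.
split => //.
rewrite (@ge0_negligible_integral _ _ R lebesgue_measure _ N)//; last 3 first.
- exact: mf.
- by move=> t /E1 /f0.
- exact: countable_lebesgue_measure0.
apply: (@le_lt_trans _ _ (\int[lebesgue_measure]_(t in \bigcup_n J n) (t^-1)%:E)%E).
  apply: ge0_subset_integral => //.
  - exact: measurableD.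
  - exact: mf.
  - by move=> t /U1 /f0.
  - by move=> t [[]].
rewrite seqDU_bigcup_eq ge0_integral_bigcup//; last 3 first.
- exact: seqDU_measurable.
- by rewrite -seqDU_bigcup_eq; exact: mf.
- by rewrite -seqDU_bigcup_eq => t /U1 /f0.
apply: (@le_lt_trans _ _ (\sum_(i <oo) (b i)%:E)%E).
  apply: lee_nneseries => [i _ _|i _].
    by apply: integral_ge0 => t Jt; exact: f0 (J1 i _ (@subset_seqDU _ J i _ Jt)).
  apply: le_trans (Jb i); apply: ge0_subset_integral => //.
  - exact: seqDU_measurable.
  - exact: mJ.
  - exact: (mf _ (J1 i)).
  - by move=> t Jt; exact: f0 (J1 i _ Jt).
  - exact: subset_seqDU.
have b0 i : 0 <= b i.
  rewrite -lee_fin; apply: le_trans (Jb i).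
  by apply: integral_ge0 => t Jt; exact: f0 (J1 i _ Jt).
apply: (@le_lt_trans _ _ B%:E); last exact: ltry.
apply: lime_le; first by apply: is_cvg_nneseries => i _ _; rewrite lee_fin.
by apply: nearW => n; rewrite sumEFin big_mkord lee_fin.
Qed.

(** The whole interval [[t / (1 + a), t]] has logarithmic measure [ln (1 + a) <= a]. *)
Lemma log_measure_gap (t a : R) (A : set R) : measurable A -> 0 <= a ->
  A = `[t / (1 + a), t] `&` `[1, +oo[ ->
  (\int[lebesgue_measure]_(t in A) (t^-1)%:E <= a%:E)%E.
Proof.
move=> mA a0 AE.
have a1 : 0 < 1 + a by lra.
have [t1|t1] := ltP t 1.
  have -> : A = set0.
    apply/seteqP; split => // x; rewrite AE /= !in_itv/= andbT => -[/andP[_ xt] x1].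
    by move: (lt_le_trans (le_lt_trans xt t1) x1); rewrite ltxx.
  by rewrite integral_set0 lee_fin.
have t0 : 0 < t by exact: lt_le_trans t1.
have l0 : 0 < t / (1 + a) by rewrite divr_gt0.
have lt : t / (1 + a) <= t by rewrite ler_pdivrMr// ler_peMr ?(ltW t0)//; lra.
have ci : cont_on (t / (1 + a)) t (fun x : R => x^-1).
  move=> x /andP[lx _]; apply: inv_continuous.
  by rewrite gt_eqF// (lt_le_trans l0).
apply: (@le_trans _ _ (\int[lebesgue_measure]_(x in `[(t / (1 + a))%R, t]) (x^-1)%:E)%E).
  apply: ge0_subset_integral => //.
  - apply/measurable_EFinP; apply: cont_measurable; first exact: measurable_itv. move=> x.
    by rewrite /= in_itv/=; exact: ci.
  - move=> x; rewrite /= in_itv/= => /andP[lx _].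
    by rewrite lee_fin invr_ge0 (le_trans (ltW l0)).
  - by rewrite AE => x [].
rewrite integral_rint// rint_inv// lee_fin.
have -> : t / (t / (1 + a)) = 1 + a by field; rewrite !gt_eqF.
by apply: le_ln1Dx; lra.
Qed.

(* With t_k the supremum of the radii where T < e^(k+1), the exceptional set consists
   of the intervals [t_k / (1 + a_k), t_k], a_k = 2 / (k (ln k)^(1+e)) being summable:
   a radius r outside them with k <= ln (T r) < k + 1 satisfies r (1 + a_k) < t_k. *)
Theorem borel_growth (e : R) (G : set R) (T : R -> R) : 0 < e ->
  countable [set r | 0 < r /\ ~ G r] ->
  (forall r s, G r -> G s -> r < s -> T r <= T s) ->
  (forall B, exists r, [/\ G r, 1 <= r & B < T r]) ->
  (\forall r \near +oo, G r -> ln (T r) <= r) ->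
  exists E : set R, [/\ E `<=` `[1, +oo[, finite_log_measure E &
    \forall r \near +oo, ~ E r -> G r /\ forall s, G s ->
      s <= r + 2 * (r / (ln r `^ (1 + e) * ln (T r))) -> T s <= expR 1 * T r].
Proof.
move=> e0 cB mono unb gro.
have [g [gg g1 Tg]] := unb (expR 3).
pose S k := [set r | [/\ G r, 1 <= r & T r < expR k.+1%:R]].
have le_mono r s : G r -> G s -> r <= s -> T r <= T s.
  by move=> gr gs; rewrite le_eqVlt => /predU1P[->//|]; exact: mono.
have Sub k : has_ubound (S k).
  have [h [gh h1 Th]] := unb (expR k.+1%:R).
  exists h => r [gr r1 Tr]; rewrite leNgt; apply/negP => hr.
  by have := lt_trans Th (le_lt_trans (mono _ _ gh gr hr) Tr); rewrite ltxx.
pose t k := sup (S k).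
(* Indices start at 3, so that the telescoping sum starts from [ln 2 > 0]; eventually
   [T r > expR 3], which makes the relevant index at least 3. *)
pose J n := `[t (2 + n).+1 / (1 + borel_gap e (2 + n).+1), t (2 + n).+1] `&` `[1, +oo[.
have mJ n : measurable (J n) by apply: measurableI; exact: measurable_itv.
pose N := [set r | 0 < r /\ ~ G r] `&` `[1, +oo[.
exists (N `|` \bigcup_n J n); split.
- by move=> r [[_ //]|[n _ [_ //]]].
- apply: (@finite_log_bigcup J N (fun n => borel_gap e (2 + n).+1) (2 / e * ln 2%:R `^ (- e))) => //.
  + by move=> n r [].
  + exact (sub_countable (subset_card_le (@subIsetl _ _ _)) cB).
  + by move=> r [].
  + by move=> n; apply: (log_measure_gap (mJ n) (borel_gap_ge0 _ _) erefl).
  + by move=> n; exact: borel_gap_sum.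
near=> r => nE.
have rg : g < r by near: r; apply: nbhs_pinfty_gt; exact: num_real.
have r1 : 1 <= r := le_trans g1 (ltW rg).
have r0 : 0 < r by exact: lt_le_trans r1.
have gr : G r.
  by apply: contrapT => nr; apply: nE; left; split; [split|rewrite /= in_itv/= r1].
split=> // s gs sr.
have T3 : expR 3 < T r by exact: lt_le_trans Tg (mono _ _ gg gr rg).
have T0 : 0 < T r by exact: lt_trans T3; exact: expR_gt0.
have L3 : 3 < ln (T r) by rewrite -[ltLHS]expRK ltr_ln ?posrE ?expR_gt0.
have L0 : 0 < ln (T r) by exact: lt_trans L3.
have lr : ln (T r) <= r by move: gr; near: r.
pose k := Num.truncn (ln (T r)).
have /andP[k1 k2] := truncn_itv (ltW L0).
have k3 : (3 <= k)%N by rewrite truncn_ge_nat ?ltW.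
have kE : k = (2 + (k - 3)).+1 by rewrite -addSn subnKC.
have Sr : S k r by split=> //; rewrite -[ltLHS]lnK ?posrE// ltr_expR.
have rt : r <= t k by exact: ub_le_sup.
have a0 := borel_gap_ge0 e k.
have a1 : 0 < 1 + borel_gap e k by lra.
have rt' : r * (1 + borel_gap e k) < t k.
  rewrite ltNge; apply/negP => h; apply: nE; right; exists (k - 3)%N => //.
  rewrite /J -kE; split; last by rewrite /= in_itv/= r1.
  by rewrite /= in_itv/= rt andbT ler_pdivrMr.
have kp : 3 <= k%:R :> R by rewrite ler_nat.
have lk0 : 0 < ln (k%:R : R) by rewrite ln_gt0//; lra.
have lkr : ln (k%:R : R) <= ln r.
  by rewrite ler_ln ?posrE//; [apply: le_trans k1 lr|lra].
have D0 : 0 < k%:R * ln (k%:R : R) `^ (1 + e) by rewrite mulr_gt0 ?powR_gt0//; lra.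
have DD : k%:R * ln (k%:R : R) `^ (1 + e) <= ln r `^ (1 + e) * ln (T r).
  rewrite mulrC; apply: ler_pM; rewrite ?powR_ge0 ?ler0n ?k1//.
  by apply: ge0_ler_powR; rewrite ?nnegrE//; lra.
have st : s < t k.
  apply: le_lt_trans rt'; apply: le_trans sr _.
  rewrite mulrDr mulr1 lerD2l /borel_gap mulrCA ler_pM2l// ler_pM2l//.
  by rewrite lef_pV2 ?posrE// (lt_le_trans D0).
(* Below the supremum [t k] there is a good [q > s] with [T q < expR k.+1], and [expR k <= T r]. *)
have [q [gq q1 Tq] sq] := sup_gt (ex_intro _ _ Sr) st.
apply: le_trans (mono _ _ gs gq sq) _.
apply: le_trans (ltW Tq) _; rewrite -natr1 addrC expRD ler_pM2l ?expR_gt0//.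
by rewrite -[leRHS]lnK ?posrE// ler_expR.
Unshelve. all: by end_near. Qed.

End Borel.

(** * The growth of the shifted quotient *)

Lemma limf_esup_lt (R : realType) (f : R -> \bar R) (k y : \bar R) :
  limf_esup f (pinfty_nbhs R) = k -> (k < y)%E -> \forall r \near +oo, (f r < y)%E.
Proof.
move=> <- /ereal_inf_lt[_ [V FV <-]] supy.
near=> r; apply: le_lt_trans supy; apply: ereal_sup_ubound; exists r => //.
by near: r.
Unshelve. all: by end_near. Qed.

Section Growth.
Variables (R : realType) (w : R[i] -> R[i]) (eps : R).
Hypotheses (mw : meromorphic w) (w0 : exists z, w z != 0) (eps0 : 0 < eps).
Hypothesis unb : forall B, exists r, [/\ good w r, 1 <= r & B < chr w r].

Lemma chr_large B : \forall r \near +oo, good w r -> B < chr w r.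
Proof.
have [g [gg _ Bg]] := unb B.
near=> r => gr; apply: lt_le_trans Bg _; apply: chr_mono => //.
by near: r; apply: nbhs_pinfty_gt; exact: num_real.
Unshelve. all: by end_near. Qed.

Definition step r := r / (ln r `^ (1 + eps) * ln (chr w r)).

Lemma log_scale : \forall r \near +oo, good w r ->
  [/\ 1 <= r, 1 <= ln r `^ (1 + eps) & 2 <= ln (chr w r)].
Proof.
near=> r => gr.
have r3 : expR 1 <= r by near: r; apply: nbhs_pinfty_ge; exact: num_real.
have r1 : 1 <= r by apply: le_trans r3; rewrite -expR0 ler_expR.
have T2 : expR 2 < chr w r by move: gr; near: r; exact: chr_large.
split => //.
  have l1 : 1 <= ln r by rewrite -[leLHS]expRK ler_ln ?posrE ?expR_gt0// (lt_le_trans ltr01).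
  have h0 : 0 <= 1 + eps by rewrite addr_ge0 ?(ltW eps0).
  have := ler_powR l1 h0.
  by rewrite powRr0.
rewrite -[leLHS]expRK ler_ln ?posrE ?expR_gt0//; first exact: ltW.
exact: lt_trans T2; exact: expR_gt0.
Unshelve. all: by end_near. Qed.

Hypothesis hgrowth : limf_esup
   (fun r : R => (ln r `^ (1 + eps))%:E * lne (characteristic r w) / r%:E)%E
   (pinfty_nbhs R) = 0%E.

Lemma step_large K : 0 < K -> \forall r \near +oo, good w r -> K < step r.
Proof.
move=> K0; have Ki : (0 < (K^-1)%:E :> \bar R)%E by rewrite lte_fin invr_gt0.
near=> r => gr.
have [r1 l1 l2] : [/\ 1 <= r, 1 <= ln r `^ (1 + eps) & 2 <= ln (chr w r)].
  by move: gr; near: r; exact: log_scale.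
have r0 : 0 < r by exact: lt_le_trans r1.
have T0 : 0 < chr w r by rewrite ltNge; apply/negP => h; move: l2; rewrite ln0//; lra.
have : ((ln r `^ (1 + eps))%:E * lne (characteristic r w) / r%:E < (K^-1)%:E)%E.
  by near: r; exact: limf_esup_lt hgrowth Ki.
rewrite (chrE mw w0 gr) lne_EFin// inver gt_eqF// -!EFinM lte_fin => h.
have D0 : 0 < ln r `^ (1 + eps) * ln (chr w r) by rewrite mulr_gt0//; lra.
rewrite /step ltr_pdivlMr// mulrC -ltr_pdivlMr//.
by rewrite ltr_pdivrMr// in h; rewrite ltr_pdivlMr// mulrC -ltr_pdivlMl.
Unshelve. all: by end_near. Qed.

Lemma ln_chr_le : \forall r \near +oo, good w r -> ln (chr w r) <= r.
Proof.
near=> r => gr.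
have [r1 l1 l2] : [/\ 1 <= r, 1 <= ln r `^ (1 + eps) & 2 <= ln (chr w r)].
  by move: gr; near: r; exact: log_scale.
have : 1 < step r by move: gr; near: r; exact: step_large.
have D0 : 0 < ln r `^ (1 + eps) * ln (chr w r) by rewrite mulr_gt0//; lra.
rewrite /step ltr_pdivlMr// mul1r => /ltW; apply: le_trans.
by rewrite ler_peMl//; lra.
Unshelve. all: by end_near. Qed.

(** Eventually [g r <= step r] and [step r > 1], so the exponent [delta] may be raised to
    [1 / 2]. *)
Lemma shift_le_sqrt_step (delta : R) (c : R -> R[i]) : 0 < delta -> delta < 1 / 2 ->
  (exists g : R -> R,
       [/\ forall r, 0 <= g r,
           ((g r)%:E /
              (r%:E / ((ln r `^ (1 + eps))%:E * lne (characteristic r w))))%E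
             @[r --> +oo] --> 0%E
         & \forall r \near +oo, cmod (c r) <= g r `^ delta]) ->
  \forall r \near +oo, good w r -> cmod (c r) <= Num.sqrt (step r).
Proof.
move=> d0 d1 [g [g0 hg cg]].
have hg1 : \forall r \near +oo, ((g r)%:E /
    (r%:E / ((ln r `^ (1 + eps))%:E * lne (characteristic r w))) < 1)%E.
  exact: hg (open_ereal_lt' lte01).
near=> r => gr.
have [r1 l1 l2] : [/\ 1 <= r, 1 <= ln r `^ (1 + eps) & 2 <= ln (chr w r)].
  by move: gr; near: r; exact: log_scale.
have r0 : 0 < r by exact: lt_le_trans r1.
have T0 : 0 < chr w r by rewrite ltNge; apply/negP => h; move: l2; rewrite ln0//; lra.
have D0 : 0 < ln r `^ (1 + eps) * ln (chr w r) by rewrite mulr_gt0//; lra.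
have S1 : 1 < step r by move: gr; near: r; exact: step_large.
have S0 : 0 < step r by exact: lt_trans S1.
have gS : g r <= step r.
  have : ((g r)%:E / (r%:E / ((ln r `^ (1 + eps))%:E * lne (characteristic r w))) < 1)%E.
    by near: r.
  rewrite (chrE mw w0 gr) lne_EFin// -EFinM inver gt_eqF// -EFinM inver gt_eqF//.
  by rewrite -EFinM lte_fin ltr_pdivrMr// mul1r => /ltW.
apply: le_trans (_ : g r `^ delta <= _); first by near: r.
apply: le_trans (_ : step r `^ delta <= _).
  by apply: ge0_ler_powR; rewrite ?nnegrE ?(ltW d0) ?(ltW S0).
rewrite -powR12_sqrt ?(ltW S0)//; apply: ler_powR; first exact: ltW.
lra.
Unshelve. all: by end_near. Qed.

End Growth.

Lemma proximity_shift_constant (R : realType) (w : R[i] -> R[i]) (c : R -> R[i])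
    (e r : R) : meromorphic w -> (exists z, w z != 0) -> (forall z, w z = w 0) ->
  0 < e -> 1 <= r ->
  (proximity r (fun z => (w (z + c r) / w z)%R) <= e%:E * characteristic r w)%E.
Proof.
move=> mw w0 wc e0 r1.
have gr : good w r.
  split; first exact: lt_le_trans r1.
  move=> z _; exists 1 => // y _; split; last by have [p] := w0; rewrite !wc.
  exact: (holo_near ltr01 (fun y _ => esym (wc y)) (holo_cst _ _)).
rewrite (chrE mw w0 gr) (_ : (fun z => _) = (fun z => w z / w z)).
  by rewrite proximity_ratio mule_ge0// lee_fin; [exact: ltW|exact: chr_ge0].
by apply/funext => z; rewrite (wc (z + _)) -(wc z).
Qed.

Theorem theorem1p4 (R : realType) (w : R[i] -> R[i]) (eps delta : R)
    (c : R -> R[i])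
    (hw : meromorphic w) (hw0 : exists z, w z != 0)
    (heps : 0 < eps)
    (hgrowth : limf_esup
       (fun r : R => (ln r `^ (1 + eps))%:E * lne (characteristic r w) / r%:E)%E
       (pinfty_nbhs R) = 0%E)
    (hdelta0 : 0 < delta) (hdelta : delta < 1 / 2)
    (hc : exists g : R -> R,
       [/\ forall r, 0 <= g r,
           ((g r)%:E /
              (r%:E / ((ln r `^ (1 + eps))%:E * lne (characteristic r w))))%E
             @[r --> +oo] --> 0%E
         & \forall r \near +oo, cmod (c r) <= g r `^ delta]) :
  exists E : set R,
    [/\ E `<=` `[1, +oo[,
        finite_log_measure E
      & forall e : R, 0 < e -> \forall r \near +oo, ~ E r ->
          (proximity r (fun z => (w (z + c r) / w z)%R)
             <= e%:E * characteristic r w)%E].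
Proof.
have [[B HB]|unb] := pselect (exists B, forall r, good w r -> 1 <= r -> chr w r <= B).
  exists set0; split => //.
    by split; [exact: measurable0|rewrite integral_set0].
  move=> e e0; near=> r => _.
  have r1 : 1 <= r by near: r; apply: nbhs_pinfty_ge; exact: num_real.
  exact: proximity_shift_constant hw hw0 (bounded_chr_const hw hw0 HB) e0 r1.
have {}unb B : exists r, [/\ good w r, 1 <= r & B < chr w r].
  apply: contrapT => H; apply: unb; exists B => r gr r1.
  by rewrite leNgt; apply/negP => Br; apply: H; exists r.
have [E [E1 mE HE]] := borel_growth heps (bad_countable hw hw0)
  (fun r s gr gs => chr_mono hw hw0 gr gs) unb (ln_chr_le hw hw0 heps unb hgrowth).
exists E; split => // e e0.
have [r0 [C [r01 C0 HP]]] := proximity_le_chr hw hw0.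
(* 52 is the constant of the shift estimate, and [2 * expR 1 + 1] bounds [2 * T(rho') + C] in units
   of [T(r)]; it remains to make the square root at most [q = e / A]. *)
pose A : R := 52 * (2 * expR 1 + 1).
have A0 : 0 < A by rewrite mulr_gt0// addr_gt0// mulr_gt0// expR_gt0.
pose q := e / A.
have q0 : 0 < q by rewrite divr_gt0.
(* A lower bound for the square root [y] of the step: 4 ensures that [2 * |c|] is at most [H], and
   [2 / q^2] that [|c| / H <= 2 / y] is at most [q^2]. *)
pose K : R := Num.max 4 (2 / q ^+ 2).
have K4 : 4 <= K by rewrite le_max lexx.
have Kq : 2 / q ^+ 2 <= K by rewrite le_max lexx orbT.
have K0 : 0 < K by lra.
have hS := step_large hw hw0 heps unb hgrowth (mulr_gt0 K0 K0).
have hL := log_scale hw hw0 heps unb.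
have hC := chr_large hw hw0 unb C.
have hc' := shift_le_sqrt_step hw hw0 heps unb hgrowth hdelta0 hdelta hc.
near=> r => nE.
have [gr growth] : good w r /\ forall s, good w s ->
    s <= r + 2 * step w eps r -> chr w s <= expR 1 * chr w r.
  by move: nE; near: r.
have [r1 l1 l2] : [/\ 1 <= r, 1 <= ln r `^ (1 + eps) & 2 <= ln (chr w r)].
  by move: gr; near: r.
have SK : K * K < step w eps r by move: gr; near: r.
have CT : C < chr w r by move: gr; near: r.
have cS : cmod (c r) <= Num.sqrt (step w eps r) by move: gr; near: r.
have r0r : 2 * r0 <= r by near: r; apply: nbhs_pinfty_ge; exact: num_real.
set X := step w eps r in growth SK cS.
pose y := Num.sqrt X.
have X0 : 0 < X by apply: lt_trans SK; rewrite mulr_gt0.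
have y2 : X = y ^+ 2 by rewrite sqr_sqrtr ?ltW.
have yK : K < y.
  by rewrite -(@ltr_pXn2r _ 2) ?nnegrE ?sqrtr_ge0 ?(ltW K0)// -y2 expr2.
have y0 : 0 < y by lra.
(* From [ln (T r) >= 2]; this keeps [rho'] below [2 * r]. *)
have X2 : 2 * X <= r.
  have D0 : 0 < ln r `^ (1 + eps) * ln (chr w r) by rewrite mulr_gt0//; lra.
  rewrite /X /step mulrA ler_pdivrMr// mulrC ler_pM2l; last by lra.
  by apply: (le_trans l2); rewrite ler_peMl// (le_trans _ l2).
pose H := X / 2.
have cH : 2 * cmod (c r) <= H.
  have : 4 * y <= X by rewrite y2 expr2 ler_pM2r//; lra.
  by rewrite /H; move: cS; rewrite -/y; lra.
have H0 : 0 < H by rewrite divr_gt0.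
have rH0 : 0 <= r + H by lra.
have rH1 : r + H < r + 2 * H by lra.
(* Taking [rho] between [r + H] and [r + 2 * H], and [rho'] between [r + 3 * H] and [r + 4 * H],
   leaves room to choose good radii, keeps both gaps at least [H], and stays within the range
   [r + 2 * X] of the growth bound. *)
have [rho [grho rho1 rho2]] := good_between hw hw0 rH0 rH1.
have rH3 : 0 <= r + 3 * H by lra.
have rH4 : r + 3 * H < r + 4 * H by lra.
have [rho' [grho' rho'1 rho'2]] := good_between hw hw0 rH3 rH4.
have HX : 4 * H = 2 * X by rewrite /H; field.
have b1 : r + H <= rho by lra.
have b2 : rho + H <= rho' by lra.
have b3 : rho' <= 2 * r by lra.
have b4 : rho' <= r + 2 * X by lra.
apply: le_trans (HP r rho rho' H (c r) gr grho grho' r0r b1 b2 b3 H0 cH) _.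
rewrite (chrE hw hw0 gr) -EFinM lee_fin.
have T0 : 0 < chr w r by exact: le_lt_trans CT.
have TT : 2 * chr w rho' + C <= (2 * expR 1 + 1) * chr w r.
  by have := growth _ grho' b4; move: (expR 1) => k; lra.
have sq : Num.sqrt (cmod (c r) / H) <= q.
  rewrite -[leRHS]gtr0_norm// -sqrtr_sqr ler_sqrt ?sqr_ge0//.
  rewrite /H y2 ler_pdivrMr ?divr_gt0 ?exprn_gt0//.
  apply: le_trans cS _; rewrite -/y.
  have : 2 / q ^+ 2 < y by exact: le_lt_trans yK.
  rewrite ltr_pdivrMr ?exprn_gt0// => /ltW h.
  have -> : q ^+ 2 * (y ^+ 2 / 2) = y * (y * q ^+ 2 / 2) by field.
  by rewrite ler_peMr ?(ltW y0)// ler_pdivlMr// mul1r.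
have -> : e * chr w r = 52 * q * ((2 * expR 1 + 1) * chr w r).
  by rewrite /q /A; field; rewrite gt_eqF// addr_gt0// mulr_gt0// expR_gt0.
have rho1' : 1 <= rho' by lra.
have l0 : 0 <= 52 * Num.sqrt (cmod (c r) / H) by rewrite mulr_ge0 ?sqrtr_ge0.
have r0' : 0 <= 2 * chr w rho' + C.
  exact: addr_ge0 (mulr_ge0 (ler0n _ _) (chr_ge0 hw hw0 grho' rho1')) C0.
by apply: (ler_pM l0 r0' _ TT); rewrite ler_pM2l.
Unshelve. all: by end_near. Qed.
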